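(* Let $K$ be an algebraically closed field of characteristic $0$. The predegree polynomial of a smooth quadric surface $Q\subset\mathbb{P}^3_K$ is $$1 + 2t + 4t^2 + 8t^3 + 16t^4 + 32t^5 + 64t^6 + 112t^7 + 140t^8 + 40t^9 .$$
   Context: Definition of the predegree polynomial. Let $A$ be an $(n+1)$-dimensional $K$-vector space ($n\ge1$), so $\mathbb{P}A\cong\mathbb{P}^n$ and $\mathbb{P}\operatorname{End}(A)\cong\mathbb{P}^{n^2+2n}$ (projective spaces of lines). Let $X\subset\mathbb{P}A$ be a hypersurface of degree $d$ with equation $f\in\operatorname{Sym}^d(A^\vee)$. The group $\mathbb{P}\operatorname{GL}(A)$ acts on the right on $\mathbb{P}\operatorname{Sym}^d(A^\vee)$ by $X\mapsto X\circ\varphi$, the hypersurface with equation $f(\varphi(\cdot))$. Let $\alpha:\mathbb{P}\operatorname{End}(A)\dashrightarrow\mathbb{P}\operatorname{Sym}^d(A^\vee)$ be the rational map $\varphi\mapsto[f(\varphi(\cdot))]$, and let $\overline{\Gamma}\subset\mathbb{P}\operatorname{End}(A)\times\mathbb{P}\operatorname{Sym}^d(A^\vee)$ be the closure of its graph, with projections $p_1,p_2$ to the two factors. Put $h_1=c_1(\mathcal{O}_{\mathbb{P}\operatorname{End}(A)}(1))$, $h_2=c_1(\mathcal{O}_{\mathbb{P}\operatorname{Sym}^d(A^\vee)}(1))$ and, for $0\le i\le n^2+2n$, $$a_i=\int p_1^*h_1^{\,n^2+2n-i}\,p_2^*h_2^{\,i}\cap[\overline{\Gamma}] .$$ The predegree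 polynomial of $X$ is $\mathcal{P}_X(t)=\sum_{i=0}^{n^2+2n}a_it^i$. In the claim $n=3$ and $d=2$, so $\alpha:\mathbb{P}^{15}\dashrightarrow\mathbb{P}^9$. *)

(* Defs.v *)
From HB Require Import structures.
From Stdlib Require List.
From mathcomp Require Import all_boot all_order all_algebra.
From mathcomp Require Export mpoly.

Set Implicit Arguments.
Unset Strict Implicit.
Unset Printing Implicit Defensive.

Import GRing.Theory.
Local Open Scope ring_scope.

(* Intersection numbers on P^(a-1) x P^(b-1) over a field K, following Fulton:
   c_1(L) ∩ [V] is the class of the Weil divisor on V of any section of L that
   does not vanish identically on V.  A closed subscheme is given by a
   bihomogeneous ideal of K[x_1..x_a, y_1..y_b] = {mpoly K[a + b]}, where
   x_i is the variable lshift b i and y_j is the variable rshift a j. *)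

Definition bideg (a b : nat) (m : 'X_{1..a + b}) : nat * nat :=
  ((\sum_(i < a) m (lshift b i))%N, (\sum_(j < b) m (rshift a j))%N).

Definition bicomp (K : fieldType) (a b : nat) (e : nat * nat)
    (p : {mpoly K[a + b]}) : {mpoly K[a + b]} :=
  \sum_(m <- msupp p | bideg m == e) p@_m *: 'X_[m].

Definition bihomog (K : fieldType) (a b : nat) (e : nat * nat)
    (p : {mpoly K[a + b]}) : Prop :=
  forall m, m \in msupp p -> bideg m = e.

Definition polyset (K : fieldType) (a b : nat) := {mpoly K[a + b]} -> Prop.

Definition subp (K : fieldType) (a b : nat) (I J : polyset K a b) : Prop :=
  forall p, I p -> J p.

Definition samep (K : fieldType) (a b : nat) (I J : polyset K a b) : Prop :=
  subp I J /\ subp J I.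

Definition ssubp (K : fieldType) (a b : nat) (I J : polyset K a b) : Prop :=
  subp I J /\ ~ subp J I.

Definition bihomog_ideal (K : fieldType) (a b : nat) (I : polyset K a b)
    : Prop :=
  [/\ I 0,
      forall p q, I p -> I q -> I (p + q),
      forall p q, I q -> I (p * q)
    & forall p e, I p -> I (bicomp e p)].

(* Integral closed subschemes of P^(a-1) x P^(b-1): bihomogeneous primes
   containing neither all the x_i nor all the y_j. *)
Definition subvariety (K : fieldType) (a b : nat) (V : polyset K a b) : Prop :=
  [/\ bihomog_ideal V,
      ~ V 1,
      forall p q, V (p * q) -> V p \/ V q,
      exists i : 'I_a, ~ V 'X_(lshift b i)
    & exists j : 'I_b, ~ V 'X_(rshift a j)].

(* W is a codimension-one subvariety of V; inclusions of ideals reverse those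
   of subvarieties. *)
Definition prime_divisor (K : fieldType) (a b : nat) (V W : polyset K a b)
    : Prop :=
  [/\ subvariety W, ssubp V W
    & forall Q, subvariety Q -> ~ (ssubp V Q /\ ssubp Q W)].

(* The ideals of the local ring O_W of P^(a-1) x P^(b-1) at the generic point
   of W correspond bijectively, inclusions included, to the bihomogeneous
   ideals J saturated with respect to the bihomogeneous elements outside W:
   inverting those elements yields O_W[s, 1/s, t, 1/t], with s and t of
   bidegrees (1,0) and (0,1).  The unit ideal is included. *)
Definition local_ideal (K : fieldType) (a b : nat) (W J : polyset K a b)
    : Prop :=
  bihomog_ideal J /\
  forall e s p, bihomog e s -> ~ W s -> J (s * p) -> J p.

(* A chain of r + 1 submodules of O_{V,W} / (l). *)
Definition local_chain (K : fieldType) (a b : nat) (V W : polyset K a b)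
    (l : {mpoly K[a + b]}) (r : nat) : Prop :=
  exists J : nat -> polyset K a b,
    (forall i, (i <= r)%N -> [/\ local_ideal W (J i), subp V (J i) & J i l]) /\
    (forall i, (i < r)%N -> ssubp (J i) (J i.+1)).

(* Order of vanishing of l along W: the length of O_{V,W} / (l). *)
Definition is_ord (K : fieldType) (a b : nat) (V W : polyset K a b)
    (l : {mpoly K[a + b]}) (r : nat) : Prop :=
  local_chain V W l r /\ ~ local_chain V W l r.+1.

(* Effective cycles, as formal sums of subvarieties with multiplicities. *)
Definition alg_cycle (K : fieldType) (a b : nat) := seq (nat * polyset K a b).

Definition is_div (K : fieldType) (a b : nat) (V : polyset K a b)
    (l : {mpoly K[a + b]}) (D : alg_cycle K a b) : Prop :=
  [/\ forall c, List.In c D ->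
        [/\ prime_divisor V c.2, c.2 l & is_ord V c.2 l c.1],
      forall W, prime_divisor V W -> W l ->
        exists2 c, List.In c D & samep W c.2
    & List.ForallOrdPairs (fun c c' => ~ samep c.2 c'.2) D].

(* c1_cap e z z': the cycle z' represents c_1(O(e.1, e.2)) ∩ z. *)
Inductive c1_cap (K : fieldType) (a b : nat) (e : nat * nat)
    : alg_cycle K a b -> alg_cycle K a b -> Prop :=
| C1Cap0 : c1_cap e [::] [::]
| C1CapS m V z l D z' :
    bihomog e l -> ~ V l -> is_div V l D -> c1_cap e z z' ->
    c1_cap e ((m, V) :: z) ([seq ((m * c.1)%N, c.2) | c <- D] ++ z').

Definition bipoint (K : fieldType) (a b : nat) (x : 'I_a -> K) (y : 'I_b -> K)
    : 'I_(a + b) -> K :=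
  fun k => match split k with inl i => x i | inr j => y j end.

(* The ideal of the Zariski closure of a set S of points of
   P^(a-1) x P^(b-1), each given by homogeneous coordinates (x, y). *)
Definition vanishing (K : fieldType) (a b : nat)
    (S : ('I_a -> K) -> ('I_b -> K) -> Prop) : polyset K a b :=
  fun p => forall e x y, S x y -> (bicomp e p).@[bipoint x y] = 0.

Definition is_point (K : fieldType) (a b : nat) (V : polyset K a b) : Prop :=
  exists x y, [/\ exists i, x i != 0, exists j, y j != 0
    & samep V (vanishing (fun x' y' => x' = x /\ y' = y))].

(* The degree counts every point once, K being algebraically closed below. *)
Definition degree0 (K : fieldType) (a b : nat) (z : alg_cycle K a b) (n : nat)
    : Prop :=
  (forall c, List.In c z -> is_point c.2) /\ n = sumn [seq c.1 | c <- z].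

(* integral_of [:: e_1; ...; e_r] z n: some choice of sections yields
   n = ∫ c_1(O(e_r)) ... c_1(O(e_1)) ∩ z. *)
Fixpoint integral_of (K : fieldType) (a b : nat) (es : seq (nat * nat))
    (z : alg_cycle K a b) (n : nat) : Prop :=
  if es is e :: es' then exists2 z', c1_cap e z z' & integral_of es' z' n
  else degree0 z n.

(* The number is attained, and does not depend on the choice of sections. *)
Definition intersection_number (K : fieldType) (a b : nat)
    (es : seq (nat * nat)) (V : polyset K a b) (n : nat) : Prop :=
  integral_of es [:: (1%N, V)] n /\
  forall n', integral_of es [:: (1%N, V)] n' -> n' = n.

(* P End(A) for A = K^(n+1), with coordinates the matrix entries (listed by
   mxvec), and P Sym^d(A^v), with coordinates the coefficients of the
   degree-d monomials. *)

Definition form_monoms (n d : nat) : {set 'X_{1..n.+1 < d.+1}} :=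
  [set m : 'X_{1..n.+1 < d.+1} | mdeg m == d].

Definition form_coords (K : fieldType) (n d : nat) (f : {mpoly K[n.+1]})
    : 'I_#|form_monoms n d| -> K :=
  fun j => f@_(bmnm (enum_val j)).

Definition end_coords (K : fieldType) (n : nat) (phi : 'M[K]_n.+1)
    : 'I_(n.+1 * n.+1) -> K :=
  fun k => mxvec phi 0 k.

(* f(phi(.)), with phi acting on column vectors. *)
Definition precomp (K : fieldType) (n : nat) (f : {mpoly K[n.+1]})
    (phi : 'M[K]_n.+1) : {mpoly K[n.+1]} :=
  f \mPo [tuple \sum_(j < n.+1) phi i j *: 'X_j | i < n.+1].

Definition orbit_graph (K : fieldType) (n d : nat) (f : {mpoly K[n.+1]})
    (x : 'I_(n.+1 * n.+1) -> K) (y : 'I_#|form_monoms n d| -> K) : Prop :=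
  exists phi : 'M[K]_n.+1,
    [/\ phi != 0, precomp f phi != 0, x = end_coords phi
      & y = form_coords (precomp f phi)].

Definition graph_closure (K : fieldType) (n d : nat) (f : {mpoly K[n.+1]})
    : polyset K (n.+1 * n.+1) #|form_monoms n d| :=
  vanishing (@orbit_graph K n d f).

(* P is the predegree polynomial of the hypersurface of degree d in P^n with
   equation f; n ^ 2 + 2 * n = dim P End(A). *)
Definition is_predegree_polynomial (K : closedFieldType) (n d : nat)
    (f : {mpoly K[n.+1]}) (P : {poly int}) : Prop :=
  let N := (n ^ 2 + 2 * n)%N in
  exists a : nat -> nat,
    (forall i, (i <= N)%N ->
       intersection_number (nseq i (0%N, 1%N) ++ nseq (N - i) (1%N, 0%N))
         (@graph_closure K n d f) (a i)) /\
    P = \sum_(i < N.+1) (a i)%:Z *: 'X^i.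

Definition smooth_hypersurface (K : fieldType) (n : nat) (f : {mpoly K[n.+1]})
    : Prop :=
  forall x : 'I_n.+1 -> K, (exists i, x i != 0) -> f.@[x] = 0 ->
    exists i, (f^`M(i)).@[x] != 0.

(* Main.v *)
(** Write the quadric as f = L0 L3 - L1 L2 and let V be the closure of the graph.  The numbers
    a_i are limits of the differences of order 15 of the bigraded Hilbert function h of V, and
    h(m, n) = dim A_m F^n, where F is spanned by the coefficients of f(phi z).  Let I be the
    ideal of the base locus, generated by these coefficients as polynomials in phi.  Then
    h(m + 2, n) - h(m, n + 1) is the Hilbert function of V + I, so that c_i = 2 a_i - a_(i+1)
    is a multidegree of the exceptional divisor.  The latter contains two components, one
    for each ruling of the quadric: phi maps to a line of the ruling, phi = tau (x) psi, and
    the conormal direction is any quadratic form psi_0 l_0 + psi_1 l_1 vanishing on the kernel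
    of phi.  Cut such a component repeatedly by coordinate hyperplanes; specializations of its
    parametrization give distinct components of the sections, and counting them bounds the
    multidegrees below by 8, 42, 120, 40 for i = 6, 7, 8, 9, whence c_i >= 16, 84, 240, 80.
    As a_0 <= 1 and all a_i, c_i are nonnegative,
    0 <= a_10 = 2^10 a_0 - sum_(i <= 9) 2^(9 - i) c_i <= 1024 - 1024 forces all equalities. *)

From HB Require Import structures.
From Stdlib Require Import Classical ClassicalEpsilon IndefiniteDescription.
From Stdlib Require Import FunctionalExtensionality PropExtensionality.
From Stdlib Require List.
From mathcomp Require Import all_boot all_order all_fingroup all_algebra.
From mathcomp Require Import zify ring lra.
Require Import Defs.

Set Implicit Arguments.
Unset Strict Implicit.
Unset Printing Implicit Defensive.

Import Order.TTheory GRing.Theory Num.Theory.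
Local Open Scope ring_scope.

(** * Relative dimension *)

(** The definition of an intersection number lets the sections vary and measures multiplicities by
    lengths of chains of ideals. Hilbert functions remove both difficulties: cutting by a form takes
    a difference of the Hilbert function, up to terms of lower degree, whatever the form. Exact
    multidegrees would still require all components of the exceptional divisor with their
    multiplicities. Neither is determined here: the bounds leave no slack because 8 * 16 + 4 * 84 +
    2 * 240 + 80 = 2^10. The numbers have a geometric origin: a component is generically a
    P^6-bundle over the Segre variety P^1 x P^7 of the matrices tau (x) psi, whose degree is 8; a
    general quadric contains two pencils of lines, over each of which these matrices form P^1 x P^1
    x P^3, of degree 20, hence 40 = 2 * 20. Noninclusion of specializations concerns kernels of ring
    morphisms; it becomes decidable by computation because, on the part kept after the four cuts
    y_jj = 0, all coordinates are products of monomials and 2 x 2 determinants. *)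

Section RelDim.
Variables (K : fieldType) (E : lmodType K).
Implicit Types M N L : E -> Prop.

Definition is_sub M := M 0 /\ forall c u v, M u -> M v -> M (c *: u + v).

Definition indep_mod N r (p : 'I_r -> E) :=
  forall c : 'I_r -> K, N (\sum_i c i *: p i) -> forall i, c i = 0.

Definition span_mod M N r (p : 'I_r -> E) :=
  forall v, M v -> exists c : 'I_r -> K, N (v - \sum_i c i *: p i).

(* dim (M / (M :&: N)) = r; nothing is assumed of M, N, in particular not N <= M. *)
Definition dimq M N r := exists p : 'I_r -> E,
  [/\ forall i, M (p i), indep_mod N p & span_mod M N p].

Lemma subD M u v : is_sub M -> M u -> M v -> M (u + v).
Proof. by case=> _ h Mu Mv; rewrite -[u]scale1r; apply: h. Qed.

Lemma subZ M c u : is_sub M -> M u -> M (c *: u).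
Proof. by case=> h0 h Mu; rewrite -[_ *: _]addr0; apply: h. Qed.

Lemma subN M u : is_sub M -> M u -> M (- u).
Proof. by move=> h Mu; rewrite -scaleN1r; apply: subZ. Qed.

Lemma subB M u v : is_sub M -> M u -> M v -> M (u - v).
Proof. by move=> h Mu Mv; apply: subD => //; apply: subN. Qed.

Lemma sub_sum M (I : Type) (s : seq I) (P : pred I) (F : I -> E) :
  is_sub M -> (forall i, P i -> M (F i)) -> M (\sum_(i <- s | P i) F i).
Proof.
move=> h hF; apply: big_ind => //; first by case: h.
by move=> u v; apply: subD.
Qed.

Lemma sub_lin M r (c : 'I_r -> K) (p : 'I_r -> E) :
  is_sub M -> (forall i, M (p i)) -> M (\sum_i c i *: p i).
Proof. by move=> h hp; apply: sub_sum => // i _; apply: subZ. Qed.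

(** Steinitz exchange modulo [N]: if r > s, the r x s coefficient matrix has a nonzero left kernel
    vector, which is a forbidden relation among the [p i]. *)
Lemma exchange N r s (p : 'I_r -> E) (q : 'I_s -> E) :
  is_sub N -> indep_mod N p ->
  (forall i, exists c : 'I_s -> K, N (p i - \sum_j c j *: q j)) -> (r <= s)%N.
Proof.
move=> hN ip /functional_choice[A hA]; rewrite leqNgt; apply/negP=> ltsr.
pose B := \matrix_(i < r, j < s) A i j.
have : kermx B != 0.
  rewrite -mxrank_eq0 mxrank_ker -lt0n subn_gt0.
  by apply: leq_ltn_trans ltsr; apply: rank_leq_col.
case/rowV0Pn=> u /sub_kermxP uB /eqP; apply; apply/rowP=> i; rewrite mxE.
apply: (ip (fun i => u 0 i)) => {i}.
suff -> : \sum_i u 0 i *: p i = \sum_i u 0 i *: (p i - \sum_j A i j *: q j).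
  by apply: sub_sum => // i _; apply: subZ.
have -> : \sum_i u 0 i *: (p i - \sum_j A i j *: q j)
  = \sum_i u 0 i *: p i - \sum_i \sum_j (u 0 i * A i j) *: q j.
  rewrite -sumrB; apply: eq_bigr => i _; rewrite scalerBr scaler_sumr.
  by congr (_ - _); apply: eq_bigr => j _; rewrite scalerA.
rewrite exchange_big /= [X in _ - X]big1 ?subr0 // => j _.
rewrite -scaler_suml; have /rowP/(_ j) := uB; rewrite !mxE => h.
suff -> : \sum_i u 0 i * A i j = 0 by rewrite scale0r.
by rewrite -[RHS]h; apply: eq_bigr => i _; rewrite mxE.
Qed.

Lemma dimq_uniq M N r s : is_sub N -> dimq M N r -> dimq M N s -> r = s.
Proof.
move=> hN [p [Mp ip sp]] [q [Mq iq sq]]; apply/eqP; rewrite eqn_leq.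
by apply/andP; split; [apply: (exchange hN ip) | apply: (exchange hN iq)];
  move=> i; [apply: sq | apply: sp].
Qed.

Lemma max_nat (P : nat -> Prop) s :
  P 0%N -> (forall r, P r -> (r <= s)%N) -> exists r, P r /\ ~ P r.+1.
Proof.
move=> P0 hP; apply: NNPP => hn.
have : forall r, P r by elim=> // r Pr; apply: NNPP => h; apply: hn; exists r.
by move/(_ s.+1)/hP; rewrite ltnn.
Qed.

Lemma dimq_ex M N s (q : 'I_s -> E) :
  is_sub N -> span_mod M N q -> exists r, dimq M N r.
Proof.
move=> hN sq.
pose P r := exists p : 'I_r -> E, (forall i, M (p i)) /\ indep_mod N p.
have [||r [[p [Mp ip]] hr]] := @max_nat P s.
- by exists (fun=> 0); split=> [[]|c _ []].
- by move=> r [p [Mp ip]]; apply: (exchange hN ip) => i; apply: sq.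
exists r, p; split=> // v Mv; apply: NNPP => hv; apply: hr.
exists (fun i => oapp p v (unlift ord_max i)); split=> [i|c].
  by case: unliftP => [j _|_] /=.
rewrite (bigD1_ord ord_max) //= unlift_none /= => hc.
have eqs : \sum_(i < r) c (lift ord_max i) *: oapp p v (unlift ord_max (lift ord_max i))
   = \sum_(i < r) c (lift ord_max i) *: p i.
  by apply: eq_bigr => i _; rewrite liftK.
rewrite eqs in hc.
have c0 : c ord_max = 0.
  apply/eqP/negP=> /negP cn; apply: hv.
  exists (fun i => - (c ord_max)^-1 * c (lift ord_max i)).
  have -> : v - \sum_i (- (c ord_max)^-1 * c (lift ord_max i)) *: p i
    = (c ord_max)^-1 *: (c ord_max *: v + \sum_i c (lift ord_max i) *: p i).
    rewrite scalerDr scalerA mulVf // scale1r scaler_sumr -sumrN; congr (_ + _).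
    by apply: eq_bigr => i _; rewrite mulNr scaleNr opprK scalerA.
  exact: subZ.
rewrite c0 scale0r add0r in hc.
by move=> i; case: (unliftP ord_max i) => [j ->|->//]; apply: (ip (fun j => c (lift ord_max j))).
Qed.

Lemma dimq_le M N s (q : 'I_s -> E) r :
  is_sub N -> span_mod M N q -> dimq M N r -> (r <= s)%N.
Proof. by move=> hN sq [p [Mp ip sp]]; apply: (exchange hN ip) => i; apply: sq. Qed.

Lemma dimq_add M N L r s :
  is_sub N -> is_sub L -> (forall v, N v -> M v) -> (forall v, L v -> N v) ->
  dimq M N r -> dimq N L s -> dimq M L (r + s).
Proof.
move=> hN hL NM LN [p [Mp ip sp]] [q [Nq iq sq]].
pose f i := match split i with inl j => p j | inr j => q j end.
have fl i : f (lshift s i) = p i by rewrite /f (unsplitK (inl i)).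
have fr i : f (rshift r i) = q i by rewrite /f (unsplitK (inr i)).
have fsum (c : 'I_(r + s) -> K) : \sum_i c i *: f i
   = \sum_i c (lshift s i) *: p i + \sum_i c (rshift r i) *: q i.
  rewrite big_split_ord /=; congr (_ + _); apply: eq_bigr => i _.
    by rewrite fl.
  by rewrite fr.
exists f; split=> [i|c|v Mv].
- by rewrite /f; case: split => j //; apply/NM/Nq.
- rewrite fsum => h.
  have h2 : N (\sum_i c (rshift r i) *: q i) by apply: sub_lin.
  have h1 := ip _ (eq_ind _ N (subB hN (LN _ h) h2) _ (addrK _ _)).
  have h3 := iq (fun i => c (rshift r i)).
  rewrite big1 ?add0r in h; last by move=> i _; rewrite h1 scale0r.
  move=> i; rewrite -(splitK i); case: (split i) => j /=; first exact: h1.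
  exact: h3.
- have [c hc] := sp _ Mv; have [d hd] := sq _ hc.
  exists (fun i => match split i with inl j => c j | inr j => d j end).
  rewrite fsum; set u := \sum_i _; set w := (X in _ - (_ + X)).
  suff [-> ->] : u = \sum_i c i *: p i /\ w = \sum_i d i *: q i by rewrite opprD addrA.
  split; apply: eq_bigr => i _; first by rewrite (unsplitK (inl i)).
  by rewrite (unsplitK (inr i)).
Qed.

Lemma dimq_ext M N M' N' r : (forall v, M v <-> M' v) ->
  (forall v, M v -> (N v <-> N' v)) -> is_sub M ->
  dimq M N r -> dimq M' N' r.
Proof.
move=> hM hN sM [p [Mp ip sp]]; exists p; split=> [i|c h|v].
- by apply/hM.
- by apply: ip; apply/hN => //; apply: sub_lin.
- move/hM=> Mv; have [c hc] := sp _ Mv; exists c; apply/hN => //.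
  by apply: subB => //; apply: sub_lin.
Qed.

End RelDim.

Section RelDimMap.
Variables (K : fieldType) (E F : lmodType K) (T : E -> F).
Hypothesis Tlin : forall c u v, T (c *: u + v) = c *: T u + T v.

Lemma lin0 : T 0 = 0.
Proof.
have := Tlin (-1) 0 0; rewrite scaleN1r scaleN1r addNr => ->.
by rewrite addNr.
Qed.

Lemma linsum r (c : 'I_r -> K) (p : 'I_r -> E) :
  T (\sum_i c i *: p i) = \sum_i c i *: T (p i).
Proof.
elim: r c p => [|r IH] c p; first by rewrite !big_ord0 lin0.
by rewrite !big_ord_recl Tlin IH.
Qed.

Lemma linB u v : T (u - v) = T u - T v.
Proof. by rewrite addrC -scaleN1r Tlin scaleN1r addrC. Qed.

(** The hypotheses say that [T] induces an isomorphism from M / (M :&: N) onto M' / (M' :&: N'). *)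
Lemma dimq_map (M N : E -> Prop) (M' N' : F -> Prop) r :
  is_sub M -> is_sub N' ->
  (forall v, M v -> M' (T v)) ->
  (forall w, M' w -> exists2 v, M v & N' (w - T v)) ->
  (forall v, M v -> (N v <-> N' (T v))) ->
  dimq M N r -> dimq M' N' r.
Proof.
move=> hM hN' MM' surj hN [p [Mp ip sp]]; exists (T \o p); split=> [i|c h|w M'w] /=.
- exact: MM'.
- apply: ip; apply/hN; first exact: sub_lin.
  by rewrite linsum.
- have [v Mv hv] := surj _ M'w; have [c hc] := sp _ Mv; exists c.
  move/(hN _ (subB hM Mv (sub_lin c hM Mp))): hc; rewrite linB linsum => hc.
  by have := subD hN' hv hc; rewrite addrA subrK.
Qed.

Lemma dimq_inj_le (M N : E -> Prop) (M' N' : F -> Prop) r s :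
  is_sub M -> is_sub N' ->
  (forall v, M v -> M' (T v)) ->
  (forall v, M v -> N' (T v) -> N v) ->
  dimq M N r -> dimq M' N' s -> (r <= s)%N.
Proof.
move=> hM hN' MM' hN [p [Mp ip sp]] [q [Mq iq sq]].
apply: (@exchange _ _ N' r s (T \o p) q) => // [c|i]; last by apply: sq; apply: MM'.
by rewrite -linsum => h; apply: ip; apply: hN => //; apply: sub_lin.
Qed.
End RelDimMap.

(** * Bigraded ideals and Hilbert functions *)

Section Bigraded.
Variables (K : fieldType) (a b : nat).
Local Notation S := {mpoly K[a + b]}.
Implicit Types (p q s : S) (e d : nat * nat) (J : polyset K a b).

Definition addb e d : nat * nat := ((e.1 + d.1)%N, (e.2 + d.2)%N).

Lemma bidegD (m m' : 'X_{1..a + b}) : bideg (m + m')%MM = addb (bideg m) (bideg m').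
Proof.
by rewrite /bideg /addb /= -!big_split /=; congr pair; apply: eq_bigr => i _;
  rewrite mnmDE.
Qed.

Lemma bideg0 : bideg (0%MM : 'X_{1..a + b}) = (0%N, 0%N).
Proof. by rewrite /bideg !big1 // => i _; rewrite mnm0E. Qed.

Lemma bidegx (i : 'I_a) : bideg U_(lshift b i)%MM = (1%N, 0%N).
Proof.
rewrite /bideg (bigD1 i) //= mnm1E eqxx !big1 ?addn0 // => j.
  by rewrite mnm1E eq_lrshift.
by move=> ji; rewrite mnm1E eq_lshift eq_sym (negPf ji).
Qed.

Lemma bidegy (j : 'I_b) : bideg U_(rshift a j)%MM = (0%N, 1%N).
Proof.
rewrite /bideg [in X in (_, X)](bigD1 j) //= mnm1E eqxx !big1 ?addn0 // => i.
  by move=> ji; rewrite mnm1E eq_rshift eq_sym (negPf ji).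
by rewrite mnm1E eq_rlshift.
Qed.

Lemma mdeg_bideg (m : 'X_{1..a + b}) : mdeg m = ((bideg m).1 + (bideg m).2)%N.
Proof. by rewrite mdegE big_split_ord. Qed.

Lemma mcoeff_bicomp e p m : (bicomp e p)@_m = if bideg m == e then p@_m else 0.
Proof.
rewrite /bicomp raddf_sum /=.
under eq_bigr => i _ do rewrite mcoeffZ mcoeffX.
case: ifP => [me|me].
  have [mp|mp] := boolP (m \in msupp p); last first.
    rewrite (memN_msupp_eq0 mp) big_seq_cond big1 // => i /andP[ip _].
    by case: eqP ip => [->|]; rewrite ?mulr0 // (negPf mp).
  rewrite (big_rem m mp) /= me eqxx mulr1 big_seq_cond big1 ?addr0 // => i /andP[].
  by rewrite mem_rem_uniq ?msupp_uniq // inE => /andP[/negPf->]; rewrite mulr0.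
rewrite big1 // => i /eqP ie; case: eqP => [im|]; rewrite ?mulr0 //.
by rewrite -im ie eqxx in me.
Qed.

Lemma bihomogP e p : bihomog e p <-> (forall m, bideg m != e -> p@_m = 0).
Proof.
split=> h m; first by apply: contraNeq; rewrite -mcoeff_msupp => /h ->.
by rewrite mcoeff_msupp => pm; apply/eqP; apply: contraNT pm => /h ->.
Qed.

Lemma bicomp_bihomog e p : bihomog e (bicomp e p).
Proof. by apply/bihomogP => m /negPf me; rewrite mcoeff_bicomp me. Qed.

Arguments bicomp_bihomog : clear implicits.

Lemma bicomp_id e p : bihomog e p -> bicomp e p = p.
Proof.
move/bihomogP=> h; apply/mpolyP=> m; rewrite mcoeff_bicomp; case: eqP => // /eqP.
by move/h->.
Qed.

Lemma bicomp_neq e d p : bihomog e p -> e != d -> bicomp d p = 0.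
Proof.
move/bihomogP=> h ed; apply/mpolyP=> m; rewrite mcoeff_bicomp mcoeff0.
by case: eqP => // md; rewrite h // md eq_sym.
Qed.

Lemma bicomp_lin e c p q : bicomp e (c *: p + q) = c *: bicomp e p + bicomp e q.
Proof.
apply/mpolyP=> m; rewrite mcoeffD mcoeffZ !mcoeff_bicomp mcoeffD mcoeffZ.
by case: ifP => //; rewrite mulr0 addr0.
Qed.

Lemma bicomp0 e : bicomp e (0 : S) = 0.
Proof. exact: (lin0 (bicomp_lin e)). Qed.

Lemma bicompD e p q : bicomp e (p + q) = bicomp e p + bicomp e q.
Proof. by rewrite -[p]scale1r bicomp_lin !scale1r. Qed.

Lemma bicompB e p q : bicomp e (p - q) = bicomp e p - bicomp e q.
Proof. exact: (linB (bicomp_lin e)). Qed.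

Lemma bicomp_sum e I (r : seq I) (P : pred I) (F : I -> S) :
  bicomp e (\sum_(i <- r | P i) F i) = \sum_(i <- r | P i) bicomp e (F i).
Proof. exact: (big_morph _ (bicompD e) (bicomp0 e)). Qed.

Definition bidegs p : seq (nat * nat) := undup [seq bideg m | m <- msupp p].

Lemma bicomp_sumE p : p = \sum_(e <- bidegs p) bicomp e p.
Proof.
apply/mpolyP=> m; rewrite raddf_sum /=.
under eq_bigr => e _ do rewrite mcoeff_bicomp.
have [pm|pm] := boolP (m \in msupp p); last first.
  by rewrite (memN_msupp_eq0 pm) big1 // => e _; case: ifP.
have pe : bideg m \in bidegs p by rewrite mem_undup map_f.
rewrite (bigD1_seq (bideg m)) ?undup_uniq //= eqxx big1 ?addr0 // => e.
by rewrite eq_sym => /negPf->.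
Qed.

Lemma bihomog_sub e : is_sub (bihomog e : S -> Prop).
Proof.
split=> [m|c p q /bihomogP hp /bihomogP hq]; first by rewrite msupp0.
by apply/bihomogP=> m me; rewrite mcoeffD mcoeffZ hp // hq // mulr0 addr0.
Qed.

Lemma bihomogM e d p q : bihomog e p -> bihomog d q -> bihomog (addb e d) (p * q).
Proof.
move=> hp hq m /msuppM_le /allpairsP[[m1 m2] /= [h1 h2 ->]].
by rewrite bidegD (hp _ h1) (hq _ h2).
Qed.

Lemma bihomogX e m : bideg m = e -> bihomog e ('X_[m] : S).
Proof. by move=> me m'; rewrite msuppX inE => /eqP->. Qed.

Lemma bihomog_x i : bihomog (1%N, 0%N) ('X_(lshift b i) : S).
Proof. exact/bihomogX/bidegx. Qed.

Lemma bihomog_y j : bihomog (0%N, 1%N) ('X_(rshift a j) : S).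
Proof. exact/bihomogX/bidegy. Qed.

Lemma bihomog1 : bihomog (0%N, 0%N) (1 : S).
Proof. by rewrite -mpolyX0; apply/bihomogX/bideg0. Qed.

Lemma addb_inj e d d' : addb e d = addb e d' -> d = d'.
Proof. by case: d d' => [? ?] [? ?] [/addnI-> /addnI->]. Qed.

Lemma bicompM e d s p : bihomog e s -> bicomp (addb e d) (s * p) = s * bicomp d p.
Proof.
move=> hs; rewrite {1}(bicomp_sumE p) mulr_sumr bicomp_sum.
have hb d' : bihomog (addb e d') (s * bicomp d' p) := bihomogM hs (bicomp_bihomog _ _).
have [dp|dp] := boolP (d \in bidegs p); last first.
  have -> : bicomp d p = 0.
    apply/mpolyP=> m; rewrite mcoeff_bicomp mcoeff0; case: eqP => // md.
    apply: memN_msupp_eq0; apply: contra dp => mp.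
    by rewrite mem_undup -md map_f.
  rewrite mulr0 big_seq big1 // => d' d'p; apply: bicomp_neq (hb d') _.
  by apply: contraNneq dp => /addb_inj <-.
rewrite (bigD1_seq d) ?undup_uniq //= (bicomp_id (hb d)) big1 ?addr0 // => d' dd'.
by apply: bicomp_neq (hb d') _; apply: contraNneq dd' => /addb_inj ->.
Qed.

Lemma bideg_gt0 (m : 'X_{1..a + b}) e : bideg m = (e.1, e.2.+1) ->
  exists j : 'I_b, (0 < m (rshift a j))%N.
Proof.
move=> [_ h]; have /eqP : (\sum_(j < b) m (rshift a j))%N != 0%N by rewrite h.
move=> h0; apply: NNPP => hn; apply: h0; apply: big1 => j _.
by apply/eqP; rewrite -leqn0 leqNgt; apply/negP => ?; apply: hn; exists j.
Qed.

Lemma bideg_span e : exists r, exists q : 'I_r -> S,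
  forall v, bihomog e v -> exists c : 'I_r -> K, v = \sum_i c i *: q i.
Proof.
pose k := (e.1 + e.2).+1.
pose val (i : 'I_#|{: bmultinom (a + b) k}|) := bmnm (enum_val i).
exists #|{: bmultinom (a + b) k}|, (fun i => 'X_[val i]) => v hv.
exists (fun i => v@_(val i)).
rewrite [LHS](@mpolywE _ _ k); last first.
  rewrite msizeE; apply/bigmax_leqP_seq => m mv _.
  by rewrite mdeg_bideg (hv _ mv).
by rewrite (reindex _ (onW_bij _ (enum_val_bij _))).
Qed.

Lemma ideal_sub J : bihomog_ideal J -> is_sub J.
Proof.
case=> J0 JD JM _; split=> // c p q Jp Jq; apply: JD => //.
by rewrite -mul_mpolyC; apply: JM.
Qed.

Lemma hil_ex J e : is_sub J -> exists r, dimq (bihomog e) J r.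
Proof.
move=> hJ; have [s [q hq]] := bideg_span e.
apply: (@dimq_ex _ _ _ _ s q) => // v /hq[c ->]; exists c; rewrite subrr.
by case: hJ.
Qed.

(* The Hilbert function of S / J. *)
Definition hil J (m n : nat) : nat := epsilon (inhabits 0%N) (dimq (bihomog (m, n)) J).

Lemma hilP J m n : bihomog_ideal J -> dimq (bihomog (m, n)) J (hil J m n).
Proof. by move=> /ideal_sub hJ; apply: epsilon_spec (hil_ex _ hJ). Qed.

Lemma hil_eq J m n r : bihomog_ideal J -> dimq (bihomog (m, n)) J r -> hil J m n = r.
Proof. by move=> hJ; apply: dimq_uniq (ideal_sub hJ) (hilP _ _ hJ). Qed.

Definition addi J s : polyset K a b := fun p => exists u, exists2 c, J u & p = u + c * s.
Definition colon J s : polyset K a b := fun p => J (p * s).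

Lemma addi_ideal J d s : bihomog_ideal J -> bihomog d s -> bihomog_ideal (addi J s).
Proof.
move=> [J0 JD JM JC] hs; split.
- by exists 0, 0 => //; rewrite mul0r addr0.
- move=> _ _ [u [c Ju ->]] [v [c' Jv ->]]; exists (u + v), (c + c'); first exact: JD.
  by rewrite mulrDl addrACA.
- move=> r _ [u [c Ju ->]]; exists (r * u), (r * c); first exact: JM.
  by rewrite mulrDr mulrA.
- move=> _ e [u [c Ju ->]]; rewrite bicompD mulrC.
  rewrite {1}(bicomp_sumE c) mulr_sumr bicomp_sum.
  pose f d' := if addb d d' == e then bicomp d' c else 0.
  exists (bicomp e u), (\sum_(d' <- bidegs c) f d'); first exact: JC.
  rewrite mulr_suml; congr (_ + _); apply: eq_bigr => d' _; rewrite /f.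
  have hb : bihomog (addb d d') (s * bicomp d' c) := bihomogM hs (bicomp_bihomog _ _).
  case: eqP => [<-|/eqP h]; first by rewrite (bicomp_id hb) mulrC.
  by rewrite mul0r (bicomp_neq hb).
Qed.

Lemma colon_ideal J d s : bihomog_ideal J -> bihomog d s -> bihomog_ideal (colon J s).
Proof.
move=> [J0 JD JM JC] hs; split=> [|p q|p q|p e]; rewrite /colon.
- by rewrite mul0r.
- by rewrite mulrDl; apply: JD.
- by rewrite -mulrA; apply: JM.
- by move=> h; rewrite mulrC -(bicompM _ _ hs) mulrC; apply: JC.
Qed.

Lemma addi_sub J s : subp J (addi J s).
Proof. by move=> p Jp; exists p, 0; rewrite // mul0r addr0. Qed.

Lemma addi_in J s : J 0 -> addi J s s.
Proof. by move=> J0; exists 0, 1; rewrite // mul1r add0r. Qed.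

Lemma addi_min J s J' : bihomog_ideal J' -> subp J J' -> J' s -> subp (addi J s) J'.
Proof. by move=> [_ hD hM _] JJ' J's _ [u [c Ju ->]]; apply: hD (JJ' _ Ju) (hM _ _ J's). Qed.

Lemma colon_sub J s : bihomog_ideal J -> subp J (colon J s).
Proof. by move=> [_ _ hM _] p Jp; rewrite /colon mulrC; apply: hM. Qed.

(** Additivity on the exact sequence 0 -> S/(J : s) (-d) -> S/J -> S/(J + s) -> 0, whose first map
    is multiplication by [s]. *)
Lemma hil_addi J d s m n : bihomog_ideal J -> bihomog d s ->
  hil J (d.1 + m) (d.2 + n) = (hil (addi J s) (d.1 + m) (d.2 + n) + hil (colon J s) m n)%N.
Proof.
move=> hJ hs; apply: hil_eq => //.
have hA := addi_ideal hJ hs; have hC := colon_ideal hJ hs.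
set e := ((d.1 + m)%N, (d.2 + n)%N); have eE : e = addb d (m, n) by [].
have sS := bihomog_sub e; have sA := ideal_sub hA; have sJ := ideal_sub hJ.
pose N v := bihomog e v /\ addi J s v.
pose L v := bihomog e v /\ J v.
have sL : is_sub L.
  split=> [|c p q [p1 p2] [q1 q2]]; first by split; [case: sS|case: sJ].
  by split; [case: sS => _; apply|case: sJ => _; apply].
have sN : is_sub N.
  split=> [|c p q [p1 p2] [q1 q2]]; first by split; [case: sS|case: sA].
  by split; [case: sS => _; apply|case: sA => _; apply].
have h1 : dimq (bihomog e) N (hil (addi J s) (d.1 + m) (d.2 + n)).
  by apply: dimq_ext (hilP _ _ hA) => // v hv; split=> [|[]].
have h2 : dimq N L (hil (colon J s) m n).
  apply: (@dimq_map _ _ _ (fun p => p * s)) (hilP m n hC) => //.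
  - by move=> c u v; rewrite mulrDl scalerAl.
  - exact: bihomog_sub.
  - move=> v hv; split; first by rewrite mulrC eE; apply: bihomogM.
    by exists 0, v; rewrite ?add0r //; case: hJ.
  - move=> w [hw [u [c Ju wE]]]; exists (bicomp (m, n) c); first exact: bicomp_bihomog.
    have -> : w - bicomp (m, n) c * s = bicomp e u.
      rewrite -(bicomp_id hw) wE bicompD [c * s]mulrC eE (bicompM _ _ hs).
      by rewrite [_ * s]mulrC addrK.
    by split; [apply: bicomp_bihomog | case: hJ => _ _ _; apply].
  - move=> v hv; split=> [h|[]//]; split=> //.
    by rewrite mulrC eE; apply: bihomogM.
have LN v : L v -> N v by move=> [hv Jv]; split=> //; apply: addi_sub.
apply: dimq_ext (dimq_add sN sL (fun v h => proj1 h) LN h1 h2) => // v hv.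
by split=> [[]|].
Qed.

Lemma hil_mono J J' m n : bihomog_ideal J -> bihomog_ideal J' -> subp J J' ->
  (hil J' m n <= hil J m n)%N.
Proof.
move=> hJ hJ' JJ'; have [p [Mp ip sp]] := hilP m n hJ'.
have [q [Mq iq sq]] := hilP m n hJ.
apply: (exchange (ideal_sub hJ') ip) => i; have [c hc] := sq _ (Mp i).
by exists c; exact: (JJ' _ hc).
Qed.

End Bigraded.
Arguments bicomp_bihomog {K a b} e p.
Arguments bihomog_sub {K a b} e.

(** * Differences of eventually polynomial functions *)

Section Differences.
Implicit Types (f g : nat -> nat -> int) (e d : nat * nat) (es : seq (nat * nat)).

Definition delta e g : nat -> nat -> int :=
  fun m n => g (e.1 + m)%N (e.2 + n)%N - g m n.

Fixpoint deltas es g := if es is e :: es' then deltas es' (delta e g) else g.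

Definition eqv f g := exists N : nat, forall m n, (N <= m)%N -> (N <= n)%N -> f m n = g m n.

Definition shift e g : nat -> nat -> int := fun m n => g (e.1 + m)%N (e.2 + n)%N.
Definition addf f g : nat -> nat -> int := fun m n => f m n + g m n.
Definition subf f g : nat -> nat -> int := fun m n => f m n - g m n.
Definition scalef (c : int) g : nat -> nat -> int := fun m n => c * g m n.
Definition cstf (c : int) : nat -> nat -> int := fun _ _ => c.

(* g is eventually a polynomial of total degree < k. *)
Fixpoint EP k g := if k is k'.+1 then EP k' (delta (1, 0)%N g) /\ EP k' (delta (0, 1)%N g)
  else eqv g (cstf 0).

Lemma eqv_refl g : eqv g g. Proof. by exists 0%N. Qed.

Lemma eqv_sym f g : eqv f g -> eqv g f.
Proof. by case=> N h; exists N => m n ? ?; rewrite h. Qed.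

Lemma eqv_trans f g h : eqv f g -> eqv g h -> eqv f h.
Proof.
case=> N h1 [M h2]; exists (maxn N M) => m n hm hn.
by rewrite h1 ?h2 // ?(leq_trans _ hm) ?(leq_trans _ hn) // (leq_maxl, leq_maxr).
Qed.

Lemma eqv_op (op : int -> int -> int) f f' g g' : eqv f f' -> eqv g g' ->
  eqv (fun m n => op (f m n) (g m n)) (fun m n => op (f' m n) (g' m n)).
Proof.
case=> N h1 [M h2]; exists (maxn N M) => m n hm hn.
by rewrite h1 ?h2 // ?(leq_trans _ hm) ?(leq_trans _ hn) // (leq_maxl, leq_maxr).
Qed.

Lemma eqv_shift e f g : eqv f g -> eqv (shift e f) (shift e g).
Proof.
by case=> N h; exists N => m n hm hn; apply: h; apply: leq_trans (leq_addl _ _).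
Qed.

Lemma eqv_delta e f g : eqv f g -> eqv (delta e f) (delta e g).
Proof. by move=> h; apply: (eqv_op (fun x y => x - y) (eqv_shift e h) h). Qed.

Lemma eqv_deltas es f g : eqv f g -> eqv (deltas es f) (deltas es g).
Proof. by elim: es f g => //= e es IH f g h; apply/IH/eqv_delta. Qed.

Lemma delta_add e f g : delta e (addf f g) = addf (delta e f) (delta e g).
Proof. by do 2![apply: functional_extensionality => ?]; rewrite /delta /addf; ring. Qed.

Lemma delta_sub e f g : delta e (subf f g) = subf (delta e f) (delta e g).
Proof. by do 2![apply: functional_extensionality => ?]; rewrite /delta /subf; ring. Qed.

Lemma delta_scale e c g : delta e (scalef c g) = scalef c (delta e g).
Proof. by do 2![apply: functional_extensionality => ?]; rewrite /delta /scalef; ring. Qed.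

Lemma delta_shift e d g : delta e (shift d g) = shift d (delta e g).
Proof.
do 2![apply: functional_extensionality => ?]; rewrite /delta /shift /=.
by rewrite addnCA [(d.2 + (e.2 + _))%N]addnCA.
Qed.

Lemma deltaC e d g : delta e (delta d g) = delta d (delta e g).
Proof.
do 2![apply: functional_extensionality => ?]; rewrite /delta.
by rewrite (addnCA e.1 d.1) (addnCA e.2 d.2); ring.
Qed.

Lemma deltas_add es f g : deltas es (addf f g) = addf (deltas es f) (deltas es g).
Proof. by elim: es f g => //= e es IH f g; rewrite delta_add IH. Qed.

Lemma deltas_sub es f g : deltas es (subf f g) = subf (deltas es f) (deltas es g).
Proof. by elim: es f g => //= e es IH f g; rewrite delta_sub IH. Qed.

Lemma deltas_shift es d g : deltas es (shift d g) = shift d (deltas es g).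
Proof. by elim: es g => //= e es IH g; rewrite delta_shift IH. Qed.

Lemma deltas_delta es e g : deltas es (delta e g) = delta e (deltas es g).
Proof. by elim: es g => //= d es IH g; rewrite deltaC IH. Qed.

Lemma deltas_cat es es' g : deltas (es ++ es') g = deltas es' (deltas es g).
Proof. by elim: es g => //=. Qed.

Lemma delta0 e c : delta e (cstf c) = cstf 0.
Proof. by do 2![apply: functional_extensionality => ?]; rewrite /delta /cstf subrr. Qed.

Lemma EP_eqv k f g : eqv f g -> EP k f -> EP k g.
Proof.
elim: k f g => [|k IH] f g fg /=; first by apply: eqv_trans; apply: eqv_sym.
by case=> h1 h2; split; [apply: IH h1|apply: IH h2]; apply: eqv_delta.
Qed.

Lemma EP_add k f g : EP k f -> EP k g -> EP k (addf f g).
Proof.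
elim: k f g => [|k IH] f g /=.
  move=> h1 h2; have := eqv_op +%R h1 h2; rewrite -/(addf f g) => h.
  by apply: eqv_trans h _; exists 0%N => m n _ _; rewrite /cstf addr0.
by move=> [? ?] [? ?]; rewrite !delta_add; split; apply: IH.
Qed.

Lemma EP_scale k c g : EP k g -> EP k (scalef c g).
Proof.
elim: k g => [|k IH] g /=.
  by case=> N h; exists N => m n hm hn; rewrite /scalef h // /cstf mulr0.
by move=> [? ?]; rewrite !delta_scale; split; apply: IH.
Qed.

Lemma EP_sub k f g : EP k f -> EP k g -> EP k (subf f g).
Proof.
move=> hf hg; apply: EP_eqv (EP_add hf (EP_scale (-1) hg)).
by exists 0%N => m n _ _; rewrite /addf /scalef /subf mulN1r.
Qed.

Lemma EP_shift k d g : EP k g -> EP k (shift d g).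
Proof.
elim: k g => [|k IH] g /=; first exact: (eqv_shift d).
by move=> [? ?]; rewrite !delta_shift; split; apply: IH.
Qed.

Lemma eqv_unshift d g c : eqv (shift d g) (cstf c) -> eqv g (cstf c).
Proof.
case=> N h; exists (N + d.1 + d.2)%N => m n hm hn.
have := h (m - d.1)%N (n - d.2)%N; rewrite /shift !subnKC; first by apply; lia.
  by lia.
by lia.
Qed.

Lemma EP_unshift k d g : EP k (shift d g) -> EP k g.
Proof.
elim: k g => [|k IH] g /=; first exact: eqv_unshift.
by rewrite !delta_shift => -[? ?]; split; apply: IH.
Qed.

Lemma EP_S k g : EP k g -> EP k.+1 g.
Proof.
elim: k g => [|k IH] g; last by case=> h1 h2; split; apply: IH.
by move=> h; split; apply: eqv_trans (eqv_delta _ h) _; rewrite delta0; apply: eqv_refl.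
Qed.

Lemma EP_le k l g : (k <= l)%N -> EP k g -> EP l g.
Proof.
elim: l => [|l IH]; first by rewrite leqn0 => /eqP->.
by rewrite leq_eqVlt => /orP[/eqP->//|/IH h /h]; apply: EP_S.
Qed.

(** The step [e] is a path of unit steps along the two axes, so its difference is a sum of shifts of
    the two unit differences. *)
Lemma EP_delta k e g : EP k.+1 g -> EP k (delta e g).
Proof.
case: e => e1 e2 [h1 h2].
have hy : EP k (delta (0, e2)%N g).
  elim: e2 => [|e2 IH].
    apply: EP_eqv (EP_scale 0 h2); exists 0%N => m n _ _.
    by rewrite /scalef mul0r /delta subrr.
  apply: EP_eqv (EP_add IH (EP_shift (0, e2)%N h2)); exists 0%N => m n _ _.
  by rewrite /addf /shift /delta /= !add0n addnA add1n; ring.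
elim: e1 => [//|e1 IH].
apply: EP_eqv (EP_add IH (EP_shift (e1, e2)%N h1)); exists 0%N => m n _ _.
by rewrite /addf /shift /delta /= !add0n addnA add1n; ring.
Qed.

(* If g has degree at most size es, then c is a mixed coefficient of its leading form,
   normalized as an intersection number of divisors of bidegrees es. *)
Definition dlim es g c := eqv (deltas es g) (cstf c).

Lemma dlim_uniq es g c c' : dlim es g c -> dlim es g c' -> c = c'.
Proof.
move=> [N h] [M h']; pose m := maxn N M.
by have := h m m; rewrite (h' m m) ?leq_maxr // ?leq_maxl // => /(_ isT isT).
Qed.

Lemma dlim_eqv es f g c : eqv f g -> dlim es f c -> dlim es g c.
Proof. by move=> /(eqv_deltas es)/eqv_sym; apply: eqv_trans. Qed.

Lemma dlim_add es f g c c' : dlim es f c -> dlim es g c' -> dlim es (addf f g) (c + c').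
Proof. by rewrite /dlim deltas_add; apply: eqv_op. Qed.

Lemma dlim_sub es f g c c' : dlim es f c -> dlim es g c' -> dlim es (subf f g) (c - c').
Proof. by rewrite /dlim deltas_sub; apply: (eqv_op (fun x y => x - y)). Qed.

Lemma dlim_shift es d g c : dlim es g c -> dlim es (shift d g) c.
Proof. by rewrite /dlim deltas_shift => /(eqv_shift d). Qed.

Lemma dlim_unshift es d g c : dlim es (shift d g) c -> dlim es g c.
Proof. by rewrite /dlim deltas_shift => /eqv_unshift. Qed.

Lemma dlim_EP0 es g : EP (size es) g -> dlim es g 0.
Proof. by elim: es g => //= e es IH g h; apply/IH/EP_delta. Qed.

Lemma EP1_lim g : EP 1 g -> exists c, eqv g (cstf c).
Proof.
case=> [[N h1] [M h2]]; pose P := maxn N M; exists (g P P), P.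
have lN : (N <= P)%N by apply: leq_maxl.
have lM : (M <= P)%N by apply: leq_maxr.
move=> m n hm hn; rewrite /cstf -(subnK hm) -(subnK hn).
elim: (m - P)%N => [|k IH].
  rewrite add0n; elim: (n - P)%N => [//|l IH]; rewrite -IH; apply/eqP.
  rewrite -subr_eq0; apply/eqP; rewrite -[RHS](h2 P (l + P)%N) //.
  by apply: leq_trans lM (leq_addl _ _).
rewrite -IH; apply/eqP; rewrite -subr_eq0; apply/eqP.
rewrite -[RHS](h1 (k + P)%N (n - P + P)%N) //; apply: leq_trans lN (leq_addl _ _).
Qed.

Lemma dlim_ex es g : EP (size es).+1 g -> exists c, dlim es g c.
Proof.
elim: es g => [|e es IH] g; first exact: EP1_lim.
by move=> h; apply/IH/EP_delta.
Qed.

Lemma dlim_ge0 es g c : dlim es g c -> (forall m n, 0 <= deltas es g m n) -> 0 <= c.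
Proof. by case=> N h hp; rewrite -[c]/(cstf c N N) -h. Qed.

End Differences.

(** * Differences of functions of one variable *)

Section Univariate.
Implicit Types u v : nat -> int.

Definition du u : nat -> int := fun n => u n.+1 - u n.

Lemma iterdu_sub k u v n : iter k du (fun n => u n - v n) n = iter k du u n - iter k du v n.
Proof. by elim: k n => [//|k IH] n; rewrite !iterS /du !IH; ring. Qed.

(** Summed k times, a k-th difference bounded by -1 drives the function to minus infinity. Applied
    to a nonnegative gap between two functions, this compares the leading coefficients of Hilbert
    functions and binomials. *)
Lemma du_neg k u N : (forall n, (N <= n)%N -> iter k du u n <= -1) ->
  exists n, u n < 0.
Proof.
suff H : exists N', forall n, (N' <= n)%N -> (forall n, (N <= n)%N -> iter k du u n <= -1) -> u n <= -1.
  by move=> h; case: H => M /(_ M (leqnn _) h) h1; exists M; apply: le_lt_trans h1 _.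
elim: k u N => [|k IH] u N.
  by exists N => n hn /(_ n hn).
have [M hM] := IH (du u) N.
(* From [M] on the function drops by at least 1 per step, so |u M| + 1 further steps make it
   negative. *)
pose B := `|u M|%N; exists (M + B + 1)%N => n hn h.
have {}hM j : (M <= j)%N -> u j.+1 <= u j - 1.
  move=> /hM hj; suff : du u j <= -1 by rewrite /du; lra.
  by apply: hj => i hi; rewrite -iterSr; apply: h.
have hd j : u (M + j)%N <= u M - j%:Z.
  elim: j => [|j IHj]; first by rewrite addn0 subr0.
  by rewrite addnS; apply: le_trans (hM _ (leq_addr _ _)) _; lia.
have := hd (n - M)%N; rewrite subnKC; last by lia.
by rewrite /B in hn; lia.
Qed.

Lemma du_bin k r n : iter k du (fun n => ('C(n + r, k))%:Z) n = 1.
Proof.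
elim: k n => [|k IH] n; first by rewrite /= bin0.
rewrite iterSr -[RHS](IH n); congr (iter k du _ _).
by apply: functional_extensionality => j; rewrite /du addSn binS PoszD; lia.
Qed.

Lemma diag_du k g c : EP k g -> (0 < c)%N ->
  exists N, forall n, (N <= n)%N -> iter k du (fun n => g (n * c)%N (n * c)%N) n = 0.
Proof.
move=> + c0; elim: k g => [|k IH] g.
  case=> N h; exists N => n hn /=; rewrite h // ; apply: leq_trans hn _;
    by rewrite leq_pmulr.
move=> /(EP_delta (c, c))/IH[N h]; exists N => n /h; rewrite iterSr => <-.
by congr (iter k du _ _).
Qed.

Lemma row_du k g n m :
  deltas (nseq k (1, 0)%N) g m n = iter k du (fun m => g m n) m.
Proof. by elim: k g m => [//|k IH] g m; rewrite iterSr /= IH. Qed.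

(** For k = r = 15 this counts the monomials of degree m + 2n in 16 variables. A unit step in n is
    two steps in the degree, whence two binomials of lower order. *)
Lemma EP_bin k r : EP k.+1 (fun m n => ('C(m + n.*2 + r, k))%:Z).
Proof.
elim: k r => [|k IH] r.
  by split; exists 0%N => m n _ _; rewrite /delta !bin0 subrr.
split.
  apply: EP_eqv (IH r); exists 0%N => m n _ _.
  by rewrite /delta /= add0n add1n !addSn binS PoszD; lia.
apply: EP_eqv (EP_add (IH r) (IH r.+1)); exists 0%N => m n _ _.
rewrite /delta /addf /= add0n add1n doubleS !addnS !addSn !binS !PoszD; lia.
Qed.

End Univariate.

(** * Noetherianity and prime filtrations *)

Lemma ex_min_nat (P : nat -> Prop) : (exists n, P n) ->
  exists n, P n /\ forall m, P m -> (n <= m)%N.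
Proof.
case=> n; elim/ltn_ind: n => n IH Pn.
have [[m [Pm mn]]|h] := classic (exists m, P m /\ (m < n)%N); first exact: IH mn Pm.
exists n; split=> // m Pm; rewrite leqNgt; apply/negP => mn; apply: h; by exists m.
Qed.

Lemma ex_max_nat (P : nat -> Prop) B : (exists n, P n) ->
  (forall n, P n -> (n <= B)%N) -> exists n, P n /\ forall m, P m -> (m <= n)%N.
Proof.
move=> [n Pn] hB; have [|k [[m [Pm mk]] hk]] := @ex_min_nat (fun k => exists m, P m /\ B - m = k)%N.
  by exists (B - n)%N, n.
exists m; split=> // j Pj; have := hk (B - j)%N (ex_intro _ j (conj Pj erefl)).
by rewrite -mk leq_sub2lE ?hB.
Qed.

Lemma nondecr_subseq (u : nat -> nat) : exists f : nat -> nat,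
  (forall k, f k < f k.+1)%N /\ (forall k, u (f k) <= u (f k.+1))%N.
Proof.
have /functional_choice[m hm] N : exists i, (N <= i)%N /\ forall j, (N <= j)%N -> (u i <= u j)%N.
  have [|r [[i [Ni ui]] hr]] := @ex_min_nat (fun r => exists i, (N <= i)%N /\ u i = r).
    by exists (u N), N.
  by exists i; split=> // j Nj; rewrite ui; apply: hr; exists j.
pose f := fix f k := if k is k'.+1 then m (f k').+1 else m 0%N.
have fS k : (f k < f k.+1)%N by case: (hm (f k).+1).
exists f; split=> // k; case: k => [|k]; first by have [_] := hm 0%N; apply.
have [h1 h2] := hm (f k).+1; apply: h2; apply: leq_trans (fS k) (ltnW (fS k.+1)).
Qed.

Lemma homo_ltn_S (f : nat -> nat) : (forall k, f k < f k.+1)%N ->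
  forall i j, (i < j)%N -> (f i < f j)%N.
Proof. by move=> h i j; apply: (homo_ltn ltn_trans). Qed.

(** Passing to subsequences makes one coordinate after another nondecreasing; then the first two
    terms are comparable. *)
Lemma dickson n (f : nat -> 'X_{1..n}) : exists i j, (i < j)%N /\ (f i <= f j)%MM.
Proof.
have H (s : seq 'I_n) : exists g : nat -> nat, (forall k, g k < g k.+1)%N /\
    forall c, c \in s -> forall k, (f (g k) c <= f (g k.+1) c)%N.
  elim: s => [|c s [g [g1 g2]]]; first by exists id.
  have [h [h1 h2]] := nondecr_subseq (fun k => f (g k) c).
  exists (g \o h); split=> [k|c']; first by apply: (homo_ltn_S g1).
  rewrite inE => /orP[/eqP->//|c's] k /=.
  have hle : {homo (fun k => f (g k) c') : i j / (i <= j)%N}.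
    by apply: homo_leq => //; [apply: leq_trans | apply: g2].
  by apply: hle; apply: ltnW.
have [g [g1 g2]] := H (enum 'I_n).
exists (g 0%N), (g 1%N); split=> //; apply/mnm_lepP => c; apply: g2.
by rewrite mem_enum.
Qed.

Section Noether.
Variables (K : fieldType) (a b : nat).
Local Notation S := {mpoly K[a + b]}.
Implicit Types (p q s : S) (e d : nat * nat) (J V : polyset K a b).

(** Choose q_i in J_(i+1) outside J_i with minimal leading monomial. By Dickson's lemma the lead of
    some q_i divides that of some q_j with i < j; cancelling it leaves an element of J_(j+1) outside
    J_j with a smaller leading monomial. *)
Lemma acc (J : nat -> polyset K a b) : (forall i, bihomog_ideal (J i)) ->
  (forall i, ssubp (J i) (J i.+1)) -> False.
Proof.
move=> hJ hs.
have mono i j : (i <= j)%N -> subp (J i) (J j).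
  elim: j => [|j IH]; first by rewrite leqn0 => /eqP->.
  rewrite leq_eqVlt => /orP[/eqP->//|/IH h p /h]; by case: (hs j) => + _; apply.
have /functional_choice[q hq] i : exists q, [/\ J i.+1 q, ~ J i q &
    forall q', J i.+1 q' -> ~ J i q' -> ~ (mlead q' < mlead q)%O].
  have [p [p1 p2]] : exists p, J i.+1 p /\ ~ J i p.
    apply: NNPP => h; case: (hs i) => _; apply=> p p1.
    by apply: NNPP => p2; apply: h; exists p.
  have [m] : exists m, m = mlead p by exists (mlead p).
  elim/(well_founded_ind (@ltom_wf (a + b))): m p p1 p2 => m IH p p1 p2 mp.
  apply: NNPP => hn; apply: (hn); exists p; split=> // q' q1 q2 lt.
  by apply: (hn); apply: (IH (mlead q') _ q') => //; rewrite mp.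
have [i [j [ij le]]] := dickson (fun i => mlead (q i)).
have [qj1 qj2 qj3] := hq j; have [qi1 qi2 _] := hq i.
have nz p k : ~ J k p -> p != 0.
  by move=> h; apply/negP => /eqP p0; apply: h; rewrite p0; case: (hJ k).
have qin := nz _ _ qi2; have qjn := nz _ _ qj2.
have qiJ : J j (q i) := mono _ _ ij _ qi1.
pose c := mleadc (q j) / mleadc (q i).
pose t : S := c *: 'X_[(mlead (q j) - mlead (q i))%MM].
pose r := q j - t * q i.
have Jt k : J k (q i) -> J k (- (t * q i)).
  by case: (hJ k) => _ _ hM _ h; rewrite -mulNr; apply: hM.
have tqi : J j (- (t * q i)) by apply: Jt.
have r1 : J j.+1 r.
  by have [_ hD _ _] := hJ j.+1; apply: hD => //; apply: mono tqi.
have r2 : ~ J j r.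
  move=> rJ; apply: qj2; have -> : q j = r + t * q i by rewrite subrK.
  by have [_ hD hM _] := hJ j; apply: hD => //; apply: hM.
apply: (qj3 _ r1 r2).
have lt0 : (t * q i)@_(mlead (q j)) = mleadc (q j).
  rewrite -{1}(submK le) /t -scalerAl mcoeffZ ['X_[_] * _]mulrC mcoeffMX.
  by rewrite /c divfK // mleadc_eq0.
have rn := nz _ _ r2.
have rm : mlead r \in msupp r by apply: mlead_supp.
have t0 : t * q i != 0.
  by apply: contraNneq qjn => h; rewrite -mleadc_eq0 -lt0 h mcoeff0.
have lt1 : mlead (t * q i) = mlead (q j).
  have tn : t != 0 by apply: contraNneq t0 => ->; rewrite mul0r.
  rewrite mleadM // /t mleadZ ?mleadXm ?submK //.
  by apply: contraNneq tn; rewrite /t => ->; rewrite scale0r.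
rewrite lt_neqAle; apply/andP; split.
  apply/eqP=> h; move: rm; rewrite h mcoeff_msupp /r mcoeffB lt0 subrr eqxx //.
have /msuppB_le := rm; rewrite mem_cat => /orP[]; first exact: msupp_le_mlead.
by move/msupp_le_mlead; rewrite lt1.
Qed.

Lemma ideal_ind (P : polyset K a b -> Prop) :
  (forall J, bihomog_ideal J ->
     (forall J', bihomog_ideal J' -> ssubp J J' -> P J') -> P J) ->
  forall J, bihomog_ideal J -> P J.
Proof.
move=> H J hJ; apply: NNPP => nP.
pose T := {I : polyset K a b | bihomog_ideal I /\ ~ P I}.
have /functional_choice[f hf] (x : T) : exists y : T, ssubp (sval x) (sval y).
  case: x => I [hI nPI] /=; apply: NNPP => hn; apply: nPI; apply: H => // J' hJ' IJ'.
  by apply: NNPP => nPJ'; apply: hn; exists (exist _ J' (conj hJ' nPJ')).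
pose x0 : T := exist _ J (conj hJ nP).
apply: (@acc (fun i => sval (iter i f x0))) => i; last by rewrite iterS.
by case: (svalP (iter i f x0)).
Qed.

Definition is_prime V :=
  [/\ bihomog_ideal V, ~ V 1 & forall p q, V (p * q) -> V p \/ V q].

Lemma ideal_bicomp V p : bihomog_ideal V -> (forall e, V (bicomp e p)) -> V p.
Proof.
by move=> hV h; rewrite (bicomp_sumE p); apply: sub_sum => //; apply: ideal_sub.
Qed.

Lemma top_bicomp_notin V p : bihomog_ideal V -> ~ V p -> exists d, ~ V (bicomp d p) /\
  forall d', ~ V (bicomp d' p) -> (d'.1 < d.1)%N \/ (d'.1 = d.1 /\ (d'.2 <= d.2)%N).
Proof.
move=> hV nVp.
have badin d : ~ V (bicomp d p) -> d \in bidegs p.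
  move=> h; apply/negP=> /negP dp; apply: h.
  have -> : bicomp d p = 0; last by case: hV.
  apply/mpolyP=> m; rewrite mcoeff_bicomp mcoeff0; case: eqP => // md.
  apply: memN_msupp_eq0; apply: contra dp => mp.
  by rewrite mem_undup -md map_f.
have bnd d : ~ V (bicomp d p) -> (d.1 <= msize p)%N /\ (d.2 <= msize p)%N.
  move/badin; rewrite mem_undup => /mapP[m /msize_mdeg_lt /ltnW h ->].
  move: h; rewrite mdeg_bideg => h; split; apply: leq_trans h; rewrite ?leq_addr //.
  exact: leq_addl.
have [d0 hd0] : exists d, ~ V (bicomp d p).
  by apply: NNPP => h; apply: nVp; apply: ideal_bicomp => // e; apply: NNPP => h'; apply: h; exists e.
have [||m [[n hmn] hm]] := @ex_max_nat (fun m => exists n, ~ V (bicomp (m, n) p)) (msize p).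
- by exists d0.1, d0.2; case: (d0) hd0.
- by move=> m [n /bnd[]].
have [||n' [hn' hn2]] := @ex_max_nat (fun n => ~ V (bicomp (m, n) p)) (msize p).
- by exists n.
- by move=> k /bnd[].
exists (m, n'); split=> // [[m1 n1]] h /=.
have := hm m1 (ex_intro _ n1 h); rewrite leq_eqVlt => /orP[/eqP mm|]; last by left.
by right; split=> //; apply: hn2; rewrite -mm.
Qed.

(** Let d and e be the lexicographically largest bidegrees in which the components of p and q lie
    outside V. Modulo V the component of p q in bidegree d + e is the product of these two
    components. *)
Lemma bihomog_prime V : bihomog_ideal V -> ~ V 1 ->
  (forall d e p q, bihomog d p -> bihomog e q -> V (p * q) -> V p \/ V q) ->
  is_prime V.
Proof.
move=> hV V1 H; split=> // p q Vpq; apply: NNPP => /not_or_and[nVp nVq].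
have [d [hd1 hd2]] := top_bicomp_notin hV nVp; have [e [he1 he2]] := top_bicomp_notin hV nVq.
have sV := ideal_sub hV.
case: (H _ _ _ _ (bicomp_bihomog d p) (bicomp_bihomog e q)) => //.
have dp : d \in bidegs p.
  apply/negP=> /negP dp; apply: hd1.
  have -> : bicomp d p = 0; last by case: sV.
  apply/mpolyP=> m; rewrite mcoeff_bicomp mcoeff0; case: eqP => // md.
  apply: memN_msupp_eq0; apply: contra dp => mp.
  by rewrite mem_undup -md map_f.
have : V (bicomp (addb d e) (p * q)) by case: hV => _ _ _; apply.
rewrite {1}(bicomp_sumE p) mulr_suml bicomp_sum (bigD1_seq d) ?undup_uniq //=.
rewrite (bicompM _ _ (bicomp_bihomog d p)) => h.
rewrite -[_ * _](addrK (\sum_(i <- bidegs p | i != d) bicomp (addb d e) (bicomp i p * q))).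
apply: subB => //; apply: sub_sum => // d' dd'.
pose e' := ((addb d e).1 - d'.1, (addb d e).2 - d'.2)%N.
have hb := bicomp_bihomog d' p.
have [hde|hde] := eqVneq (addb d' e') (addb d e); last first.
  have -> : bicomp (addb d e) (bicomp d' p * q) = 0; last by case: sV.
  rewrite (bicomp_sumE q) mulr_sumr bicomp_sum big1 // => e1 _.
  apply: bicomp_neq (bihomogM hb (bicomp_bihomog e1 q)) _.
  apply: contraNneq hde => h1; rewrite -h1 /e' -h1 /addb /=.
  by rewrite !addKn.
rewrite -hde (bicompM _ _ hb).
have [h1|h1] := classic (V (bicomp d' p)).
  by rewrite mulrC; case: hV => _ _ hM _; apply: hM.
have [h2|h2] := classic (V (bicomp e' q)).
  by case: hV => _ _ hM _; apply: hM.
have /eqP[] := dd'; move: hde (hd2 _ h1) (he2 _ h2).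
case: (d) (d') (e) (e') => [d1 d2] [d1' d2'] [e1 e2] [e1' e2'] [] /= hA hB hC hE.
by congr pair; lia.
Qed.

Lemma ssub_comp J J' : bihomog_ideal J -> bihomog_ideal J' -> ssubp J J' ->
  exists d s, [/\ bihomog d s, J' s & ~ J s].
Proof.
move=> hJ hJ' [_ n]; apply: NNPP => h; apply: n => p J'p.
apply: ideal_bicomp => // e; apply: NNPP => ne; apply: h.
exists e, (bicomp e p); split=> //; first exact: bicomp_bihomog.
by case: hJ' => _ _ _; apply.
Qed.

(** Associated primes: among the ideals J : s with s bihomogeneous in J' and outside J, a maximal
    one is prime. If p q lies in J : s and neither factor does, then J : (p s) is strictly larger,
    as it contains q. *)
Lemma ex_prime_colon J J' : bihomog_ideal J -> bihomog_ideal J' -> ssubp J J' ->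
  exists d s, [/\ bihomog d s, J' s, ~ J s & is_prime (colon J s)].
Proof.
move=> hJ hJ' /(ssub_comp hJ hJ')[d [s [hs J's nJs]]].
have [I IE] : exists I, I = colon J s by exists (colon J s).
have hI : bihomog_ideal I by rewrite IE; apply: colon_ideal hs.
elim/ideal_ind: hI d s hs J's nJs IE => {}I hI IH d s hs J's nJs IE.
apply: NNPP => hn; apply: (hn); exists d, s; split=> //.
apply: bihomog_prime => [||d1 d2 p q hp hq hpq].
- exact: colon_ideal hs.
- by rewrite /colon mul1r.
- apply: NNPP => /not_or_and[np nq]; apply: hn.
  have hps : bihomog (addb d1 d) (p * s) by apply: bihomogM.
  apply: (IH (colon J (p * s)) _ _ _ (p * s) hps) => //.
  + exact: colon_ideal hps.
  + rewrite IE; split=> [r hr|h].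
      by rewrite /colon mulrCA; case: hJ => _ _ hM _; apply: hM.
    by apply: nq; apply: (h q); rewrite /colon mulrA [q * p]mulrC.
  + by case: hJ' => _ _ hM _; apply: hM.
Qed.

(* A filtration of J'/J with quotients S/P, P prime, shifted by the given bidegrees. *)
Inductive filt J' : polyset K a b -> seq (polyset K a b * (nat * nat)) -> Prop :=
| FiltNil J : subp J' J -> filt J' J [::]
| FiltCons J d s L : bihomog d s -> ~ J s -> J' s -> is_prime (colon J s) ->
    filt J' (addi J s) L -> filt J' J ((colon J s, d) :: L).

Lemma filt_ex J J' : bihomog_ideal J -> bihomog_ideal J' -> subp J J' ->
  exists L, filt J' J L.
Proof.
move=> hJ hJ'; elim/ideal_ind: hJ => {}J hJ IH JJ'.
have [h|h] := classic (subp J' J); first by exists [::]; apply: FiltNil.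
have [d [s [hs J's nJs pr]]] := ex_prime_colon hJ hJ' (conj JJ' h).
have [||L hL] := IH _ (addi_ideal hJ hs).
- split; first exact: addi_sub.
  by move=> hh; apply: nJs; apply: hh; apply: addi_in; case: hJ.
- exact: addi_min.
by exists ((colon J s, d) :: L); apply: FiltCons.
Qed.

Lemma filt_prime J J' L : bihomog_ideal J -> filt J' J L ->
  forall c, List.In c L -> is_prime c.1 /\ subp J c.1.
Proof.
move=> hJ hL; elim: hL hJ => {J L} [J _ _ c []|J d s L hs nJs J's pr hL IH hJ c].
case=> [<-/=|cL]; first by split=> //; apply: colon_sub.
have [h1 h2] := IH (addi_ideal hJ hs) c cL; split=> // p Jp.
by apply: h2; apply: addi_sub.
Qed.

Definition hilz J : nat -> nat -> int := fun m n => (hil J m n)%:Z.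

Lemma samep_ideal J J' : bihomog_ideal J -> samep J J' -> bihomog_ideal J'.
Proof.
move=> [h0 hD hM hC] [h1 h2]; split=> [|p q hp hq|p q hq|p e hp]; apply: h1 => //.
- by apply: hD; apply: h2.
- by apply/hM/h2.
- by apply/hC/h2.
Qed.

Lemma hil_same J J' m n : bihomog_ideal J -> samep J J' -> hil J m n = hil J' m n.
Proof.
move=> hJ JJ'; have hJ' := samep_ideal hJ JJ'; case: JJ' => h1 h2.
by apply/eqP; rewrite eqn_leq !hil_mono.
Qed.

End Noether.

(** * Dimension and multidegrees *)

Definition prop_bool (P : Prop) : bool := if excluded_middle_informative P then true else false.

Lemma prop_boolP P : reflect P (prop_bool P).
Proof. by rewrite /prop_bool; case: excluded_middle_informative => h; constructor. Qed.

Section Dim.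
Variables (K : fieldType) (a b : nat).
Local Notation S := {mpoly K[a + b]}.
Implicit Types (p q s : S) (e d : nat * nat) (J V W P : polyset K a b).
Implicit Types (L : seq (polyset K a b * (nat * nat))).

Lemma subv_prime V : subvariety V -> is_prime V.
Proof. by case. Qed.

Lemma subv_ideal V : subvariety V -> bihomog_ideal V.
Proof. by case. Qed.

Definition unit_ideal : polyset K a b := fun _ => True.

Lemma unit_ideal_bihomog : bihomog_ideal unit_ideal. Proof. by []. Qed.

Lemma hil0 J m n : bihomog_ideal J -> (forall p, bihomog (m, n) p -> J p) -> hil J m n = 0%N.
Proof.
move=> hJ h; apply: hil_eq => //; exists (fun i => 0); split=> [[]|c _ []|v /h Jv] //.
by exists (fun=> 0); rewrite big_ord0 subr0.
Qed.

(** Hilbert functions add along a prime filtration, up to shifts, so a property closed under sums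
    and invariant under shifts passes from the quotients to J'/J. *)
Lemma filt_closed (Q : (nat -> nat -> int) -> Prop) J J' L :
  Q (cstf 0) -> (forall f g, Q f -> Q g -> Q (addf f g)) ->
  (forall d g, Q (shift d g) <-> Q g) ->
  bihomog_ideal J -> bihomog_ideal J' -> subp J J' -> filt J' J L ->
  (forall c, List.In c L -> Q (hilz c.1)) -> Q (subf (hilz J) (hilz J')).
Proof.
move=> Q0 QD Qs + hJ' + hL.
elim: hL => {J L} [J J'J|J d s L hs nJs J's pr hL IH] hJ JJ' HL.
  suff -> : subf (hilz J) (hilz J') = cstf 0 by [].
  do 2![apply: functional_extensionality => ?]; rewrite /subf /hilz.
  by rewrite (hil_same _ _ hJ (conj JJ' J'J)) subrr.
have hA := addi_ideal hJ hs.
apply/(Qs d).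
have -> : shift d (subf (hilz J) (hilz J')) =
    addf (shift d (subf (hilz (addi J s)) (hilz J'))) (hilz (colon J s)).
  do 2![apply: functional_extensionality => ?].
  by rewrite /shift /subf /addf /hilz (hil_addi _ _ hJ hs) PoszD addrAC.
apply: QD; last exact: (HL _ (or_introl erefl)).
apply/Qs; apply: IH => //; first exact: addi_min.
by move=> c cL; apply: HL; right.
Qed.

(** The quotients occur with shifts, but shifting a function of degree at most k changes it only in
    degree below k; at leading order the shifts disappear. *)
Lemma filt_sum k J J' L : bihomog_ideal J -> bihomog_ideal J' -> subp J J' -> filt J' J L ->
  (forall c, List.In c L -> EP k.+1 (hilz c.1)) ->
  EP k (subf (subf (hilz J) (hilz J')) (fun m n => \sum_(c <- L) hilz c.1 m n)).
Proof.
move=> + hJ' + hL.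
elim: hL => {J L} [J J'J|J d s L hs nJs J's pr hL IH] hJ JJ' HL.
  apply: (EP_le (leq0n k)); exists 0%N => m n _ _; rewrite /subf /hilz big_nil subr0.
  by rewrite (hil_same _ _ hJ (conj JJ' J'J)) subrr.
have hA := addi_ideal hJ hs; apply: (@EP_unshift _ d).
have hP := HL _ (or_introl erefl).
have {}IH := IH hA (addi_min hJ' JJ' J's) (fun c cL => HL c (or_intror cL)).
apply: EP_eqv (EP_sub (EP_shift d IH) (EP_delta d hP)); exists 0%N => m n _ _.
by rewrite /shift /subf /delta big_cons /hilz (hil_addi _ _ hJ hs) PoszD; ring.
Qed.

Lemma bihomog_xdiv J m n p : bihomog_ideal J -> (forall i, J 'X_(lshift b i)) ->
  bihomog (m.+1, n) p -> J p.
Proof.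
move=> hJ Jx hp; rewrite (mpolyE p) big_seq; apply: sub_sum => [|mm mp]; first exact: ideal_sub.
apply: subZ; first exact: ideal_sub.
have [hm _] := hp _ mp.
have [i hi] : exists i : 'I_a, (0 < mm (lshift b i))%N.
  apply: NNPP => h; move: hm; rewrite big1 // => i _.
  by apply/eqP; rewrite -leqn0 leqNgt; apply/negP => ?; apply: h; exists i.
have -> : mm = ((mm - U_(lshift b i)) + U_(lshift b i))%MM by rewrite submK // lep1mP -lt0n.
by rewrite mpolyXD; case: hJ => _ _ hM _; apply: hM.
Qed.

Lemma bihomog_ydiv J m n p : bihomog_ideal J -> (forall j, J 'X_(rshift a j)) ->
  bihomog (m, n.+1) p -> J p.
Proof.
move=> hJ Jy hp; rewrite (mpolyE p) big_seq; apply: sub_sum => [|mm mp]; first exact: ideal_sub.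
apply: subZ; first exact: ideal_sub.
have [i hi] := bideg_gt0 (e := (m, n)) (hp _ mp).
have -> : mm = ((mm - U_(rshift a i)) + U_(rshift a i))%MM by rewrite submK // lep1mP -lt0n.
by rewrite mpolyXD; case: hJ => _ _ hM _; apply: hM.
Qed.

(** Such a prime contains all x_i or all y_j, hence every form of bidegree at least (1, 1): eventual
    Hilbert functions do not see it. *)
Lemma irrelevant_EP V : is_prime V -> ~ subvariety V -> EP 0 (hilz V).
Proof.
case=> hV V1 pr nsub; exists 1%N => m n; case: m => // m _; case: n => // n _.
suff -> : hilz V m.+1 n.+1 = 0 by [].
congr Posz; apply: hil0 => // p hp.
have [hx|hx] := classic (forall i, V 'X_(lshift b i)); first exact: bihomog_xdiv hp.
have [hy|hy] := classic (forall j, V 'X_(rshift a j)); first exact: bihomog_ydiv hp.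
by case: nsub; split=> //; [move: hx|move: hy] => /not_all_ex_not.
Qed.

Lemma irrelevant_dlim V es : is_prime V -> ~ subvariety V -> dlim es (hilz V) 0.
Proof. by move=> h1 h2; apply/dlim_EP0/(EP_le (leq0n _))/irrelevant_EP. Qed.

(* For a subvariety V: dim V < k. *)
Fixpoint dimlt k V := if k is k'.+1 then
  forall W, subvariety W -> ssubp V W -> dimlt k' W else False.

Lemma EP_above k J J' : bihomog_ideal J -> bihomog_ideal J' -> subp J J' ->
  (forall P, subvariety P -> subp J P -> EP k (hilz P)) -> EP k (subf (hilz J) (hilz J')).
Proof.
move=> hJ hJ' JJ' H; have [L hL] := filt_ex hJ hJ' JJ'.
apply: (filt_closed _ _ _ hJ hJ' JJ' hL).
- by apply: (EP_le (leq0n k)); apply: eqv_refl.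
- exact: EP_add.
- by move=> d g; split; [apply: EP_unshift|apply: EP_shift].
- move=> c /(filt_prime hJ hL)[pc Jc].
  have [sc|sc] := classic (subvariety c.1); first exact: H.
  exact/(EP_le (leq0n k))/irrelevant_EP.
Qed.

Lemma EP_above1 k J : bihomog_ideal J ->
  (forall P, subvariety P -> subp J P -> EP k (hilz P)) -> EP k (hilz J).
Proof.
move=> hJ H; apply: EP_eqv (EP_above hJ unit_ideal_bihomog _ H) => //.
exists 0%N => m n _ _; rewrite /subf /hilz [hil unit_ideal _ _]hil0 ?subr0 //.
Qed.

(** A form outside the prime V is a nonzerodivisor modulo V, that is V : l = V. *)
Lemma delta_hil V d l : is_prime V -> bihomog d l -> ~ V l ->
  delta d (hilz V) = shift d (hilz (addi V l)).
Proof.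
move=> [hV V1 pr] hl nVl; do 2![apply: functional_extensionality => ?].
rewrite /delta /shift /hilz (hil_addi _ _ hV hl).
suff -> : forall m n, hil (colon V l) m n = hil V m n by rewrite PoszD addrK.
move=> m n; apply: hil_same; first exact: colon_ideal hl.
split; last by apply: colon_sub.
by move=> p /pr[].
Qed.

Lemma addi_ssub V l P : ~ V l -> V 0 -> subp (addi V l) P -> ssubp V P.
Proof.
move=> nVl V0 h; split=> [p Vp|h2]; first by apply/h/addi_sub.
by apply: nVl; apply: h2; apply: h; apply: addi_in.
Qed.

(** One half of the comparison of chains of primes with the degree of the Hilbert polynomial: every
    prime containing V + (l) is strictly larger than V, so a difference of the Hilbert function of V
    is governed by smaller dimensions. [dimlt_bound] is the other half. *)
Lemma dim_EP k V : subvariety V -> dimlt k V -> EP k (hilz V).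
Proof.
elim: k V => [//|k IH] V sV dV; have [hV _ _ [i nx] [j ny]] := sV.
have [pV V0] : is_prime V /\ V 0 by split; [exact: subv_prime|case: hV].
have H d l : bihomog d l -> ~ V l -> EP k (delta d (hilz V)).
  move=> hl nVl; rewrite (delta_hil pV hl nVl); apply: EP_shift.
  apply: EP_above1; first exact: addi_ideal hl.
  move=> P sP hP; apply: IH => //; apply: dV => //; exact: addi_ssub hP.
split; first by apply: (H _ 'X_(lshift b i)) => //; apply: bihomog_x.
by apply: (H _ 'X_(rshift a j)) => //; apply: bihomog_y.
Qed.

Lemma EP_ideal k J : bihomog_ideal J ->
  (forall P, subvariety P -> subp J P -> dimlt k P) -> EP k (hilz J).
Proof. by move=> hJ H; apply: EP_above1 => // P sP JP; apply: dim_EP (H _ sP JP). Qed.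

Lemma dimlt_sub k V W : dimlt k.+1 V -> subvariety W -> ssubp V W -> dimlt k W.
Proof. by move=> h; apply: h. Qed.

Definition std_degs (es : seq (nat * nat)) := all [pred e | (e == (1, 0)) || (e == (0, 1))]%N es.

Lemma std_form V e : subvariety V -> (e == (1, 0)%N) || (e == (0, 1)%N) ->
  exists2 l, bihomog e l & ~ V l.
Proof.
by case=> _ _ _ [i hi] [j hj] /orP[]/eqP->; [exists 'X_(lshift b i)|exists 'X_(rshift a j)] => //;
  [apply: bihomog_x|apply: bihomog_y].
Qed.

Lemma dlim_above es J J' : bihomog_ideal J -> bihomog_ideal J' -> subp J J' ->
  (forall P, subvariety P -> subp J P -> exists2 c, dlim es (hilz P) c & 0 <= c) ->
  exists2 c, dlim es (subf (hilz J) (hilz J')) c & 0 <= c.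
Proof.
move=> hJ hJ' JJ' H; have [L hL] := filt_ex hJ hJ' JJ'.
apply: (filt_closed (Q := fun g => exists2 c, dlim es g c & 0 <= c) _ _ _ hJ hJ' JJ' hL).
- by exists 0 => //; apply/dlim_EP0/(EP_le (leq0n _)); apply: eqv_refl.
- move=> f g [c hc c0] [c' hc' c0']; exists (c + c'); last exact: addr_ge0.
  exact: dlim_add.
- by move=> d g; split=> -[c hc c0]; exists c => //; [apply: dlim_unshift hc|apply: dlim_shift].
- move=> c /(filt_prime hJ hL)[pc Jc].
  have [sc|sc] := classic (subvariety c.1); first exact: H.
  by exists 0 => //; apply: irrelevant_dlim.
Qed.

(** Each prime in a filtration of the coordinate section has smaller dimension and, by induction, a
    nonnegative limit; when no cut remains, the limit is a value of a Hilbert function. *)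
Lemma dlim_pos es V : std_degs es -> subvariety V -> dimlt (size es).+1 V ->
  exists2 c, dlim es (hilz V) c & 0 <= c.
Proof.
elim: es V => [|e es IH] V.
  move=> _ sV dV; have [c hc] := dlim_ex (es := [::]) (dim_EP sV dV); exists c => //.
  by apply: dlim_ge0 hc _ => m n.
case/andP=> he hes sV dV; have [l hl nVl] := std_form sV he.
have hV := subv_ideal sV; have hA := addi_ideal hV hl.
rewrite /dlim /= (delta_hil (subv_prime sV) hl nVl).
have [||c hc c0] := dlim_above (es := es) hA unit_ideal_bihomog; first by [].
  move=> P sP hP; apply: IH => //; apply: dV => //; apply: addi_ssub hP => //; by case: hV.
exists c => //; apply: dlim_shift; apply: dlim_eqv hc.
by exists 0%N => m n _ _; rewrite /subf /hilz [hil unit_ideal _ _]hil0 ?subr0.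
Qed.

Lemma dlim_le es J J' c c' : std_degs es -> bihomog_ideal J -> bihomog_ideal J' ->
  subp J J' -> (forall P, subvariety P -> subp J P -> dimlt (size es).+1 P) ->
  dlim es (hilz J) c -> dlim es (hilz J') c' -> c' <= c.
Proof.
move=> hes hJ hJ' JJ' H hc hc'.
have [P sP JP|c0 h0 h1] := @dlim_above es _ _ hJ hJ' JJ'; first by apply: dlim_pos (H _ sP JP).
by rewrite -subr_ge0 (dlim_uniq (dlim_sub hc hc') h0).
Qed.

End Dim.

(** * Orders of vanishing as multiplicities in a filtration *)

Section Mult.
Variables (K : fieldType) (a b : nat).
Local Notation S := {mpoly K[a + b]}.
Implicit Types (p q s : S) (e d : nat * nat) (J V W P N : polyset K a b).
Implicit Types (L : seq (polyset K a b * (nat * nat))).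

Definition cnt W L : nat := (\sum_(c <- L) prop_bool (samep c.1 W))%N.

(** The contraction to S of the ideal generated by J in the homogeneous localization at W. *)
Definition sat W J : polyset K a b := fun p => exists e s, [/\ bihomog e s, ~ W s & J (s * p)].

Lemma sat_sub W J : ~ W 1 -> subp J (sat W J).
Proof. by move=> W1 p Jp; exists (0, 0)%N, 1; rewrite mul1r; split=> //; apply: bihomog1. Qed.

Lemma sat_local W J : is_prime W -> bihomog_ideal J -> local_ideal W (sat W J).
Proof.
move=> [hW W1 prW] hJ; have [J0 hD hM hC] := hJ; split; first split.
- exact: sat_sub.
- move=> p q [e [s [hs Ws Js]]] [e' [s' [hs' Ws' Js']]].
  exists (addb e e'), (s * s'); split; first exact: bihomogM.
    by move/prW=> [].
  rewrite mulrDr; apply: hD; last by rewrite -mulrA; apply: hM.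
  by rewrite mulrAC mulrC; apply: hM.
- move=> p q [e [s [hs Ws Js]]]; exists e, s; split=> //.
  by rewrite mulrCA; apply: hM.
- move=> p e0 [e [s [hs Ws Js]]]; exists e, s; split=> //.
  by rewrite -(bicompM _ _ hs); apply: hC.
move=> e s p hs Ws [e' [s' [hs' Ws' Js']]]; exists (addb e' e), (s' * s).
split; first exact: bihomogM; last by rewrite -mulrA.
by move/prW=> [].
Qed.

(** Each step with quotient S/W enlarges the localization at W: if [s] were already in the
    saturation, some t outside W would lie in J : s = W. The other steps are skipped. *)
Lemma filt_chain W J L : is_prime W -> bihomog_ideal J -> filt (@unit_ideal K a b) J L ->
  exists Jc : nat -> polyset K a b, [/\ subp (sat W J) (Jc 0%N),
    forall i, (i <= cnt W L)%N -> local_ideal W (Jc i) /\ subp J (Jc i)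
    & forall i, (i < cnt W L)%N -> ssubp (Jc i) (Jc i.+1)].
Proof.
move=> pW + hL; have [hW W1 prW] := pW.
elim: hL => {J L} [J hf hJ|J d s L hs nJs J's pr hL IH hJ].
  exists (fun=> sat W J); split=> // [i _|i]; last by rewrite /cnt big_nil.
  by split; [apply: sat_local|apply: sat_sub].
have [Jc [h0 h1 h2]] := IH (addi_ideal hJ hs).
have J0 : J 0 by case: hJ.
have sJ : subp (sat W J) (sat W (addi J s)).
  by move=> p [e [t [ht Wt Jt]]]; exists e, t; split=> //; apply: addi_sub.
have -> : cnt W ((colon J s, d) :: L) = (prop_bool (samep (colon J s) W) + cnt W L)%N.
  by rewrite /cnt big_cons.
case: prop_boolP => hP /=.
  exists (fun i => if i is i'.+1 then Jc i' else sat W J); split=> // [[|i]|[|i]].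
  - by split; [apply: sat_local|apply: sat_sub].
  - rewrite add1n ltnS => /h1[l1 l2]; split=> // p Jp; apply: l2; exact: addi_sub.
  - move=> _; split=> [p /sJ/h0//|h].
    have [] := h s; first by apply: h0; apply: sat_sub => //; apply: addi_in.
    move=> e [t [ht Wt Jt]]; apply: Wt; case: hP => hP _; exact: hP.
  - by rewrite add1n ltnS; apply: h2.
exists Jc; rewrite add0n; split=> // [p /sJ/h0//|i /h1[l1 l2]].
by split=> // p Jp; apply: l2; apply: addi_sub.
Qed.

Lemma addi_bihomog J d s e p : bihomog_ideal J -> bihomog d s -> bihomog e p -> addi J s p ->
  exists u c e1, [/\ J u, bihomog e1 c & p = u + c * s].
Proof.
move=> hJ hs hp [u [c Ju pE]]; have [J0 _ _ hC] := hJ.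
pose e1 := (e.1 - d.1, e.2 - d.2)%N.
have pE' : p = bicomp e u + bicomp e (s * c) by rewrite -bicompD [s * c]mulrC -pE bicomp_id.
have [h|h] := eqVneq (addb d e1) e.
  exists (bicomp e u), (bicomp e1 c), e1; split; [exact: hC|exact: bicomp_bihomog|].
  by rewrite mulrC -(bicompM _ _ hs) h.
exists (bicomp e u), 0, (0, 0)%N; split; [exact: hC| |].
  by have [] := @bihomog_sub K a b (0, 0)%N.
rewrite mul0r addr0 {1}pE' (bicomp_sumE c) mulr_sumr bicomp_sum big1 ?addr0 // => e2 _.
apply: bicomp_neq (bihomogM hs (bicomp_bihomog e2 c)) _.
by apply: contraNneq h => h1; rewrite /e1 -h1 /addb /= !addKn.
Qed.

Lemma local_ext W N N' : local_ideal W N -> local_ideal W N' ->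
  (forall e p, bihomog e p -> N p -> N' p) -> subp N N'.
Proof.
move=> [hN _] [hN' _] h p Np; apply: ideal_bicomp => // e; apply: (h e).
  exact: bicomp_bihomog.
by case: hN => _ _ _; apply.
Qed.

(* lam N counts the steps colon J s = W of the filtration at which N contains, locally at W,
   an element of J + (s) outside J: in a composition series each contributes length 1. *)
Lemma filt_length V W J L : prime_divisor V W -> ssubp V J -> bihomog_ideal J ->
  filt (@unit_ideal K a b) J L ->
  exists lam : polyset K a b -> nat, [/\ forall N, (lam N <= cnt W L)%N,
    forall N N', subp N N' -> (lam N <= lam N')%N
    & forall N N', local_ideal W N -> local_ideal W N' -> subp N N' ->
       (forall e p, bihomog e p -> J p -> N' p -> N p) -> lam N = lam N' -> subp N' N].
Proof.
move=> [sW VW ncov] + + hL; have [hW W1 prW] := subv_prime sW.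
elim: hL => {J L} [J hf VJ hJ|J d s L hs nJs J's pr hL IH VJ hJ].
  exists (fun=> 0%N); split=> // N N' lN lN' NN' h _.
  by apply: (local_ext lN' lN) => e p hp ?; apply: (h e) => //; apply: hf.
have hA := addi_ideal hJ hs; have J0 : J 0 by case: hJ.
have VA : ssubp V (addi J s).
  split=> [p Vp|h]; first by apply: addi_sub; case: VJ => + _; apply.
  by apply: nJs; case: VJ => + _; apply; apply: h; apply: addi_in.
have [lam [h1 h2 h3]] := IH VA hA.
have -> : cnt W ((colon J s, d) :: L) = (prop_bool (samep (colon J s) W) + cnt W L)%N.
  by rewrite /cnt big_cons.
pose jump N := samep (colon J s) W /\
  exists e p, [/\ bihomog e p, N p, addi J s p & ~ sat W J p].
exists (fun N => prop_bool (jump N) + lam N)%N; split=> [N|N N' NN'|N N' lN lN' NN' agree].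
- apply: leq_add => //; case: prop_boolP => // -[hs' _]; by case: prop_boolP.
- apply: leq_add; last exact: h2.
  case: prop_boolP => // -[hs' [e [p [? /NN' ? ? ?]]]]; case: prop_boolP => // -[]; split=> //.
  by exists e, p.
move=> eql.
have jNN' : jump N -> jump N' by move=> [? [e [p [? /NN' ? ? ?]]]]; split=> //; exists e, p.
have [ej el] : (jump N' -> jump N) /\ lam N = lam N'.
  move: eql (h2 _ _ NN'); case: (prop_boolP (jump N)) => jN; case: (prop_boolP (jump N')) => jN' /=; split=> //; try lia.
  by case: jN'; apply: jNN'.
apply: h3 => // e p' hp' Ap' N'p'.
have [N0 ND NM NC] := lN.1; have [N0' ND' NM' NC'] := lN'.1; have [_ JD JM _] := hJ.
have insat : sat W J p' -> N p'.
  case=> e1 [t [ht Wt Jt]]; apply: (lN.2 _ _ _ ht Wt).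
  exact: (agree _ _ (bihomogM ht hp') Jt (NM' _ _ N'p')).
have [|nsat] := classic (sat W J p'); first exact: insat.
have [u' [c' [e1' [Ju' hc' p'E]]]] := addi_bihomog hJ hs hp' Ap'.
(* If some t outside W had t s in J, then [s], and with it p', would lie in the saturation. *)
have PW : subp (colon J s) W.
  move=> t; rewrite /colon => Jts; apply: NNPP => Wt; apply: nsat.
  have [tt [d' [htt Wtt Jtts]]] : exists tt d', [/\ bihomog d' tt, ~ W tt & J (tt * s)].
    apply: NNPP => hn; apply: Wt; apply: ideal_bicomp => // d'; apply: NNPP => nW; apply: hn.
    exists (bicomp d' t), d'; split=> //; first exact: bicomp_bihomog.
    by rewrite mulrC -(bicompM _ _ hs) mulrC; case: hJ => _ _ _; apply; rewrite ?[s * t]mulrC.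
  exists d', tt; split=> //; rewrite p'E mulrDr; apply: JD; first exact: JM.
  by rewrite mulrCA; apply: JM.
(* [colon J s] is a prime strictly larger than V and contained in W; as W has codimension one in V,
   it is W. *)
have spW : samep (colon J s) W.
  split=> //; apply: NNPP => nWP; apply: (ncov (colon J s)).
    case: sW => _ _ _ [i hi] [j hj]; case: pr => ? ? ?; split=> //; [exists i|exists j] => /PW //.
  split; split=> //.
  - by move=> p Vp; apply: (colon_sub s hJ); case: VJ => + _; apply.
  - by move=> h; case: VJ => _; apply=> p Jp; apply: h; exact: (colon_sub s hJ Jp).
have [] := ej _.
  by split=> //; exists e, p'.
move=> _ [e2 [p [hp Np Ap npsat]]].
have [u [c [e1 [Ju hc pE]]]] := addi_bihomog hJ hs hp Ap.
have Wc : ~ W c.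
  move=> Wc; apply: npsat; apply: sat_sub => //; rewrite pE; apply: JD => //.
  by case: spW => _; apply.
(* [c] is invertible at W, and in c p' - c' p the multiples of [s] cancel, leaving an element of
   J. *)
apply: (lN.2 _ _ _ hc Wc).
rewrite -[c * p'](subrK (c' * p)).
apply: ND; last exact: NM.
have hJ1 : J (c * p' - c' * p).
  have -> : c * p' - c' * p = c * u' - c' * u by rewrite pE p'E; ring.
  by apply: (subB (ideal_sub hJ)); apply: JM.
have hN1 : N' (c * p' - c' * p).
  by apply: (subB (ideal_sub lN'.1)); apply: NM' => //; apply: NN'.
apply: ideal_bicomp => [|e3]; first exact: lN.1.
apply: (agree e3); first exact: bicomp_bihomog.
  by case: hJ => _ _ _; apply.
exact: NC'.
Qed.

(** [filt_chain] produces a chain with [cnt W L] steps; along any chain the function [lam] of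
    [filt_length] strictly increases, so none is longer. *)
Lemma ord_cnt V W l L e r : prime_divisor V W -> bihomog_ideal V -> bihomog e l -> ~ V l -> W l ->
  filt (@unit_ideal K a b) (addi V l) L -> is_ord V W l r <-> r = cnt W L.
Proof.
move=> dW hV hl nVl Wl hL; have [sW VW ncov] := dW.
have hA := addi_ideal hV hl; have V0 : V 0 by case: hV.
have pW := subv_prime sW.
have VA : ssubp V (addi V l).
  by split=> [|h]; [apply: addi_sub|apply: nVl; apply: h; apply: addi_in].
have ub r' : local_chain V W l r' -> (r' <= cnt W L)%N.
  case=> J [c1 c2]; have [lam [h1 h2 h3]] := filt_length dW VA hA hL.
  have hlt i : (i < r')%N -> (lam (J i) < lam (J i.+1))%N.
    move=> ir; have [l1 l2 l3] := c1 i (ltnW ir); have [m1 m2 m3] := c1 i.+1 ir.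
    have [s1 s2] := c2 i ir; rewrite ltn_neqAle h2 // andbT; apply/eqP=> E.
    apply: s2; apply: h3 E => // e0 p _ Ap _.
    apply: (addi_min _ l2 l3 Ap); exact: l1.1.
  have : (r' <= lam (J r'))%N.
    elim: (r') hlt => // k IH hlt; apply: leq_ltn_trans (hlt k (leqnn _)).
    by apply: IH => i ik; apply: hlt; apply: ltnW.
  by move/leq_trans; apply.
have ex r' : (r' <= cnt W L)%N -> local_chain V W l r'.
  move=> le; have [Jc [h0 h1 h2]] := filt_chain pW hA hL; exists Jc; split=> i ir.
    have [l1 l2] := h1 i (leq_trans ir le); split=> //.
      by move=> p Vp; apply: l2; apply: addi_sub.
    by apply: l2; apply: addi_in.
  by apply: h2; apply: leq_trans ir le.
split=> [[h1 h2]|->].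
  have := ub _ h1; rewrite leq_eqVlt => /orP[/eqP//|/ex/h2[]].
by split; [apply: ex|move/ub; rewrite ltnn].
Qed.

End Mult.

(** * Divisors and Hilbert functions *)

Section Cap.
Variables (K : fieldType) (a b : nat).
Local Notation S := {mpoly K[a + b]}.
Implicit Types (p q s : S) (e d : nat * nat) (J V W P N : polyset K a b).
Implicit Types (L : seq (polyset K a b * (nat * nat))) (D z : alg_cycle K a b).

Lemma samep_sym J J' : samep J J' -> samep J' J.
Proof. by case. Qed.

Lemma samep_trans J' J J'' : samep J J' -> samep J' J'' -> samep J J''.
Proof. by move=> [h1 h2] [h3 h4]; split=> p; [move/h1/h3|move/h4/h2]. Qed.

Lemma EP_sum_in (T : Type) k (r : seq T) (F : T -> nat -> nat -> int) :
  (forall i, List.In i r -> EP k (F i)) -> EP k (fun m n => \sum_(i <- r) F i m n).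
Proof.
elim: r => [|i r IH] h.
  apply: EP_le (leq0n k) _; exists 0%N => m n _ _; exact: big_nil.
apply: EP_eqv (EP_add (h i (or_introl erefl)) (IH (fun j hj => h j (or_intror hj)))).
by exists 0%N => m n _ _; rewrite big_cons.
Qed.

Lemma eq_sum_in (T : Type) (r : seq T) (F G : T -> int) :
  (forall i, List.In i r -> F i = G i) -> \sum_(i <- r) F i = \sum_(i <- r) G i.
Proof.
elim: r => [|i r IH] h; first by rewrite !big_nil.
rewrite !big_cons (h i (or_introl erefl)); congr (_ + _).
by apply: IH => j hj; apply: h; right.
Qed.

Definition cycf z : nat -> nat -> int := fun m n => \sum_(c <- z) c.1%:Z * hilz c.2 m n.

Lemma cnt_gt0 W L : (0 < cnt W L)%N -> exists2 c, List.In c L & samep c.1 W.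
Proof.
elim: L => [|c L IH]; first by rewrite /cnt big_nil.
rewrite /cnt big_cons -/(cnt W L); case: prop_boolP => h; first by exists c => //; left.
by rewrite add0n => /IH[c' h1 h2]; exists c' => //; right.
Qed.

(** Collects the terms of a filtration that agree with a component of D; the components being
    pairwise distinct, each term is counted once. *)
Lemma group_cycle D L m n : (forall c, List.In c L -> bihomog_ideal c.1) ->
  (forall c, List.In c D -> c.1 = cnt c.2 L) ->
  List.ForallOrdPairs (fun c c' => ~ samep c.2 c'.2) D ->
  cycf D m n = \sum_(p <- L) (prop_bool (exists2 c, List.In c D & samep p.1 c.2))%:Z * hilz p.1 m n.
Proof.
move=> hL; elim: D => [|c D IH] hD.
  move=> _; rewrite /cycf big_nil big1 // => p _.
  by case: prop_boolP => [[]|]; rewrite ?mul0r.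
move=> hF; have [hc hF'] : List.Forall (fun c' => ~ samep c.2 c'.2) D /\
    List.ForallOrdPairs (fun c c' => ~ samep c.2 c'.2) D by inversion hF.
rewrite /cycf big_cons -/(cycf D m n) IH //; last by move=> c' h; apply: hD; right.
rewrite (hD c (or_introl erefl)) /cnt -natz natr_sum mulr_suml -big_split /=.
apply: eq_sum_in => p pL; rewrite natz -[X in X + _]/(_%:Z * _).
have -> : (prop_bool (samep p.1 c.2))%:Z * hilz c.2 m n = (prop_bool (samep p.1 c.2))%:Z * hilz p.1 m n.
  by case: prop_boolP => h; rewrite ?mul0r // /hilz (hil_same _ _ (hL _ pL) h).
rewrite -mulrDl; congr (_ * _).
case: prop_boolP => h1; case: prop_boolP => h2; case: prop_boolP => h3 //; exfalso.
- case: h2 => c' c'D h2; have /List.Forall_forall/(_ c' c'D) := hc; apply.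
  exact: samep_trans (samep_sym h1) h2.
- case: h2 => c' c'D h2; have /List.Forall_forall/(_ c' c'D) := hc; apply.
  exact: samep_trans (samep_sym h1) h2.
- by apply: h3; exists c => //; left.
- by apply: h3; case: h2 => c' ? ?; exists c' => //; right.
- case: h3 => c' [<-//|] ? ?; apply: h2; by exists c'.
Qed.

(** If W did not occur in the filtration, [lam] would vanish identically and put 1 in the saturation
    of V + (l), whereas V + (l) lies in W. *)
Lemma divisor_in V W l e L : prime_divisor V W -> bihomog_ideal V -> bihomog e l -> ~ V l -> W l ->
  filt (@unit_ideal K a b) (addi V l) L -> exists2 c, List.In c L & samep c.1 W.
Proof.
move=> dW hV hl nVl Wl hL; have [sW VW ncov] := dW.
have hA := addi_ideal hV hl; have V0 : V 0 by case: hV.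
have pW := subv_prime sW; have [hW W1 prW] := pW.
have VA : ssubp V (addi V l).
  by split=> [|h]; [apply: addi_sub|apply: nVl; apply: h; apply: addi_in].
apply: cnt_gt0; rewrite lt0n; apply/eqP=> c0.
have [lam [h1 h2 h3]] := filt_length dW VA hA hL.
have lf : local_ideal W (@unit_ideal K a b) by [].
have ls := sat_local pW hA.
have [|||e1 [s [hs Ws]]] := h3 _ _ ls lf _ _ _ 1 I.
- by [].
- by move=> e0 p _ Ap _; apply: sat_sub.
- by apply/eqP; move: (h1 (sat W (addi V l))) (h1 (@unit_ideal K a b)); rewrite c0 !leqn0 => /eqP-> /eqP->.
- by rewrite mulr1 => As; apply: Ws; apply: (addi_min hW _ Wl As); case: VW.
Qed.

(** The components are the prime divisors occurring in a prime filtration of S/(V + (l)), one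
    representative from each class of equal ideals. *)
Lemma div_ex V l e : subvariety V -> bihomog e l -> ~ V l -> exists D, is_div V l D.
Proof.
move=> sV hl nVl; have hV := subv_ideal sV; have hA := addi_ideal hV hl.
have [L hL] := filt_ex hA (@unit_ideal_bihomog K a b) (fun _ _ => I).
have [D [h1 h2 h3]] : exists D, [/\ forall c, List.In c D -> c.1 = cnt c.2 L /\ prime_divisor V c.2 /\ c.2 l,
    forall c, List.In c L -> prime_divisor V c.1 -> exists2 c', List.In c' D & samep c.1 c'.2
    & List.ForallOrdPairs (fun c c' => ~ samep c.2 c'.2) D].
  have HL := filt_prime hA hL.
  suff H (f : polyset K a b -> nat) : exists D, [/\ forall c, List.In c D -> c.1 = f c.2 /\ prime_divisor V c.2 /\ c.2 l,
      forall c, List.In c L -> prime_divisor V c.1 -> exists2 c', List.In c' D & samep c.1 c'.2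
      & List.ForallOrdPairs (fun c c' => ~ samep c.2 c'.2) D] by exact: (H (fun W => cnt W L)).
  elim: (L) HL => [|c L' IH] HL.
    by exists [::]; split=> //; constructor.
  have [D [h1 h2 h3]] := IH (fun c hc => HL c (or_intror hc)).
  have [h|h] := classic (prime_divisor V c.1 /\ forall c', List.In c' D -> ~ samep c.1 c'.2).
    exists ((f c.1, c.1) :: D); split=> [c'|c'|].
    - case=> [<-/=|/h1//]; split=> //; split; first by case: h.
      by have [_ h4] := HL c (or_introl erefl); apply: (h4 l); apply: addi_in; case: hV.
    - case=> [<- _|c'L /(h2 _ c'L)[c1 ? ?]]; first by exists (f c.1, c.1); [left|split].
      by exists c1 => //; right.
    - constructor=> //; apply/List.Forall_forall => c' c'D /= sc; exact: (h.2 _ c'D sc).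
  exists D; split=> // c'; case=> [<- dc|/h2//].
  apply: NNPP => hn; apply: h; split=> // c1 c1D sc; apply: hn; by exists c1.
exists D; split=> // [c /h1[c1 [dc cl]]|W dW Wl].
  by split=> //; apply/(ord_cnt _ dc hV hl nVl cl hL).
have [c cL cW] := divisor_in dW hV hl nVl Wl hL.
have hc : bihomog_ideal c.1 by case: (filt_prime hA hL cL) => -[].
have dc : prime_divisor V c.1.
  case: dW => [[hW W1 prW [i hi] [j hj]] [VW nWV] ncov]; case: cW => cW Wc.
  have [[_ c1 prc] _] := filt_prime hA hL cL; split.
  - by split=> //; [exists i => /cW|exists j => /cW].
  - by split=> [p /VW/Wc//|h]; apply: nWV => p /Wc/h.
  - move=> Q sQ [VQ [Qc ncQ]]; apply: (ncov Q sQ); split=> //; split=> [p /Qc/cW//|h].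
    by apply: ncQ => p /cW/h.
have [c' c'D cc'] := h2 c cL dc; exists c' => //.
exact: samep_trans (samep_sym cW) cc'.
Qed.

(** In a prime filtration of S/(V + (l)) each prime divisor occurs as often as the order of l along
    it; all other terms, and the effect of the shifts, have lower degree. *)
Lemma cap_div k V l e D : subvariety V -> dimlt k.+2 V -> bihomog e l -> ~ V l -> is_div V l D ->
  (forall c, List.In c D -> subvariety c.2 /\ dimlt k.+1 c.2) /\
  EP k (subf (delta e (hilz V)) (cycf D)).
Proof.
move=> sV dV hl nVl [h1 h2 h3]; have hV := subv_ideal sV; have hA := addi_ideal hV hl.
split=> [c /h1[[sc Vc _] _ _]|]; first by split=> //; apply: dV.
have [L hL] := filt_ex hA (@unit_ideal_bihomog K a b) (fun _ _ => I).
have HL := filt_prime hA hL; have V0 : V 0 by case: hV.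
have LP c : List.In c L -> EP k.+1 (hilz c.1).
  move=> cL; have [pc Ac] := HL c cL.
  have [sc|sc] := classic (subvariety c.1); last exact/(EP_le (leq0n _))/irrelevant_EP.
  by apply: dim_EP => //; apply: dV => //; apply: addi_ssub Ac.
have E1 := filt_sum hA (@unit_ideal_bihomog K a b) (fun _ _ => I) hL LP.
have E2 : EP k.+1 (hilz (addi V l)).
  apply: EP_ideal => // P sP AP; apply: dV => //; exact: addi_ssub AP.
(* [G] gathers the terms that match no component of D. Such a prime is no prime divisor, so its
   dimension is lower by one more. *)
pose G (c : polyset K a b * (nat * nat)) m n :=
  (~~ prop_bool (exists2 c', List.In c' D & samep c.1 c'.2))%:Z * hilz c.1 m n.
have E3 : EP k (fun m n => \sum_(c <- L) G c m n).
  apply: EP_sum_in => c cL; rewrite /G; case: prop_boolP => h.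
    apply: (EP_le (leq0n _)); exists 0%N => m n _ _; exact: mul0r.
  apply: EP_scale; have [pc Ac] := HL c cL.
  have [sc|sc] := classic (subvariety c.1); last exact/(EP_le (leq0n _))/irrelevant_EP.
  have Vc : ssubp V c.1 by apply: addi_ssub Ac.
  apply: dim_EP => //; apply: NNPP => nd; apply: h.
  apply: h2; last by apply: Ac; apply: addi_in.
  split=> // Q sQ [VQ Qc]; apply: nd; exact: dV Q sQ VQ _ sc Qc.
apply: EP_eqv (EP_add (EP_add E1 (EP_delta e E2)) E3); exists 0%N => m n _ _.
rewrite /addf /subf (delta_hil (subv_prime sV) hl nVl) /shift /delta.
rewrite (@group_cycle D L) //; first last.
- by move=> c /h1[dc cl oc]; apply/(ord_cnt _ dc hV hl nVl cl hL).
- by move=> c /HL[[]].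
rewrite [hilz (@unit_ideal K a b) m n](_ : _ = 0); last by congr Posz; apply: hil0.
have -> : \sum_(c <- L) hilz c.1 m n = \sum_(p <- L) (prop_bool (exists2 c, List.In c D & samep p.1 c.2))%:Z * hilz p.1 m n + \sum_(c <- L) G c m n.
  rewrite -big_split /=; apply: eq_bigr => c _; rewrite /G.
  by case: prop_bool; rewrite /= ?mul0r ?mul1r ?addr0 ?add0r.
by ring.
Qed.

Definition okc k z := forall c, List.In c z -> subvariety c.2 /\ dimlt k c.2.

Lemma cap_cycle k e z z' : okc k.+2 z -> c1_cap e z z' ->
  okc k.+1 z' /\ EP k (subf (delta e (cycf z)) (cycf z')).
Proof.
move=> + hc; elim: hc => {z z'} [_|m V z l D z' hl nVl hD _ IH ok].
  split=> //; apply: (EP_le (leq0n _)); exists 0%N => m n _ _.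
  by rewrite /subf /delta /cycf !big_nil.
have [sV dV] := ok _ (or_introl erefl).
have [ok' E'] := IH (fun c hc => ok c (or_intror hc)).
have [okD ED] := cap_div sV dV hl nVl hD; split.
  move=> c /List.in_app_iff[/List.in_map_iff[c0 [<- /okD]]//|/ok'//].
apply: EP_eqv (EP_add (EP_scale m%:Z ED) E'); exists 0%N => i j _ _.
rewrite /addf /scalef /subf /delta /cycf big_cat /= !big_cons /=.
have -> : \sum_(c <- [seq ((m * c.1)%N, c.2) | c <- D]) c.1%:Z * hilz c.2 i j
   = m%:Z * \sum_(c <- D) c.1%:Z * hilz c.2 i j.
  by rewrite big_map mulr_sumr; apply: eq_bigr => c _ /=; rewrite PoszM mulrA.
by ring.
Qed.

Lemma cap_ex e z : (e == (1, 0)%N) || (e == (0, 1)%N) -> (forall c, List.In c z -> subvariety c.2) ->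
  exists z', c1_cap e z z'.
Proof.
move=> he; elim: z => [_|[m V] z IH ok]; first by exists [::]; constructor.
have [z' hz'] := IH (fun c hc => ok c (or_intror hc)).
have sV := ok _ (or_introl erefl).
have [l hl nVl] := std_form sV he; have [D hD] := div_ex sV hl nVl.
by eexists; econstructor; eauto.
Qed.

End Cap.

(** * Intersection numbers *)

Section Kernel.
Variables (K : fieldType) (a b : nat).
Local Notation S := {mpoly K[a + b]}.
Implicit Types (p q s : S) (e d : nat * nat) (J V W : polyset K a b).

Lemma bicompM_ex e d s q : bihomog d s ->
  bicomp e (s * q) = 0 \/ exists e', bicomp e (s * q) = s * bicomp e' q.
Proof.
move=> hs; pose e1 := (e.1 - d.1, e.2 - d.2)%N.
have [h|h] := eqVneq (addb d e1) e; first by right; exists e1; rewrite -(bicompM _ _ hs) h.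
left; rewrite (bicomp_sumE q) mulr_sumr bicomp_sum big1 // => e2 _.
apply: bicomp_neq (bihomogM hs (bicomp_bihomog e2 q)) _.
by apply: contraNneq h => h1; rewrite /e1 -h1 /addb /= !addKn.
Qed.

Lemma bicompK e p : bicomp e (bicomp e p) = bicomp e p.
Proof. by apply: bicomp_id; apply: bicomp_bihomog. Qed.

(* The bihomogeneous ideal generated by the bihomogeneous elements of ker phi. *)
Definition bker (R : nzRingType) (phi : S -> R) : polyset K a b :=
  fun p => forall e, phi (bicomp e p) = 0.

Lemma bkerE (R : nzRingType) (phi : {rmorphism S -> R}) e p :
  bihomog e p -> bker phi p <-> phi p = 0.
Proof.
move=> hp; split=> [/(_ e)|h e']; first by rewrite bicomp_id.
by have [<-|h'] := eqVneq e e'; [rewrite bicomp_id|rewrite (bicomp_neq hp h') rmorph0].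
Qed.

Lemma bker_ideal (R : nzRingType) (phi : {rmorphism S -> R}) : bihomog_ideal (bker phi).
Proof.
split=> [e|p q hp hq e|p q hq e|p e hp e'].
- by rewrite bicomp0 rmorph0.
- by rewrite bicompD rmorphD /= hp hq addr0.
- rewrite (bicomp_sumE p) mulr_suml bicomp_sum rmorph_sum big1 // => d _.
  case: (bicompM_ex e q (bicomp_bihomog d p)) => [->|[e' ->]]; first exact: rmorph0.
  by rewrite rmorphM /= hq mulr0.
- have [<-|h'] := eqVneq e e'; first by rewrite bicompK.
  by rewrite (bicomp_neq (bicomp_bihomog e p) h') rmorph0.
Qed.

Lemma bker_prime (R : idomainType) (phi : {rmorphism S -> R}) : is_prime (bker phi).
Proof.
apply: bihomog_prime => [||d e p q hp hq].
- exact: bker_ideal.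
- by move/(bkerE phi (@bihomog1 K a b)); rewrite rmorph1 => /eqP; rewrite oner_eq0.
- move/(bkerE phi (bihomogM hp hq)); rewrite rmorphM => /eqP; rewrite mulf_eq0.
  by case/orP=> /eqP h; [left; apply/(bkerE phi hp)|right; apply/(bkerE phi hq)].
Qed.

Lemma bker_subv (R : idomainType) (phi : {rmorphism S -> R}) i j :
  phi 'X_(lshift b i) != 0 -> phi 'X_(rshift a j) != 0 -> subvariety (bker phi).
Proof.
move=> hi hj; have [h1 h2 h3] := bker_prime phi; split=> //.
- by exists i => /(bkerE phi (@bihomog_x K a b i)) h; rewrite h eqxx in hi.
- by exists j => /(bkerE phi (@bihomog_y K a b j)) h; rewrite h eqxx in hj.
Qed.

Lemma bker_eq (R R' : nzRingType) (phi : {rmorphism S -> R}) (psi : {rmorphism S -> R'}) :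
  (forall e p, bihomog e p -> phi p = 0 -> psi p = 0) -> subp (bker phi) (bker psi).
Proof. by move=> h p hp e; apply: (h e) => //; apply: bicomp_bihomog. Qed.

Lemma ideal_comp_cong J (t : (a + b).-tuple S) : bihomog_ideal J ->
  (forall v, J ('X_v - tnth t v)) -> forall p, J (p - (p \mPo t)).
Proof.
move=> [J0 JD JM JC] h p; have sJ : is_sub J by apply: ideal_sub.
have cong u u' v v' : J (u - u') -> J (v - v') -> J (u * v - u' * v').
  move=> h1 h2; have -> : u * v - u' * v' = v * (u - u') + u' * (v - v') by ring.
  by apply: JD; apply: JM.
rewrite {1}(mpolyE p) comp_mpolyE -sumrB; apply: sub_sum => // m _.
rewrite -scalerBr; apply: subZ => //; rewrite mpolyXE_id.
apply: (big_ind2 (fun u v => J (u - v))) => [|u u' v v'|v _].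
- by rewrite subrr.
- exact: cong.
- elim: (m v) => [|k IH]; first by rewrite !expr0 subrr.
  by rewrite !exprS; apply: cong.
Qed.

End Kernel.

(** * Zero-dimensional subvarieties over an algebraically closed field *)

Section Nullstellensatz.
Variables (K : closedFieldType) (a b : nat).
Local Notation S := {mpoly K[a + b]}.
Implicit Types (p q s : S) (e d : nat * nat) (J V W : polyset K a b).

Lemma point_hil V m n : bihomog_ideal V -> is_point V -> hil V m n = 1%N.
Proof.
move=> hV [x [y [[i xi] [j yj] hVv]]].
have phiE := hil_same m n hV hVv; rewrite phiE.
set P := vanishing _; have hP : bihomog_ideal P by apply: samep_ideal hVv.
have PE e p : bihomog e p -> P p <-> p.@[bipoint x y] = 0.
  move=> hp; split=> [/(_ e x y (conj erefl erefl))|h e' _ _ [-> ->]].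
    by rewrite bicomp_id.
  by have [<-|h'] := eqVneq e e'; [rewrite bicomp_id|rewrite (bicomp_neq hp h') rmorph0].
pose M : S := 'X_(lshift b i) ^+ m * 'X_(rshift a j) ^+ n.
have hM : bihomog (m, n) M.
  have hx : forall k, bihomog (k, 0)%N ('X_(lshift b i) ^+ k : S).
    elim=> [|k IH]; first exact: bihomog1.
    by rewrite exprS; apply: (bihomogM (@bihomog_x K a b i) IH).
  have hy : forall k, bihomog (0, k)%N ('X_(rshift a j) ^+ k : S).
    elim=> [|k IH]; first exact: bihomog1.
    by rewrite exprS; apply: (bihomogM (@bihomog_y K a b j) IH).
  by have := bihomogM (hx m) (hy n); rewrite /addb /= addn0.
have M0 : M.@[bipoint x y] != 0.
  rewrite /M rmorphM /= !rmorphXn /= !mevalXU /bipoint.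
  rewrite (unsplitK (inl i)) (unsplitK (inr j)).
  by rewrite mulf_neq0 // expf_neq0.
apply: hil_eq => //; exists (fun=> M); split=> // [c|v hv].
  rewrite big_ord1 => /(PE (m, n)); rewrite mevalZ => h k; rewrite (ord1 k).
  have /eqP := h (subZ _ (bihomog_sub _) hM).
  by rewrite mulf_eq0 (negPf M0) orbF => /eqP.
exists (fun=> v.@[bipoint x y] / M.@[bipoint x y]); rewrite big_ord1.
apply/(PE (m, n)); first exact: (subB (bihomog_sub _) hv (subZ _ (bihomog_sub _) hM)).
by rewrite mevalB mevalZ divfK // subrr.
Qed.

(** The homogenization of q in degree D, with [v] for the variable and [u] for the homogenizing
    one. *)
Definition homz (u v : S) D (q : {poly K}) : S :=
  \sum_(t < D.+1) q`_t *: (v ^+ t * u ^+ (D - t)).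

Lemma homzM u v D r (q : {poly K}) : (size q <= D.+1)%N ->
  homz u v D.+1 (q * ('X - r%:P)) = (v - r *: u) * homz u v D q.
Proof.
move=> sq; rewrite mulrBr /homz.
under eq_bigr => t _ do rewrite coefB coefMX coefMC scalerBl.
rewrite sumrB mulrBl; congr (_ - _).
  rewrite big_ord_recl /= scale0r add0r mulr_sumr; apply: eq_bigr => t _ /=.
  by rewrite /bump /= add1n subSS exprS -scalerAr mulrA.
rewrite big_ord_recr /= nth_default // mul0r scale0r addr0 mulr_sumr.
apply: eq_bigr => t _ /=; rewrite subSn -1?ltnS // exprS -scalerAl -scalerAr scalerA.
by rewrite [r * _]mulrC mulrCA.
Qed.

Lemma homz_root V u v D (q : {poly K}) : is_prime V -> ~ V u -> (size q <= D.+1)%N -> q != 0 ->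
  V (homz u v D q) -> exists r, V (v - r *: u).
Proof.
move=> pV nVu; have [hV V1 pr] := pV.
elim: D q => [|D IH] q sq q0 hq.
  have qc : q = (q`_0)%:P by apply: size1_polyC.
  case: V1; move: hq; rewrite /homz big_ord1 expr0 mulr1.
  move/(subZ (q`_0)^-1 (ideal_sub hV)); rewrite scalerA mulVf ?scale1r //.
  by rewrite -polyC_eq0 -qc.
have [s1|s1] := leqP (size q) 1.
  case: nVu; have qc : q = (q`_0)%:P by apply: size1_polyC.
  have : V (u ^+ D.+1).
    move: hq; rewrite /homz big_ord_recl /= expr0 mul1r subn0 big1 ?addr0 => [|t _].
      move/(subZ (q`_0)^-1 (ideal_sub hV)); rewrite scalerA mulVf ?scale1r //.
      by rewrite -polyC_eq0 -qc.
    by rewrite qc coefC /bump /= scale0r.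
  elim: (D.+1) => [/V1[]|k IHk]; rewrite exprS => /pr[]; [|exact: IHk]; by [].
have /closed_rootP[r rq] : size q != 1%N by rewrite neq_ltn s1 orbT.
have [q' qE] := factor_theorem _ _ rq.
have q'0 : q' != 0 by apply: contraNneq q0; rewrite qE => ->; rewrite mul0r.
have sq' : (size q' <= D.+1)%N.
  by move: sq; rewrite qE size_Mmonic ?monicXsubC // size_XsubC addn2.
move: hq; rewrite qE homzM // => /pr[h|/IH]; first by exists r.
by apply.
Qed.

(** In dimension 0 the Hilbert function is eventually constant, so the monomials X_k^t X_u^(D - t)
    become dependent modulo V. The dependence is a binary form; it splits into linear factors, and
    the prime V contains one. *)
Lemma finite_root V i j (k : 'I_(a + b)) u : subvariety V -> dimlt 1 V ->
  ~ V 'X_(lshift b i) -> ~ V 'X_(rshift a j) ->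
  u = lshift b i /\ (exists k', k = lshift b k') \/ u = rshift a j /\ (exists k', k = rshift a k') ->
  exists r, V ('X_k - r *: 'X_u).
Proof.
move=> sV dV nx ny hu; have pV := subv_prime sV; have [hV V1 pr] := pV.
have [c [N hN]] := EP1_lim (dim_EP sV dV).
have nXn w m : ~ V 'X_w -> ~ V ('X_w ^+ m).
  by move=> nw; elim: m => [//|m IH]; rewrite exprS => /pr[].
have nu : ~ V 'X_u by case: hu => -[-> _].
(* Large enough for degree D to lie in the stable range, and for the D + 1 monomials to outnumber
   the constant value [c]. *)
pose D := (N + `|c|)%N.
(* A coordinate of the other factor, outside V; its power N brings the other degree into the stable
   range. *)
pose w : 'I_(a + b) := if u == lshift b i then rshift a j else lshift b i.
have nw : ~ V 'X_w by rewrite /w; case: ifP.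
pose e := if u == lshift b i then (D, N) else (N, D).
have bX z d m : bideg U_(z)%MM = d -> bihomog (d.1 * m, d.2 * m)%N ('X_z ^+ m : S).
  move=> hz; elim: m => [|m IH]; first by rewrite !muln0 expr0; apply: bihomog1.
  by rewrite exprS !mulnS; apply: (bihomogM (bihomogX hz) IH).
pose P (t : 'I_D.+1) : S := 'X_w ^+ N * ('X_k ^+ t * 'X_u ^+ (D - t)).
have hP t : bihomog e (P t).
  have tD : (t + (D - t))%N = D by rewrite subnKC // -ltnS.
  case: hu => -[uE [k' kE]]; rewrite /P /e /w uE kE ?eqxx ?eq_rlshift.
    have := bihomogM (bX _ _ N (bidegy a j)) (bihomogM (bX _ _ t (bidegx b k')) (bX _ _ (D - t)%N (bidegx b i))).
    by rewrite /addb /= !mul0n !mul1n !add0n !addn0 tD.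
  have := bihomogM (bX _ _ N (bidegx b i)) (bihomogM (bX _ _ t (bidegy a k')) (bX _ _ (D - t)%N (bidegy a j))).
  by rewrite /addb /= !mul0n !mul1n !add0n !addn0 tD.
have : ~ indep_mod V P.
  move=> ip; have hc : hil V e.1 e.2 = `|c|%N.
    have : hilz V e.1 e.2 = c by apply: hN; rewrite /e /D; case: ifP => _ /=; rewrite ?leq_addr.
    by rewrite /hilz => <-.
  have [q [Mq iq sq]] := hilP e.1 e.2 hV.
  have hP' t : bihomog (e.1, e.2) (P t) by case: (e) (hP t).
  have := exchange (ideal_sub hV) ip (fun t => sq (P t) (hP' t)).
  by rewrite hc /D; lia.
move=> /not_all_ex_not[f hf0]; have [hf hf1] := imply_to_and _ _ hf0.
have [t0 /eqP ft0] := not_all_ex_not _ _ hf1.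
pose q := \poly_(t < D.+1) (if insub t is Some t' then f t' else 0).
have qE (t : 'I_D.+1) : q`_t = f t by rewrite coef_poly ltn_ord valK.
apply: (@homz_root V 'X_u 'X_k D q) => //; first exact: size_poly.
  by apply: contraNneq ft0 => q0; rewrite -qE q0 coef0.
have : V ('X_w ^+ N * homz 'X_u 'X_k D q).
  rewrite /homz mulr_sumr [X in V X](_ : _ = \sum_t f t *: P t) //.
  by apply: eq_bigr => t _; rewrite qE /P -scalerAr.
by case/pr=> // /(nXn _ _ nw).
Qed.

(** By [finite_root] every coordinate is modulo V a scalar multiple of one coordinate of its factor;
    the scalars are the coordinates of the point. *)
Lemma nullstellensatz V : subvariety V -> dimlt 1 V -> is_point V.
Proof.
move=> sV dV; have pV := subv_prime sV; have [hV V1 pr] := pV.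
have [_ _ _ [i nx] [j ny]] := sV.
have /functional_choice[x hx] k : exists r, V ('X_(lshift b k) - r *: 'X_(lshift b i)).
  by apply: (finite_root sV dV nx ny); left; split=> //; exists k.
have /functional_choice[y hy] k : exists r, V ('X_(rshift a k) - r *: 'X_(rshift a j)).
  by apply: (finite_root sV dV nx ny); right; split=> //; exists k.
have sV' := ideal_sub hV.
have nz k (r : K) : ~ V 'X_k -> V ('X_k - r *: 'X_k) -> r != 0.
  by move=> nk h; apply/eqP=> r0; apply: nk; move: h; rewrite r0 scale0r subr0.
exists x, y; split.
- by exists i; apply: (nz (lshift b i)).
- by exists j; apply: (nz (rshift a j)).
pose t := [tuple (match split k with inl k' => x k' *: 'X_(lshift b i) | inr k' => y k' *: 'X_(rshift a j) end : S) | k < a + b].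
have cong p : V (p - (p \mPo t)).
  apply: ideal_comp_cong => // v; rewrite tnth_mktuple -[v]splitK.
  by case: (split v) => k; rewrite unsplitK; [exact: hx|exact: hy].
have nXn w m : ~ V 'X_w -> ~ V ('X_w ^+ m).
  by move=> nw; elim: m => [//|m IH]; rewrite exprS => /pr[].
have evX m : ('X_[m] : S) \mPo t =
    ('X_[m] : S).@[bipoint x y] *: ('X_(lshift b i) ^+ (bideg m).1 * 'X_(rshift a j) ^+ (bideg m).2).
  rewrite comp_mpolyX mevalX !big_split_ord /= -scalerA scalerAr scalerAl.
  by congr (_ * _); rewrite -prodrXr -scaler_prod; apply: eq_bigr => k _;
    rewrite tnth_mktuple /bipoint ?(unsplitK (inl k)) ?(unsplitK (inr k)) exprZn.
have tE e p : bihomog e p ->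
  p \mPo t = p.@[bipoint x y] *: ('X_(lshift b i) ^+ e.1 * 'X_(rshift a j) ^+ e.2).
  move=> hp; rewrite {1 2}(mpolyE p) !raddf_sum /= scaler_suml big_seq [RHS]big_seq.
  apply: eq_bigr => m mp; rewrite comp_mpolyZ evX (hp _ mp) mevalZ scalerA //.
have VE e p : bihomog e p -> V p <-> p.@[bipoint x y] = 0.
  move=> hp; have := cong p; rewrite (tE _ _ hp) => h; split=> [Vp|p0].
    apply/eqP/negP=> /negP pn.
    have : V ('X_(lshift b i) ^+ e.1 * 'X_(rshift a j) ^+ e.2).
      rewrite -[_ * _]scale1r -(mulVf pn) -scalerA; apply: (subZ _ sV').
      by have := subB sV' Vp h; rewrite opprB addrC subrK.
    by case/pr; apply: nXn.
  by move: h; rewrite p0 scale0r subr0.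
split=> p hp.
  move=> e _ _ [-> ->]; apply/(VE e); first exact: bicomp_bihomog.
  by case: hV => _ _ _; apply.
by apply: ideal_bicomp => // e; apply/(VE e); [apply: bicomp_bihomog|apply: hp].
Qed.

End Nullstellensatz.

(** * Integrals as limits of differences *)

Section Integral.
Variables (K : closedFieldType) (a b : nat).
Implicit Types (V : polyset K a b) (z : alg_cycle K a b) (es : seq (nat * nat)).

Lemma degree0_lim z n : (forall c, List.In c z -> bihomog_ideal c.2) -> degree0 z n ->
  dlim [::] (cycf z) n%:Z.
Proof.
move=> hz [hp ->]; exists 0%N => i j _ _; rewrite /cstf /deltas /cycf.
elim: z hz hp => [|c z IH] hz hp; first by rewrite big_nil.
rewrite big_cons /= PoszD IH; first last.
- by move=> c' h; apply: hp; right.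
- by move=> c' h; apply: hz; right.
congr (_ + _); rewrite /hilz point_hil ?mulr1 //; first exact: hz (or_introl erefl).
exact: hp (or_introl erefl).
Qed.

Lemma integral_lim es z n : okc (size es).+1 z -> integral_of es z n -> dlim es (cycf z) n%:Z.
Proof.
elim: es z => [|e es IH] z ok /=.
  by apply: degree0_lim => c /ok[sc _]; exact: subv_ideal.
case=> z' hz' /IH h; have [ok' E'] := cap_cycle ok hz'.
rewrite -[n%:Z]add0r.
apply: dlim_eqv (dlim_add (dlim_EP0 E') (h ok')).
by exists 0%N => i j _ _; rewrite /addf /subf subrK.
Qed.

Lemma integral_ex es z : std_degs es -> okc (size es).+1 z -> exists n, integral_of es z n.
Proof.
elim: es z => [|e es IH] z /=.
  move=> _ ok; exists (sumn [seq c.1 | c <- z]); split=> // c /ok[sc dc].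
  exact: nullstellensatz.
move=> /andP[he hes] ok; have [|z' hz'] := @cap_ex _ _ _ e z he; first by move=> c /ok[].
have [ok' _] := cap_cycle ok hz'.
by have [n hn] := IH z' hes ok'; exists n, z'.
Qed.

(** Every choice of sections computes the same limit of differences, which gives uniqueness.
    Coordinates supply sections, and the final components are points by [nullstellensatz], which
    gives existence. *)
Theorem intersection_number_lim es V n : std_degs es -> subvariety V -> dimlt (size es).+1 V ->
  dlim es (hilz V) n%:Z -> intersection_number es V n.
Proof.
move=> hes sV dV hn.
have ok : okc (size es).+1 [:: (1%N, V)] by move=> c [<-|[]].
have H n' : integral_of es [:: (1%N, V)] n' -> n' = n.
  move/(integral_lim ok) => h; have h' : dlim es (hilz V) n'%:Z.
    by apply: dlim_eqv h; exists 0%N => i j _ _; rewrite /cycf big_seq1 mul1r.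
  by have [] := dlim_uniq h' hn.
by split=> //; have [n' hn'] := integral_ex hes ok; rewrite -(H _ hn').
Qed.

End Integral.

(** * Components *)

Section Growth.
Variables (K : fieldType) (a b : nat).
Local Notation S := {mpoly K[a + b]}.
Implicit Types (p q s : S) (e d : nat * nat) (J V W P : polyset K a b).

Lemma hil_prime V d l m n : is_prime V -> bihomog d l -> ~ V l ->
  hil V (d.1 + m) (d.2 + n) = (hil (addi V l) (d.1 + m) (d.2 + n) + hil V m n)%N.
Proof.
move=> [hV V1 pr] hl nVl; rewrite (hil_addi _ _ hV hl); congr (_ + _)%N.
apply: hil_same; first exact: colon_ideal hl.
by split; [move=> p /pr[]|apply: colon_sub].
Qed.

Lemma hil_incr V m n m' n' : subvariety V -> (m <= m')%N -> (n <= n')%N ->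
  (hil V m n <= hil V m' n')%N.
Proof.
move=> sV mm nn; have pV := subv_prime sV; have [_ _ _ [i nx] [j ny]] := sV.
have hx k l : (hil V k l <= hil V k.+1 l)%N.
  by have := hil_prime k l pV (@bihomog_x K a b i) nx; rewrite /= add0n add1n => ->; apply: leq_addl.
have hy k l : (hil V k l <= hil V k l.+1)%N.
  by have := hil_prime k l pV (@bihomog_y K a b j) ny; rewrite /= add0n add1n => ->; apply: leq_addl.
apply: (@leq_trans (hil V m' n)).
  exact: (homo_leq (f := fun k => hil V k n) leqnn leq_trans (fun k => hx k n)).
exact: (homo_leq (f := fun k => hil V m' k) leqnn leq_trans (fun k => hy m' k)).
Qed.

Lemma hil_gt0 V m n : subvariety V -> (0 < hil V m n)%N.
Proof.
move=> sV; apply: (leq_trans _ (hil_incr sV (leq0n m) (leq0n n))).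
have [hV V1 _ _ _] := sV; rewrite lt0n; apply/eqP=> h0; apply: V1.
have := hilP 0 0 hV; rewrite h0 => -[p [_ _ sp]].
have [c] := sp 1 (@bihomog1 K a b); by rewrite big_ord0 subr0.
Qed.

(** Pascal's rule: for W above V and a form s in W outside V, the Hilbert function of V grows at
    each step by at least a value of that of W, since V + (s) lies in W. *)
Lemma growth k V : subvariety V -> ~ dimlt k V ->
  exists2 c, (0 < c)%N & forall N, ('C(N, k) <= hil V (N * c) (N * c))%N.
Proof.
elim: k V => [|k IH] V sV nd.
  by exists 1%N => // N; rewrite bin0; apply: hil_gt0.
have [W [sW VW ndW]] : exists W, [/\ subvariety W, ssubp V W & ~ dimlt k W].
  by apply: NNPP => h; apply: nd => W sW VW; apply: NNPP => h'; apply: h; exists W.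
have [c c0 hc] := IH W sW ndW.
have hV := subv_ideal sV; have [d [s [hs Ws nVs]]] := ssub_comp hV (subv_ideal sW) VW.
(* The step absorbs the bidegree of [s] as well as the step [c] that serves W. *)
exists (c + d.1 + d.2)%N; first by rewrite -addnA ltn_addr.
set c' := (c + _ + _)%N.
elim=> [|N IHN]; first by [].
rewrite binS; apply: (@leq_trans (hil V (d.1 + N * c') (d.2 + N * c'))); last first.
  by apply: hil_incr => //; rewrite mulSn leq_add2r /c'; lia.
rewrite (hil_prime _ _ (subv_prime sV) hs nVs) addnC; apply: leq_add => //.
apply: (leq_trans (hc N)); apply: (@leq_trans (hil W (d.1 + N * c') (d.2 + N * c'))).
  by apply: hil_incr => //; apply: leq_trans (leq_addl _ _); rewrite leq_mul2l /c' -addnA leq_addr orbT.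
apply: hil_mono; [exact: addi_ideal hs|exact: subv_ideal|apply: addi_min => //; first exact: subv_ideal].
by case: VW.
Qed.

(** Otherwise [growth] puts C(n, k), whose k-th difference is 1, below g along a diagonal, where the
    k-th difference of g is eventually 0. *)
Lemma dimlt_bound k V g : subvariety V -> EP k g -> (forall m n, hilz V m n <= g m n) -> dimlt k V.
Proof.
move=> sV hg le; apply: NNPP => nd; have [c c0 hc] := growth sV nd.
have [N hN] := diag_du hg c0.
have [|n] := @du_neg k (fun n => g (n * c)%N (n * c)%N - 'C(n, k)%:Z) N.
  move=> n /hN h; rewrite iterdu_sub h.
  have := du_bin k 0 n; rewrite (_ : (fun n0 => _) = (fun n => 'C(n, k)%:Z)); first by move=> ->.
  by apply: functional_extensionality => i; rewrite addn0.
by have := le (n * c)%N (n * c)%N; have := hc n; rewrite /hilz -lez_nat; lia.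
Qed.

Lemma EP_dimlt k J P : bihomog_ideal J -> EP k (hilz J) -> subvariety P -> subp J P -> dimlt k P.
Proof.
move=> hJ hE sP JP; apply: (dimlt_bound sP hE) => m n.
by rewrite /hilz lez_nat; apply: hil_mono => //; apply: subv_ideal.
Qed.

Definition addI J J' : polyset K a b := fun p => exists u v, [/\ J u, J' v & p = u + v].
Definition capI J J' : polyset K a b := fun p => J p /\ J' p.

Lemma addI_ideal J J' : bihomog_ideal J -> bihomog_ideal J' -> bihomog_ideal (addI J J').
Proof.
move=> [h0 hD hM hC] [h0' hD' hM' hC']; split.
- by exists 0, 0; rewrite addr0.
- move=> _ _ [u [v [Ju Jv ->]]] [u' [v' [Ju' Jv' ->]]]; exists (u + u'), (v + v').
  by rewrite addrACA; split=> //; [apply: hD|apply: hD'].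
- move=> p _ [u [v [Ju Jv ->]]]; exists (p * u), (p * v).
  by rewrite mulrDr; split=> //; [apply: hM|apply: hM'].
- move=> _ e [u [v [Ju Jv ->]]]; exists (bicomp e u), (bicomp e v).
  by rewrite bicompD; split=> //; [apply: hC|apply: hC'].
Qed.

Lemma capI_ideal J J' : bihomog_ideal J -> bihomog_ideal J' -> bihomog_ideal (capI J J').
Proof.
move=> [h0 hD hM hC] [h0' hD' hM' hC']; split=> //.
- by move=> p q [? ?] [? ?]; split; [apply: hD|apply: hD'].
- by move=> p q [? ?]; split; [apply: hM|apply: hM'].
- by move=> p e [? ?]; split; [apply: hC|apply: hC'].
Qed.

Lemma is_subI (E : lmodType K) (M N : E -> Prop) : is_sub M -> is_sub N ->
  is_sub (fun v => M v /\ N v).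
Proof. by move=> [m0 m1] [n0 n1]; split=> // c u v [? ?] [? ?]; split; [apply: m1|apply: n1]. Qed.

(** In each bidegree (J + J') / J' is isomorphic to J / (J :&: J'). *)
Lemma hil_cap J J' m n : bihomog_ideal J -> bihomog_ideal J' ->
  (hil (capI J J') m n + hil (addI J J') m n = hil J m n + hil J' m n)%N.
Proof.
move=> hJ hJ'; have hA := addI_ideal hJ hJ'; have hC := capI_ideal hJ hJ'.
pose e := (m, n); have sS := @bihomog_sub K a b e.
have sJ := ideal_sub hJ; have sJ' := ideal_sub hJ'; have sA := ideal_sub hA; have sC := ideal_sub hC.
have sSJ := is_subI sS sJ; have sSJ' := is_subI sS sJ'; have sSA := is_subI sS sA; have sSC := is_subI sS sC.
have [k [q hq]] := @bideg_span K a b e.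
have [|r hr] := @dimq_ex _ _ (fun v => bihomog e v /\ J v) (fun v => bihomog e v /\ capI J J' v) k q sSC.
  by move=> v [/hq[c ->] _]; exists c; rewrite subrr; case: sSC.
have hr' : dimq (fun v => bihomog e v /\ addI J J' v) (fun v => bihomog e v /\ J' v) r.
  apply: (@dimq_map _ _ _ id) hr => //.
  - move=> v [hv Jv]; split=> //; exists v, 0; rewrite addr0; split=> //; by case: sJ'.
  - move=> w [hw [u [v [Ju Jv wE]]]].
    have hb : w = bicomp e u + bicomp e v by rewrite -bicompD -wE bicomp_id.
    exists (bicomp e u); first by split; [apply: bicomp_bihomog|case: hJ => _ _ _; apply].
    have -> : w - bicomp e u = bicomp e v by rewrite {1}hb addrAC subrr add0r.
    by split; [apply: bicomp_bihomog|case: hJ' => _ _ _ hC'; apply: hC'].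
  - by move=> v [hv Jv]; split=> [[_ []]|[_ ?]].
have ext (I : polyset K a b) : bihomog_ideal I -> dimq (bihomog e) (fun v => bihomog e v /\ I v) (hil I m n).
  by move=> hI; apply: (dimq_ext _ _ sS (hilP m n hI)) => // v hv; split=> [|[]].
have unext (I : polyset K a b) t : bihomog_ideal I -> dimq (bihomog e) (fun v => bihomog e v /\ I v) t -> hil I m n = t.
  by move=> hI h; apply: hil_eq => //; apply: (dimq_ext _ _ sS h) => // v hv; split=> [[]|].
have e1 := unext _ _ hC (dimq_add sSJ sSC (fun v h => h.1)
  (fun v h => conj h.1 h.2.1) (ext _ hJ) hr).
have LN v : bihomog e v /\ J' v -> bihomog e v /\ addI J J' v.
  by move=> [hv Jv]; split=> //; exists 0, v; rewrite add0r; split=> //; case: sJ.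
have e2 := unext _ _ hJ' (dimq_add sSA sSJ' (fun v h => h.1) LN (ext _ hA) hr').
by rewrite e1 e2; lia.
Qed.

Definition capL (Ps : seq (polyset K a b)) : polyset K a b := fun p => forall P, List.In P Ps -> P p.

Lemma capL_ideal Ps : (forall P, List.In P Ps -> bihomog_ideal P) -> bihomog_ideal (capL Ps).
Proof.
move=> h; split=> [P /h[]//|p q hp hq P hP|p q hq P hP|p e hp P hP].
- by case: (h P hP) => _ hD _ _; apply: hD; [apply: hp|apply: hq].
- by case: (h P hP) => _ _ hM _; apply: hM; apply: hq.
- by case: (h P hP) => _ _ _; apply; apply: hp.
Qed.

Lemma prime_capL Q Ps : (forall P, List.In P Ps -> bihomog_ideal P) ->
  is_prime Q -> subp (capL Ps) Q -> exists2 P, List.In P Ps & subp P Q.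
Proof.
move=> hPs [hQ Q1 pr]; elim: Ps hPs => [|P Ps IH] hPs h; first by case: Q1; apply: h.
have [PQ|PQ] := classic (subp P Q); first by exists P => //; left.
have [p [Pp nQp]] : exists p, P p /\ ~ Q p.
  by apply: NNPP => h'; apply: PQ => p Pp; apply: NNPP => nQ; apply: h'; exists p.
have [||P' ? ?] := IH; last by exists P' => //; right.
- by move=> P' h'; apply: hPs; right.
- move=> q hq; have /h/pr[] // : capL (P :: Ps) (p * q).
  move=> P' [<-|P'in].
    by rewrite mulrC; case: (hPs P (or_introl erefl)) => _ _ hM _; apply: hM.
  by case: (hPs P' (or_intror P'in)) => _ _ hM _; exact: hM _ _ (hq _ P'in).
Qed.

(** A prime above P and above the intersection of the others contains some P', hence is strictly
    above P; so in the inclusion-exclusion formula the sum of the two ideals has too small a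
    dimension to contribute. *)
Lemma dlim_capL es Ps (f : polyset K a b -> int) :
  (forall P, List.In P Ps -> [/\ subvariety P, dimlt (size es).+1 P & dlim es (hilz P) (f P)]) ->
  List.ForallOrdPairs (fun P P' => ~ subp P' P) Ps ->
  dlim es (hilz (capL Ps)) (\sum_(P <- Ps) f P).
Proof.
elim: Ps => [|P Ps IH] hPs hF.
  rewrite big_nil; apply/dlim_EP0/(EP_le (leq0n _)); exists 0%N => m n _ _.
  have hC : bihomog_ideal (capL [::]) by apply: capL_ideal.
  by rewrite /hilz /cstf hil0 // => p _ P [].
have [hc hF'] : List.Forall (fun P' => ~ subp P' P) Ps /\
    List.ForallOrdPairs (fun P P' => ~ subp P' P) Ps by inversion hF.
have {}IH := IH (fun P h => hPs P (or_intror h)) hF'.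
have [sP dP lP] := hPs P (or_introl erefl).
have iP : bihomog_ideal P by apply: subv_ideal.
have iPs P' : List.In P' Ps -> bihomog_ideal P'.
  by move=> h; have [s _ _] := hPs P' (or_intror h); apply: subv_ideal.
have iC := capL_ideal iPs; have iA := addI_ideal iP iC.
have lA : dlim es (hilz (addI P (capL Ps))) 0.
  apply/dlim_EP0/EP_ideal => // Q sQ AQ.
  have PQ : subp P Q by move=> p Pp; apply: AQ; exists p, 0; rewrite addr0; split=> //; case: iC.
  have CQ : subp (capL Ps) Q by move=> p Cp; apply: AQ; exists 0, p; rewrite add0r; split=> //; case: iP.
  have [P' P'in P'Q] := prime_capL iPs (subv_prime sQ) CQ.
  apply: (dP Q sQ); split=> // QP; have /List.Forall_forall/(_ _ P'in) := hc; apply.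
  by move=> p /P'Q/QP.
have -> : \sum_(P' <- P :: Ps) f P' = f P + \sum_(P' <- Ps) f P' - 0 by rewrite big_cons subr0.
apply: dlim_eqv (dlim_sub (dlim_add lP IH) lA); exists 0%N => m n _ _.
rewrite /subf /addf /hilz -PoszD -(hil_cap _ _ iP iC) PoszD addrK.
congr Posz; apply: hil_same; first exact: capI_ideal.
split=> p; first by move=> [Pp Cp] P' [<-|/Cp].
by move=> h; split=> [|P' P'in]; apply: h; [left|right].
Qed.

(** J is contained in the intersection of the given primes, and limits are monotone in this range of
    dimensions. Components of J missing from the list only make the inequality strict or leave it
    unchanged. *)
Lemma dlim_components es J Ps (f : polyset K a b -> int) c : std_degs es -> bihomog_ideal J ->
  EP (size es).+1 (hilz J) ->
  (forall P, List.In P Ps -> [/\ subvariety P, subp J P & dlim es (hilz P) (f P)]) ->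
  List.ForallOrdPairs (fun P P' => ~ subp P' P) Ps ->
  dlim es (hilz J) c -> \sum_(P <- Ps) f P <= c.
Proof.
move=> hes hJ EJ hPs hF lJ.
have hP P : List.In P Ps -> [/\ subvariety P, dimlt (size es).+1 P & dlim es (hilz P) (f P)].
  by move=> /hPs[sP JP lP]; split=> //; apply: EP_dimlt hJ EJ sP JP.
apply: (dlim_le hes hJ (J' := capL Ps) _ _ _ lJ).
- by apply: capL_ideal => P /hPs[/subv_ideal].
- by move=> p Jp P /hPs[_ JP _]; apply: JP.
- by move=> P sP JP; apply: EP_dimlt hJ EJ sP JP.
- exact: dlim_capL.
Qed.

End Growth.

(** * Coordinates *)

Lemma rmorph_mpoly_eq (K : nzRingType) (n : nat) (R : nzRingType) (g h : {rmorphism {mpoly K[n]} -> R}) :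
  (forall c, g c%:MP = h c%:MP) -> (forall i, g 'X_i = h 'X_i) -> g =1 h.
Proof.
move=> gC gX p; rewrite (mpolyE p) !rmorph_sum; apply: eq_bigr => m _.
rewrite -mul_mpolyC !rmorphM gC; congr (_ * _).
by rewrite mpolyXE_id !rmorph_prod; apply: eq_bigr => i _; rewrite !rmorphXn gX.
Qed.

Section Coef.
Variable R : comNzRingType.
Implicit Types u v w : 'I_4 -> R.

(* The coefficient of z^m in the product of two linear forms. *)
Definition cf u v (m : 'X_{1..4}) : R :=
  \sum_i \sum_j if (U_(i) + U_(j))%MM == m then u i * v j else 0.

Lemma eq_cf u u' v v' m : u =1 u' -> v =1 v' -> cf u v m = cf u' v' m.
Proof. by move=> /functional_extensionality -> /functional_extensionality ->. Qed.

Lemma cfC u v m : cf u v m = cf v u m.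
Proof.
rewrite /cf exchange_big; apply: eq_bigr => i _; apply: eq_bigr => j _.
by rewrite addmC mulrC.
Qed.

Lemma cf_lin u v w c d m :
  cf u (fun j => c * v j + d * w j) m = c * cf u v m + d * cf u w m.
Proof.
rewrite /cf !mulr_sumr -big_split; apply: eq_bigr => i _ /=.
rewrite !mulr_sumr -big_split; apply: eq_bigr => j _ /=.
by case: ifP => _; rewrite ?mulr0 ?addr0 // mulrDr; congr (_ + _); ring.
Qed.

Lemma cfZ u v c m : cf u (fun j => c * v j) m = c * cf u v m.
Proof.
rewrite -[RHS]addr0 -[X in _ + X](mul0r (cf u u m)) -cf_lin.
by congr cf; apply: functional_extensionality => j; rewrite mul0r addr0.
Qed.

Lemma U2_eq (i j k l : 'I_4) : ((U_(i) + U_(j))%MM == (U_(k) + U_(l))%MM) =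
  ((i == k) && (j == l)) || ((i == l) && (j == k)).
Proof.
apply/eqP/idP => [E|/orP [] /andP [/eqP -> /eqP ->] //]; last by rewrite addmC.
have H t : ((i == t) + (j == t) = (k == t) + (l == t))%N.
  by move/mnmP: E => /(_ t); rewrite !mnmDE !mnm1E.
have := H k; have := H l; have := H i; have := H j; rewrite !eqxx.
rewrite [k == i]eq_sym [l == i]eq_sym [k == j]eq_sym [l == j]eq_sym [k == l]eq_sym [i == j]eq_sym.
by do 6!case: eqVneq => ? //=; subst; rewrite ?eqxx.
Qed.

Lemma cf_pair u v (k l : 'I_4) : k != l -> cf u v (U_(k) + U_(l))%MM = u k * v l + u l * v k.
Proof.
move=> kl; have lk : l != k by rewrite eq_sym.
rewrite /cf (bigD1 k) //= (bigD1 l lk) /=.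
rewrite [X in _ + (_ + X)]big1 => [|i].
  rewrite addr0 (bigD1 l) //= U2_eq !eqxx /= big1 ?addr0 => [|j]; last first.
    by rewrite U2_eq (negbTE kl) eqxx /= orbF => /negbTE ->.
  congr (_ + _); rewrite (bigD1 k) //= U2_eq !eqxx orbT /= big1 ?addr0 => [//|j].
  by rewrite U2_eq (negbTE lk) eqxx /= => /negbTE ->.
case/andP => /negbTE ik /negbTE il; apply: big1 => j _.
by rewrite U2_eq ik il.
Qed.

Lemma cf_diag u v (k : 'I_4) : cf u v (U_(k) + U_(k))%MM = u k * v k.
Proof.
rewrite /cf (bigD1 k) //= [X in _ + X]big1 ?addr0 => [|i /negbTE ik]; last first.
  by apply: big1 => j _; rewrite U2_eq ik.
rewrite (bigD1 k) //= U2_eq !eqxx /= big1 ?addr0 // => j /negbTE jk.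
by rewrite U2_eq jk !andbF.
Qed.

End Coef.

Lemma cf_morph (R R' : comNzRingType) (g : {rmorphism R -> R'}) u v m :
  g (cf u v m) = cf (fun j => g (u j)) (fun j => g (v j)) m.
Proof.
rewrite /cf rmorph_sum; apply: eq_bigr => i _; rewrite rmorph_sum; apply: eq_bigr => j _.
by case: ifP; rewrite ?rmorph0 ?rmorphM.
Qed.

Local Notation NY := #|form_monoms 3 2|.

Definition quad (j : 'I_NY) : 'X_{1..4} := bmnm (enum_val j).

Section Hom.
Variables (K : fieldType) (R : comNzRingType) (h : {rmorphism K -> R}).
Local Notation S := {mpoly K[4 * 4 + NY]}.

Definition vals (X : 'I_4 -> 'I_4 -> R) (Y : 'X_{1..4} -> R) : 'I_(4 * 4 + NY) -> R :=
  fun k => match split k with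
  | inl i => mxvec (\matrix_(r, j) X r j) 0 i
  | inr j => Y (quad j) end.

Definition vx (r j : 'I_4) : 'I_(4 * 4 + NY) := lshift NY (mxvec_index r j).

Lemma vals_x X Y r j : vals X Y (vx r j) = X r j.
Proof. by rewrite /vals (unsplitK (inl _)) mxvecE mxE. Qed.

Lemma vals_y X Y j : vals X Y (rshift (4 * 4) j) = Y (quad j).
Proof. by rewrite /vals (unsplitK (inr _)). Qed.

Lemma var_ind (P : 'I_(4 * 4 + NY) -> Prop) :
  (forall r j, P (vx r j)) -> (forall j, P (rshift (4 * 4) j)) -> forall k, P k.
Proof.
move=> Px Py k; rewrite -(splitK k); case: (split k) => i /=; last exact: Py.
by case/mxvec_indexP: i => r j; exact: Px.
Qed.

Definition hom X Y : S -> R := mmap h (vals X Y).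
HB.instance Definition _ X Y := GRing.RMorphism.copy (hom X Y) (mmap h (vals X Y)).

Lemma hom_x X Y r j : hom X Y 'X_(vx r j) = X r j.
Proof. by rewrite /hom mmapX mmap1U vals_x. Qed.

Lemma hom_y X Y j : hom X Y 'X_(rshift (4 * 4) j) = Y (quad j).
Proof. by rewrite /hom mmapX mmap1U vals_y. Qed.

Lemma homC X Y c : hom X Y c%:MP = h c.
Proof. exact: mmapC. Qed.

Lemma hom_eq (g : {rmorphism S -> R}) X Y : (forall c, g c%:MP = h c) ->
  (forall r j, g 'X_(vx r j) = X r j) -> (forall j, g 'X_(rshift (4 * 4) j) = Y (quad j)) ->
  forall p, g p = hom X Y p.
Proof.
move=> gC gx gy; apply: rmorph_mpoly_eq => [c|]; first by rewrite gC; apply/esym/homC.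
by apply: var_ind => [r j|j]; rewrite ?gx ?gy; apply/esym; [apply: hom_x|apply: hom_y].
Qed.

End Hom.

Lemma quad_ex (k l : 'I_4) : exists j, quad j = (U_(k) + U_(l))%MM.
Proof.
have d2 : mdeg (U_(k) + U_(l))%MM == 2%N by rewrite mdegD !mdeg1.
have lt3 : (mdeg (U_(k) + U_(l))%MM < 3)%N by rewrite (eqP d2).
have H : BMultinom lt3 \in form_monoms 3 2 by rewrite inE /=.
by exists (enum_rank_in H (BMultinom lt3)); rewrite /quad enum_rankK_in.
Qed.

(** * Hyperplane sections *)

Section Cut.
Variables (K : fieldType) (a b : nat).
Local Notation S := {mpoly K[a + b]}.
Implicit Types (e d : nat * nat) (J V W P : polyset K a b).

(* The intersection number of P with divisors of bidegrees es is at least n; void unless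
   dim P <= size es. *)
Definition deg_ge es P (n : nat) :=
  dimlt (size es).+1 P -> forall c, dlim es (hilz P) c -> n%:Z <= c.

Lemma deg_ge_nil P : subvariety P -> deg_ge [::] P 1.
Proof.
move=> sP _ c [N /(_ N N (leqnn _) (leqnn _))] /= H.
by rewrite -[c]/(cstf c N N) -H /hilz lez_nat hil_gt0.
Qed.

(** As v is a nonzerodivisor modulo P, the limit for P with one cut more is the limit for P + (v),
    which [dlim_components] bounds below by the primes above it. *)
Lemma deg_ge_cut es e v P (Qs : seq (polyset K a b * nat)) : std_degs es ->
  subvariety P -> bihomog e v -> ~ P v ->
  (forall Q, List.In Q Qs -> [/\ subvariety Q.1, subp P Q.1, Q.1 v & deg_ge es Q.1 Q.2]) ->
  List.ForallOrdPairs (fun Q Q' => ~ subp Q'.1 Q.1) Qs ->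
  deg_ge (e :: es) P (\sum_(Q <- Qs) Q.2)%N.
Proof.
move=> std sP ev Pv HQ inc dP c lc.
have pP := subv_prime sP; have iP := subv_ideal sP.
have iA : bihomog_ideal (addi P v) by apply: addi_ideal ev.
have dQ Q : List.In Q Qs -> dimlt (size es).+1 Q.1.
  by case/HQ => sQ PQ Qv _; apply: dimlt_sub dP sQ _; split => // /(_ _ Qv).
have lA : dlim es (hilz (addi P v)) c.
  by move: lc; rewrite /dlim /= (delta_hil pP ev Pv); apply: dlim_unshift.
have EA : EP (size es).+1 (hilz (addi P v)).
  by apply: (@EP_unshift _ e); rewrite -(delta_hil pP ev Pv); apply/EP_delta/dim_EP.
pose f W := epsilon (inhabits (0 : int)) (dlim es (hilz W)).
have fP Q : List.In Q Qs -> dlim es (hilz Q.1) (f Q.1).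
  move=> QQ; apply: epsilon_spec; apply: dlim_ex; apply: dim_EP; last exact: dQ.
  by case: (HQ _ QQ).
have := @dlim_components K a b es (addi P v) (map fst Qs) f c std iA EA _ _ lA.
move=> H; apply: le_trans (H _ _).
- rewrite big_map.
  have : (\sum_(Q <- Qs) Q.2)%:Z = \sum_(Q <- Qs) (Q.2)%:Z :> int.
    by elim: (Qs) => [|Q r IH]; rewrite ?big_nil // !big_cons PoszD IH.
  move=> ->; have {H inc} : forall Q, List.In Q Qs -> (Q.2)%:Z <= f Q.1.
    by move=> Q QQ; have [_ _ _] := HQ _ QQ; apply; [apply: dQ|apply: fP].
  elim: (Qs) => [|Q r IH] H; first by rewrite !big_nil.
  by rewrite !big_cons lerD ?H ?IH //=; [left|move=> Q' ?; apply: H; right].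
- move=> W /List.in_map_iff [Q [<- QQ]]; have [sQ PQ Qv _] := HQ _ QQ.
  by split=> //; [apply: addi_min => //; apply: subv_ideal|apply: fP].
- by elim: inc => [|Q r HF _ IH] /=; constructor=> //; apply/List.Forall_map.
Qed.

End Cut.

(** * Monomial specializations *)

(* Entries 0, 1 of a state are the parameters tau_t; entries 2 + 4 * k + j, for
   k < 4 and j < 4, are p_j, q_j, alpha_j, beta_j.  An entry is a monomial in 18
   variables, or zero (None). *)
Definition state := seq (option (seq nat)).
Definition entry (s : state) i := nth None s i.
Definition mule (e e' : option (seq nat)) :=
  if (e, e') is (Some m, Some m') then Some (m ++ m') else None.
Definition eqe (e e' : option (seq nat)) :=
  match e, e' with
  | None, None => true
  | Some m, Some m' => all (fun i => count_mem i m == count_mem i m') (iota 0 18)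
  | _, _ => false
  end.

(** [Br i j k l] is the 2 x 2 determinant s_i s_l - s_j s_k of entries. *)
Inductive factor := Ent of nat | Br of nat & nat & nat & nat.
(** Tests whether a factor is the zero polynomial: a difference of two monomials vanishes only if
    they coincide. In a domain this settles products as well, by [zprod]. *)
Definition zfac s f :=
  match f with
  | Ent i => ~~ entry s i
  | Br i j k l => eqe (mule (entry s i) (entry s l)) (mule (entry s j) (entry s k))
  end.
Definition zprod s := has (zfac s).

(** [VY j k] is the coefficient of z_j z_k with j < k; the diagonal coefficients have been cut away
    beforehand. *)
Inductive coordvar := VX of nat & nat | VY of nat & nat.
Definition vdeg v : nat * nat := if v is VX _ _ then (1, 0)%N else (0, 1)%N.
Definition vok v := match v with VX r j => (r < 4) && (j < 4) | VY j k => (j < k) && (k < 4) end%N.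
Definition brp j k := Br (2 + j) (6 + j) (2 + k) (6 + k).
Definition bra j k := Br (10 + j) (14 + j) (10 + k) (14 + k).
(** The factors of the image of a coordinate under [theta]: tau_(r/2), alpha_j and p_j or q_j for
    [VX]; for [VY] the determinants of (p, q) and of (alpha, beta) in columns j and k. *)
Definition vfac v :=
  match v with
  | VX r j => [:: Ent r./2; Ent (10 + j); Ent (2 + 4 * odd r + j)]
  | VY j k => [:: brp j k; bra j k]
  end.
Definition allvars := [seq VX r j | r <- iota 0 4, j <- iota 0 4] ++
  [seq VY j k | k <- iota 0 4, j <- iota 0 k].
(** Forms that separate two specializations: coordinates, minors m_jk of the first two rows of x,
    and the combinations y_jl m_kl - y_kl m_jl. The images of all of them are products of
    factors. *)
Inductive witness := WVar of coordvar | WMinor of nat & nat | WSyz of nat & nat & nat.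
Definition wok w :=
  match w with
  | WVar v => vok v
  | WMinor j k => (j < 4) && (k < 4)
  | WSyz j k l => [&& j < 4, k < 4, l < 4, j != l & k != l]
  end%N.
Definition wfac w :=
  match w with
  | WVar v => vfac v
  | WMinor j k => [:: Ent 0; Ent 0; Ent (10 + j); Ent (10 + k); brp j k]
  | WSyz j k l => [:: Ent 0; Ent 0; brp j l; brp k l; Ent (10 + l); Ent (10 + l); bra j k]
  end.
Definition witnesses := filter wok (map WVar allvars ++
  [seq WMinor j k | k <- iota 0 4, j <- iota 0 k] ++
  flatten [seq [seq WSyz j k l | k <- iota 0 4, j <- iota 0 k] | l <- iota 0 4]).
Definition incomp s s' := has (fun w => ~~ zprod s (wfac w) && zprod s' (wfac w)) witnesses.
Definition relevant s := has (fun v => (vdeg v == (1, 0)%N) && ~~ zprod s (vfac v)) allvars &&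
  has (fun v => (vdeg v == (0, 1)%N) && ~~ zprod s (vfac v)) allvars.

Definition subst := seq (nat * option (seq nat)).
(** An unlisted parameter is kept, and an index beyond 17 stands for 1, as in [varr]. *)
Definition appv (sb : subst) x : option (seq nat) :=
  if (x < 18)%N then
    if [seq c.2 | c <- sb & c.1 == x] is e :: _ then e else Some [:: x]
  else Some [::].
Definition appm sb m := foldr (fun x e => mule (appv sb x) e) (Some [::]) m.
Definition app sb (s : state) : state := map (obind (appm sb)) s.

(* A certificate for deg_ge: a node cuts by a coordinate, and its children are
   specializations of the parameters that kill this coordinate. *)
Inductive tree := Leaf of coordvar | Node of coordvar & seq (subst * tree).
Fixpoint leaves t := if t is Node _ kids then sumn (map (fun k => leaves k.2) kids) else 1%N.
Fixpoint checks (es : seq (nat * nat)) (t : tree) (s : state) : bool :=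
  relevant s &&
  match es, t with
  | [::], Leaf _ => true
  | e :: es', Node v kids =>
    [&& vok v, vdeg v == e, ~~ zprod s (vfac v),
      all (fun k => zprod (app k.1 s) (vfac v) && checks es' k.2 (app k.1 s)) kids &
      pairwise (fun k k' => incomp (app k.1 s) (app k'.1 s)) kids]
  | _, _ => false
  end.

Arguments relevant : simpl never.
Arguments zprod : simpl never.
Arguments app : simpl never.
Arguments incomp : simpl never.

(** * Soundness of the certificates *)

Section Sound.
Variable K : fieldType.
Local Notation R := {mpoly K[18]}.
Local Notation S := {mpoly K[4 * 4 + NY]}.

Definition varr x : R := if insub x is Some i then 'X_i else 1.
Definition mono m : R := \prod_(x <- m) varr x.
Definition ent e : R := if e is Some m then mono m else 0.

Lemma monoE m : mono m = 'X_[[multinom count_mem (i : nat) m | i < 18]].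
Proof.
rewrite /mono; elim: m => [|x m IH].
  rewrite big_nil -mpolyX0; congr 'X_[_]; apply/mnmP => i; by rewrite mnm0E mnmE.
rewrite big_cons IH /varr; case: insubP => [i _ <-|lx].
  by rewrite -mpolyXD; congr 'X_[_]; apply/mnmP => j; rewrite mnmDE mnm1E !mnmE /= -val_eqE.
rewrite mul1r; congr 'X_[_]; apply/mnmP => j; rewrite !mnmE /=.
by case: eqP => // xj; rewrite -xj in lx *; rewrite xj ltn_ord in lx.
Qed.

Lemma mono_neq0 m : mono m != 0.
Proof. by rewrite monoE -msupp_eq0 msuppX. Qed.

Lemma eqeP e e' : (ent e == ent e') = eqe e e'.
Proof.
rewrite /eqe; case: e e' => [m|] [m'|]; rewrite /ent; [|exact/negbTE/mono_neq0|by rewrite eq_sym; exact/negbTE/mono_neq0|exact: eqxx].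
rewrite !monoE; apply/eqP/allP => [E i|H].
  rewrite mem_iota add0n => /andP [_ li].
  move: E => /(congr1 (fun p => p@_[multinom count_mem (i : nat) m | i < 18])).
  rewrite !mcoeffX eqxx; case: eqP => [E _|_ /eqP]; last by rewrite oner_eq0.
  by move/mnmP: E => /(_ (Ordinal li)); rewrite !mnmE /= eq_sym => ->.
congr 'X_[_]; apply/mnmP => i; rewrite !mnmE.
by apply/eqP/(H (i : nat)); rewrite mem_iota /= ltn_ord.
Qed.

Lemma entM e e' : ent (mule e e') = ent e * ent e'.
Proof. by case: e e' => [m|] [m'|] //=; rewrite ?mulr0 ?mul0r // /mono big_cat. Qed.

Definition vent s i := ent (entry s i).
Definition fval s f : R :=
  match f with
  | Ent i => vent s i
  | Br i j k l => vent s i * vent s l - vent s j * vent s k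
  end.

Lemma fvalP s f : (fval s f == 0) = zfac s f.
Proof.
case: f => [i|i j k l] /=.
  by rewrite /vent; case: entry => [m|] /=; rewrite ?eqxx ?(negbTE (mono_neq0 _)).
by rewrite subr_eq0 /vent -!entM eqeP.
Qed.

Definition wval s w : R := \prod_(f <- w) fval s f.

Lemma wvalP s w : (wval s w == 0) = zprod s w.
Proof.
rewrite /wval; elim: w => [|f w IH]; first by rewrite big_nil oner_eq0.
by rewrite big_cons mulf_eq0 IH fvalP.
Qed.

(* The first parametrization after cutting by the four y_jj: psi_0j = alpha_j p_j,
   psi_1j = alpha_j q_j, l_0j = beta_j q_j, l_1j = - beta_j p_j, hence
   y_jk = (p_j q_k - q_j p_k) (alpha_j beta_k - beta_j alpha_k). *)
Definition psi s b j : R := vent s (10 + j) * vent s (2 + 4 * b + j).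
Definition thetaX s (r j : 'I_4) : R := vent s r./2 * psi s (odd r) j.
Definition thetaY s (m : 'X_{1..4}) : R :=
  cf (fun j => psi s 0 j) (fun j => vent s (14 + j) * vent s (6 + j)) m +
  cf (fun j => psi s 1 j) (fun j => - (vent s (14 + j) * vent s (2 + j))) m.
Definition theta s : {rmorphism S -> R} := hom (@mpolyC 18 K) (thetaX s) (thetaY s).

Lemma theta_x s r j : theta s 'X_(vx r j) = wval s (vfac (VX r j)).
Proof. by rewrite [LHS]hom_x /wval unlock /= /thetaX /psi mulr1. Qed.

Lemma theta_y s (j k : 'I_4) l : j != k -> quad l = (U_(j) + U_(k))%MM ->
  theta s 'X_(rshift (4 * 4) l) = wval s (vfac (VY j k)).
Proof.
move=> jk El; rewrite [LHS]hom_y El /thetaY !cf_pair // /wval unlock /= /psi mulr1.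
by rewrite muln0 muln1; ring.
Qed.

Lemma coordvar_ex v : vok v -> exists2 i, bihomog (vdeg v) ('X_i : S) &
  forall s, theta s 'X_i = wval s (vfac v).
Proof.
case: v => [r j|j k] /andP [h1 h2].
  by exists (vx (Ordinal h1) (Ordinal h2)); [exact: bihomog_x|move=> s; rewrite theta_x].
have h3 := ltn_trans h1 h2.
have [l El] := quad_ex (Ordinal h3) (Ordinal h2).
exists (rshift (4 * 4) l); first exact: bihomog_y.
by move=> s; rewrite (theta_y s _ El) // -val_eqE /= neq_ltn h1.
Qed.

Definition realizes P w := (exists e, bihomog e P) /\ forall s, theta s P = wval s w.

Definition minor (j k : 'I_4) : S :=
  'X_(vx (@Ordinal 4 0 isT) j) * 'X_(vx (@Ordinal 4 1 isT) k) -
  'X_(vx (@Ordinal 4 0 isT) k) * 'X_(vx (@Ordinal 4 1 isT) j).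

Lemma minor_bihomog j k : bihomog (2, 0)%N (minor j k).
Proof.
by apply: (subB (bihomog_sub _));
  apply: (@bihomogM _ _ _ (1, 0)%N (1, 0)%N); exact: bihomog_x.
Qed.

Lemma theta_minor s j k : theta s (minor j k) = wval s (wfac (WMinor j k)).
Proof.
rewrite rmorphB !rmorphM !theta_x /wval unlock /= ?muln0 ?muln1 ?addn0.
by ring.
Qed.

(** The combination factors by the three-term relation [j l] alpha_k - [k l] alpha_j = alpha_l [j k]
    between the determinants of (alpha, beta). *)
Lemma realizes_syz (j k l : 'I_4) : j != l -> k != l -> exists P, realizes P (wfac (WSyz j k l)).
Proof.
move=> jl kl; have [y1 E1] := quad_ex j l; have [y2 E2] := quad_ex k l.
exists ('X_(rshift (4 * 4) y1) * minor k l - 'X_(rshift (4 * 4) y2) * minor j l); split=> [|s].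
  by exists (2, 1)%N; apply: (subB (bihomog_sub _));
    (apply: (@bihomogM _ _ _ (0, 1)%N (2, 0)%N); [exact: bihomog_y|exact: minor_bihomog]).
rewrite rmorphB !rmorphM !theta_minor (theta_y s jl E1) (theta_y s kl E2) /wval unlock /=.
by ring.
Qed.

Lemma witness_ex w : wok w -> exists P, realizes P (wfac w).
Proof.
case: w => [v /coordvar_ex [i bi th]|j k /andP [lj lk]|j k l /and5P [lj lk ll jl kl]].
- by exists 'X_i; split=> //; exists (vdeg v).
- exists (minor (Ordinal lj) (Ordinal lk)); split=> [|s]; last exact: theta_minor.
  by exists (2, 0)%N; exact: minor_bihomog.
by apply: (@realizes_syz (Ordinal lj) (Ordinal lk) (Ordinal ll)).
Qed.

Definition spec_ideal s : polyset K _ _ := bker (theta s).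

Lemma spec_ideal_zero s P w : realizes P w -> spec_ideal s P <-> zprod s w.
Proof.
case=> [[e be] E]; rewrite /spec_ideal (bkerE (theta s) be) E -wvalP.
by split=> [->|/eqP].
Qed.

Lemma incompP s s' : incomp s s' -> ~ subp (spec_ideal s') (spec_ideal s).
Proof.
rewrite /incomp => H sub.
have {H} [w [ww z1 z2]] : exists w, [/\ wok w, ~~ zprod s (wfac w) & zprod s' (wfac w)].
  have : all wok witnesses by [].
  elim: witnesses H => //= w l IH /orP [/andP [? ?]|H] /andP [? al]; first by exists w.
  exact: IH.
have [P rP] := witness_ex ww; move/negP: z1; apply.
by apply/(spec_ideal_zero s rP)/sub/(spec_ideal_zero s' rP).
Qed.

Lemma spec_ideal_subv s : relevant s -> subvariety (spec_ideal s).
Proof.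
have H d : has (fun v => (vdeg v == d) && ~~ zprod s (vfac v)) allvars ->
    exists i, [/\ bihomog d ('X_i : S) & theta s 'X_i != 0].
  have : all vok allvars by [].
  elim: allvars => //= v l IH /andP [vk al] /orP [/andP [/eqP <- nz]|]; last exact: IH.
  by have [i bi th] := coordvar_ex vk; exists i; split=> //; rewrite th wvalP.
case/andP => /H [i [bi nzi]] /H [j [bj nzj]].
have Hd (k : 'I_(4 * 4 + NY)) d : bihomog d ('X_k : S) -> bideg U_(k)%MM = d.
  by move=> bk; apply: bk; rewrite msuppX inE.
move: nzi nzj (Hd _ _ bi) (Hd _ _ bj); case: (split_ordP i) => i' ->; last by rewrite bidegy.
by case: (split_ordP j) => j' -> //; rewrite ?bidegx // => nzi nzj _ _; apply: bker_subv nzi nzj.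
Qed.

Definition sigma sb : {rmorphism R -> R} :=
  mmap (@mpolyC 18 K) (fun i : 'I_18 => ent (appv sb i)).

Lemma sigma_ent sb e : sigma sb (ent e) = ent (obind (appm sb) e).
Proof.
case: e => [m|] /=; last exact: rmorph0.
elim: m => [|x m IH] /=; first by rewrite /mono !big_nil rmorph1.
rewrite entM -IH /mono big_cons rmorphM; congr (_ * _).
rewrite /varr /appv; case: insubP => [i -> <-|/negbTE ->].
  by rewrite [LHS]mmapX mmap1U /appv ltn_ord.
by rewrite rmorph1 /= /mono big_nil.
Qed.

Lemma vent_app sb s i : vent (app sb s) i = sigma sb (vent s i).
Proof.
rewrite /vent sigma_ent /entry /app; congr ent.
case: (ltnP i (size s)) => li; first by rewrite (nth_map None).
by rewrite !nth_default ?size_map.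
Qed.

Lemma theta_app sb s p : theta (app sb s) p = sigma sb (theta s p).
Proof.
have -> : sigma sb (theta s p) = (sigma sb \o theta s) p by [].
apply/esym; apply: hom_eq => [c|r j|j] /=.
- by rewrite homC [LHS]mmapC.
- by rewrite hom_x /thetaX /psi !vent_app !rmorphM.
rewrite hom_y /thetaY rmorphD !cf_morph /psi.
by congr (_ + _); apply: eq_cf => i; rewrite !vent_app ?rmorphN !rmorphM.
Qed.

(** Specializing the parameters composes [theta] with a ring morphism, so the kernel can only
    grow. *)
Lemma spec_ideal_app sb s : subp (spec_ideal s) (spec_ideal (app sb s)).
Proof. by apply: bker_eq => e p _ E; rewrite theta_app E rmorph0. Qed.

Lemma pairwise_Forall (T U : Type) (r : rel T) (q : U -> U -> Prop) (g : T -> U) (l : seq T) :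
  (forall x y, r x y -> q (g x) (g y)) -> pairwise r l -> List.ForallOrdPairs q (map g l).
Proof.
move=> H; elim: l => [|x l IH] /=; first by constructor.
case/andP => al /IH pw; constructor=> // {pw IH}; elim: l al => [|y l IH] /=; first by constructor.
by case/andP => /H ? /IH ?; constructor.
Qed.

(** The children of a node are irreducible subvarieties of the section, none redundant; a leaf,
    where no cut remains, contributes at least 1. *)
Lemma tree_deg es t s : std_degs es -> checks es t s ->
  deg_ge es (spec_ideal s) (leaves t) /\ subvariety (spec_ideal s).
Proof.
elim: es t s => [|e es IH] [v|v kids] s; rewrite [checks _ _ _]/= ?andbF ?andbT.
- by move=> _ /spec_ideal_subv rs; split; [exact: deg_ge_nil|].
- by [].
- by [].
case/andP => se sd /andP [/spec_ideal_subv rs] /and5P [vk /eqP ve nz al pw]; split; last exact: rs.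
rewrite [leaves _]/=.
have [i bi th] := coordvar_ex vk.
pose g (k : subst * tree) := (spec_ideal (app k.1 s), leaves k.2).
have -> : sumn [seq leaves k.2 | k <- kids] = (\sum_(Q <- map g kids) Q.2)%N.
  by rewrite sumnE !big_map.
have rv : realizes 'X_i (vfac v) by split=> //; exists (vdeg v).
apply: (@deg_ge_cut _ _ _ _ _ 'X_i) => //; first by rewrite -ve.
- by move/(spec_ideal_zero s rv); exact/negP.
- move=> Q /List.in_map_iff [k [<- kk]] /=.
  have {al} /andP [zk /(IH _ _ sd) [dk sk]] : zprod (app k.1 s) (vfac v) && checks es k.2 (app k.1 s).
    by elim: kids al kk {pw} => //= k' l IHl /andP [Hk al] [<- //|]; exact: IHl.
  split; [exact: sk|exact: spec_ideal_app| |exact: dk].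
  by apply/(spec_ideal_zero _ rv); exact: zk.
by apply: pairwise_Forall pw => k k'; exact: incompP.
Qed.

End Sound.

(** * The component of a ruling *)

Definition kill i : nat * option (seq nat) := (i, None).
Definition send i m : nat * option (seq nat) := (i, Some m).

(* Found by a computer search. *)
Definition tree6 : tree := (Node (VY 0 1) [:: ([:: send 10 [:: 10;11]; send 11 [:: 10;14]; send 14
  [:: 15;11]; send 15 [:: 15;14]], Node (VY 0 2) [:: ([:: send 10 [:: 10;12]; send 12 [:: 10;15];
  send 15 [:: 16;12]; send 16 [:: 16;15]], Node (VX 0 0) [:: ([:: kill 2], Node (VX 1 0) [:: ([::
  kill 11], Node (VX 0 1) [:: ([:: kill 3], Node (VX 1 1) [:: ([:: kill 12], Node (VX 0 2) [::
  ([:: kill 4], Node (VX 1 2) [:: ([:: kill 10], Node (VX 1 3) [:: ([:: kill 9], Leaf (VX 0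
  3))])])])])])])])])])%N.
Definition tree7 : tree := (Node (VY 0 1) [:: ([:: send 10 [:: 10;11]; send 11 [:: 10;14]; send 14
  [:: 15;11]; send 15 [:: 15;14]], Node (VY 0 2) [:: ([:: send 2 [:: 2;4]; send 4 [:: 2;6]; send 6
  [:: 8;4]; send 8 [:: 8;6]], Node (VY 0 3) [:: ([:: send 10 [:: 10;13]; send 13 [:: 10;15]; send
  15 [:: 17;13]; send 17 [:: 17;15]], Node (VX 0 0) [:: ([:: kill 11], Node (VX 0 1) [:: ([:: kill
  3], Node (VX 1 1) [:: ([:: kill 13], Node (VX 0 2) [:: ([:: kill 2], Node (VX 1 2) [:: ([:: kill
  12], Node (VX 1 3) [:: ([:: kill 9], Leaf (VX 0 3))])])])])]); ([:: kill 2], Node (VX 1 0) [::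
  ([:: kill 11], Node (VX 0 1) [:: ([:: kill 3], Node (VX 1 1) [:: ([:: kill 13], Node (VX 1 2)
  [:: ([:: kill 12], Node (VX 1 3) [:: ([:: kill 9], Leaf (VX 0 3))])])])])])])]); ([:: send 10
  [:: 10;12]; send 12 [:: 10;15]; send 15 [:: 16;12]; send 16 [:: 16;15]], Node (VY 0 3) [:: ([::
  send 2 [:: 2;5]; send 5 [:: 2;6]; send 6 [:: 9;5]; send 9 [:: 9;6]], Node (VX 0 0) [:: ([:: kill
  11], Node (VX 0 1) [:: ([:: kill 3], Node (VX 1 1) [:: ([:: kill 12], Node (VX 0 2) [:: ([::
  kill 4], Node (VX 1 2) [:: ([:: kill 10], Node (VX 1 3) [:: ([:: kill 9], Leaf (VX 0
  3))])])])])]); ([:: kill 2], Node (VX 1 0) [:: ([:: kill 11], Node (VX 0 1) [:: ([:: kill 3],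
  Node (VX 1 1) [:: ([:: kill 12], Node (VX 1 2) [:: ([:: kill 8], Node (VX 0 2) [:: ([:: kill
  10], Leaf (VX 1 3))])])])])])])])]); ([:: send 2 [:: 2;3]; send 3 [:: 2;6]; send 6 [:: 7;3];
  send 7 [:: 7;6]], Node (VY 0 2) [:: ([:: send 10 [:: 10;12]; send 12 [:: 10;14]; send 14 [::
  16;12]; send 16 [:: 16;14]], Node (VY 0 3) [:: ([:: send 10 [:: 10;13]; send 13 [:: 10;16]; send
  16 [:: 17;13]; send 17 [:: 17;16]], Node (VX 0 0) [:: ([:: kill 12], Node (VX 0 1) [:: ([:: kill
  2], Node (VX 1 1) [:: ([:: kill 11], Node (VX 0 2) [:: ([:: kill 4], Node (VX 1 2) [:: ([:: kill
  13], Node (VX 1 3) [:: ([:: kill 9], Leaf (VX 0 3))])])])])]); ([:: kill 2], Node (VX 1 0) [::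
  ([:: kill 12], Node (VX 1 1) [:: ([:: kill 11], Node (VX 0 2) [:: ([:: kill 4], Node (VX 1 2)
  [:: ([:: kill 13], Node (VX 1 3) [:: ([:: kill 9], Leaf (VX 0 3))])])])])])])])])])%N.
Definition tree8 : tree := (Node (VY 0 1) [:: ([:: send 2 [:: 2;3]; send 3 [:: 2;6]; send 6 [::
  7;3]; send 7 [:: 7;6]], Node (VY 0 2) [:: ([:: send 10 [:: 10;12]; send 12 [:: 10;14]; send 14
  [:: 16;12]; send 16 [:: 16;14]], Node (VY 0 3) [:: ([:: send 2 [:: 2;5]; send 5 [:: 2;7]; send 7
  [:: 9;5]; send 9 [:: 9;7]], Node (VY 1 2) [:: ([:: send 11 [:: 11;10]; send 10 [:: 11;15]; send
  15 [:: 16;10]; send 16 [:: 16;15]], Node (VX 0 0) [:: ([:: kill 12], Node (VX 0 1) [:: ([:: kill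
  10], Node (VX 0 2) [:: ([:: kill 4], Node (VX 1 2) [:: ([:: kill 11], Node (VX 1 3) [:: ([::
  kill 9], Leaf (VX 0 3))])])]); ([:: kill 2], Node (VX 1 1) [:: ([:: kill 10], Node (VX 1 2) [::
  ([:: kill 8], Node (VX 0 2) [:: ([:: kill 11], Leaf (VX 1 3))])])])]); ([:: kill 2], Node (VX 1
  0) [:: ([:: kill 12], Node (VX 1 1) [:: ([:: kill 10], Node (VX 1 2) [:: ([:: kill 8], Node (VX
  0 2) [:: ([:: kill 11], Leaf (VX 1 3))])])])])])]); ([:: send 10 [:: 10;13]; send 13 [:: 10;16];
  send 16 [:: 17;13]; send 17 [:: 17;16]], Node (VY 1 2) [:: ([:: send 2 [:: 2;4]; send 4 [::
  2;7]; send 7 [:: 8;4]; send 8 [:: 8;7]], Node (VX 0 0) [:: ([:: kill 12], Node (VX 0 1) [:: ([::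
  kill 11], Node (VX 0 2) [:: ([:: kill 2], Node (VX 1 2) [:: ([:: kill 13], Node (VX 1 3) [::
  ([:: kill 9], Leaf (VX 0 3))])])]); ([:: kill 2], Node (VX 1 1) [:: ([:: kill 11], Node (VX 1 2)
  [:: ([:: kill 13], Node (VX 1 3) [:: ([:: kill 9], Leaf (VX 0 3))])])])]); ([:: kill 2], Node
  (VX 1 0) [:: ([:: kill 12], Node (VX 1 1) [:: ([:: kill 11], Node (VX 1 2) [:: ([:: kill 13],
  Node (VX 1 3) [:: ([:: kill 9], Leaf (VX 0 3))])])])])])]); ([:: kill 3], Node (VY 1 2) [:: ([::
  send 11 [:: 11;10]; send 10 [:: 11;15]; send 15 [:: 16;10]; send 16 [:: 16;15]], Node (VX 0 1)
  [:: ([:: kill 2], Node (VX 1 1) [:: ([:: kill 10], Node (VX 0 2) [:: ([:: kill 4], Node (VX 1 2)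
  [:: ([:: kill 11], Node (VX 1 3) [:: ([:: kill 9], Leaf (VX 0 3))])])])])])])]); ([:: send 2 [::
  2;4]; send 4 [:: 2;7]; send 7 [:: 8;4]; send 8 [:: 8;7]], Node (VY 0 3) [:: ([:: send 10 [::
  10;13]; send 13 [:: 10;14]; send 14 [:: 17;13]; send 17 [:: 17;14]], Node (VY 1 3) [:: ([:: send
  11 [:: 11;10]; send 10 [:: 11;15]; send 15 [:: 17;10]; send 17 [:: 17;15]], Node (VX 0 0) [::
  ([:: kill 13], Node (VX 0 1) [:: ([:: kill 10], Node (VX 0 2) [:: ([:: kill 2], Node (VX 1 2)
  [:: ([:: kill 12], Node (VX 1 3) [:: ([:: kill 9], Leaf (VX 0 3))])])]); ([:: kill 2], Node (VX
  1 1) [:: ([:: kill 10], Node (VX 1 2) [:: ([:: kill 12], Node (VX 1 3) [:: ([:: kill 9], Leaf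
  (VX 0 3))])])])]); ([:: kill 2], Node (VX 1 0) [:: ([:: kill 13], Node (VX 1 1) [:: ([:: kill
  10], Node (VX 1 2) [:: ([:: kill 12], Node (VX 1 3) [:: ([:: kill 9], Leaf (VX 0
  3))])])])])])])])]); ([:: send 10 [:: 10;11]; send 11 [:: 10;14]; send 14 [:: 15;11]; send 15
  [:: 15;14]], Node (VY 0 2) [:: ([:: send 2 [:: 2;4]; send 4 [:: 2;6]; send 6 [:: 8;4]; send 8
  [:: 8;6]], Node (VY 0 3) [:: ([:: send 2 [:: 2;5]; send 5 [:: 2;8]; send 8 [:: 9;5]; send 9 [::
  9;8]], Node (VY 1 2) [:: ([:: send 10 [:: 10;12]; send 12 [:: 10;15]; send 15 [:: 16;12]; send
  16 [:: 16;15]], Node (VX 0 0) [:: ([:: kill 11], Node (VX 0 1) [:: ([:: kill 3], Node (VX 1 2)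
  [:: ([:: kill 15], Node (VX 1 1) [:: ([:: kill 10], Node (VX 1 3) [:: ([:: kill 9], Leaf (VX 0
  3))])]); ([:: kill 9], Node (VX 0 2) [:: ([:: kill 15], Node (VX 1 1) [:: ([:: kill 10], Leaf
  (VX 0 3))])])])]); ([:: kill 2], Node (VX 1 0) [:: ([:: kill 11], Node (VX 1 1) [:: ([:: kill
  7], Node (VX 1 2) [:: ([:: kill 15], Node (VX 0 1) [:: ([:: kill 10], Leaf (VX 1
  3))])])])])])]); ([:: send 10 [:: 10;13]; send 13 [:: 10;15]; send 15 [:: 17;13]; send 17 [::
  17;15]], Node (VY 1 2) [:: ([:: send 3 [:: 3;2]; send 2 [:: 3;7]; send 7 [:: 8;2]; send 8 [::
  8;7]], Node (VX 0 0) [:: ([:: kill 11], Node (VX 0 1) [:: ([:: kill 13], Node (VX 0 2) [:: ([::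
  kill 3], Node (VX 1 2) [:: ([:: kill 12], Node (VX 1 3) [:: ([:: kill 9], Leaf (VX 0 3))])])]);
  ([:: kill 3], Node (VX 1 1) [:: ([:: kill 13], Node (VX 1 2) [:: ([:: kill 12], Node (VX 1 3)
  [:: ([:: kill 9], Leaf (VX 0 3))])])])]); ([:: kill 3], Node (VX 1 0) [:: ([:: kill 11], Node
  (VX 1 1) [:: ([:: kill 13], Node (VX 1 2) [:: ([:: kill 12], Node (VX 1 3) [:: ([:: kill 9],
  Leaf (VX 0 3))])])])])])]); ([:: kill 4], Node (VY 1 2) [:: ([:: send 10 [:: 10;12]; send 12 [::
  10;15]; send 15 [:: 16;12]; send 16 [:: 16;15]], Node (VX 0 1) [:: ([:: kill 3], Node (VX 1 1)
  [:: ([:: kill 12], Node (VX 0 2) [:: ([:: kill 2], Node (VX 1 2) [:: ([:: kill 10], Node (VX 1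
  3) [:: ([:: kill 9], Leaf (VX 0 3))])])])])])])]); ([:: send 10 [:: 10;12]; send 12 [:: 10;15];
  send 15 [:: 16;12]; send 16 [:: 16;15]], Node (VY 0 3) [:: ([:: send 2 [:: 2;5]; send 5 [::
  2;6]; send 6 [:: 9;5]; send 9 [:: 9;6]], Node (VY 1 3) [:: ([:: send 3 [:: 3;2]; send 2 [::
  3;7]; send 7 [:: 9;2]; send 9 [:: 9;7]], Node (VX 0 0) [:: ([:: kill 11], Node (VX 0 1) [:: ([::
  kill 12], Node (VX 0 2) [:: ([:: kill 4], Node (VX 1 2) [:: ([:: kill 10], Node (VX 1 3) [::
  ([:: kill 9], Leaf (VX 0 3))])])]); ([:: kill 3], Node (VX 1 1) [:: ([:: kill 12], Node (VX 1 2)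
  [:: ([:: kill 8], Node (VX 0 2) [:: ([:: kill 10], Leaf (VX 1 3))])])])]); ([:: kill 3], Node
  (VX 1 0) [:: ([:: kill 11], Node (VX 1 1) [:: ([:: kill 12], Node (VX 1 2) [:: ([:: kill 8],
  Node (VX 0 2) [:: ([:: kill 10], Leaf (VX 1 3))])])])])])])])])])%N.
Definition tree9 : tree := (Node (VY 0 1) [:: ([:: send 2 [:: 2;3]; send 3 [:: 2;6]; send 6 [::
  7;3]; send 7 [:: 7;6]], Node (VY 0 2) [:: ([:: send 10 [:: 10;12]; send 12 [:: 10;14]; send 14
  [:: 16;12]; send 16 [:: 16;14]], Node (VY 0 3) [:: ([:: kill 3], Node (VY 1 2) [:: ([:: send 2
  [:: 2;4]; send 4 [:: 2;7]; send 7 [:: 8;4]; send 8 [:: 8;7]], Node (VY 1 3) [:: ([:: send 11 [::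
  11;13]; send 13 [:: 11;15]; send 15 [:: 17;13]; send 17 [:: 17;15]], Node (VX 0 1) [:: ([:: kill
  13], Node (VX 0 2) [:: ([:: kill 2], Node (VX 1 2) [:: ([:: kill 10], Node (VX 1 3) [:: ([::
  kill 9], Leaf (VX 0 3))])])]); ([:: kill 2], Node (VX 1 1) [:: ([:: kill 13], Node (VX 1 2) [::
  ([:: kill 10], Node (VX 1 3) [:: ([:: kill 9], Leaf (VX 0 3))])])])])]); ([:: send 11 [::
  11;10]; send 10 [:: 11;15]; send 15 [:: 16;10]; send 16 [:: 16;15]], Node (VY 1 3) [:: ([:: send
  2 [:: 2;5]; send 5 [:: 2;7]; send 7 [:: 9;5]; send 9 [:: 9;7]], Node (VX 0 1) [:: ([:: kill 10],
  Node (VX 0 2) [:: ([:: kill 4], Node (VX 1 2) [:: ([:: kill 11], Node (VX 1 3) [:: ([:: kill 9],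
  Leaf (VX 0 3))])])]); ([:: kill 2], Node (VX 1 1) [:: ([:: kill 10], Node (VX 1 2) [:: ([:: kill
  8], Node (VX 0 2) [:: ([:: kill 11], Leaf (VX 1 3))])])])])])])])]); ([:: send 10 [:: 10;11];
  send 11 [:: 10;14]; send 14 [:: 15;11]; send 15 [:: 15;14]], Node (VY 0 2) [:: ([:: send 2 [::
  2;4]; send 4 [:: 2;6]; send 6 [:: 8;4]; send 8 [:: 8;6]], Node (VY 0 3) [:: ([:: kill 4], Node
  (VY 1 2) [:: ([:: send 3 [:: 3;2]; send 2 [:: 3;7]; send 7 [:: 8;2]; send 8 [:: 8;7]], Node (VY
  1 3) [:: ([:: send 10 [:: 10;13]; send 13 [:: 10;15]; send 15 [:: 17;13]; send 17 [:: 17;15]],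
  Node (VX 0 1) [:: ([:: kill 13], Node (VX 0 2) [:: ([:: kill 3], Node (VX 1 2) [:: ([:: kill
  12], Node (VX 1 3) [:: ([:: kill 9], Leaf (VX 0 3))])])]); ([:: kill 3], Node (VX 1 1) [:: ([::
  kill 13], Node (VX 1 2) [:: ([:: kill 12], Node (VX 1 3) [:: ([:: kill 9], Leaf (VX 0
  3))])])])])]); ([:: send 10 [:: 10;12]; send 12 [:: 10;15]; send 15 [:: 16;12]; send 16 [::
  16;15]], Node (VY 1 3) [:: ([:: send 3 [:: 3;5]; send 5 [:: 3;7]; send 7 [:: 9;5]; send 9 [::
  9;7]], Node (VX 0 1) [:: ([:: kill 12], Node (VX 0 2) [:: ([:: kill 2], Node (VX 1 2) [:: ([::
  kill 10], Node (VX 1 3) [:: ([:: kill 9], Leaf (VX 0 3))])])]); ([:: kill 3], Node (VX 1 1) [::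
  ([:: kill 12], Node (VX 1 2) [:: ([:: kill 8], Node (VX 0 2) [:: ([:: kill 10], Leaf (VX 1
  3))])])])])])])])])])%N.

(* Turns a tree for the variety x_(1, b, j) = 0 into one for x_(t, b, j) = tau_t x_(0, b, j):
   cutting by x_(1, b, j) produces one more component, tau_1 = 0. *)
Fixpoint segre (t : tree) : tree :=
  match t with
  | Leaf (VX b j) => Node (VX (2 + b) j) [:: ([:: (1, None)], t)]
  | Node (VX b j) kids => Node (VX (2 + b) j)
      (([:: (1, None)], t) :: map (fun k => (k.1, segre k.2)) kids)
  | Node v kids => Node v (map (fun k => (k.1, segre k.2)) kids)
  | _ => t
  end%N.

Definition generic_state : state := [seq Some [:: i] | i <- iota 0 18].
(** The cuts that remain once four of the i cuts by y have been spent on y_00, ..., y_33. *)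
Definition tail_degs i := nseq (i - 4) (0, 1)%N ++ nseq (14 - i) (1, 0)%N.

Section Ruling.
Variable K : fieldType.
Local Notation R := {mpoly K[18]}.
Local Notation S := {mpoly K[4 * 4 + NY]}.

(* The rows are tau_0 psi_0, tau_0 psi_1, tau_1 psi_0, tau_1 psi_1; the parameters are psi_0 = p,
   psi_1 = q, l_0 = alpha, l_1 = - beta. *)
Definition rulX s (r j : 'I_4) : R := vent K s r./2 * vent K s (2 + 4 * odd r + j).
Definition rulY s (m : 'X_{1..4}) : R :=
  cf (fun j => vent K s (2 + j)) (fun j => vent K s (10 + j)) m +
  cf (fun j => vent K s (6 + j)) (fun j => - vent K s (14 + j)) m.
Definition ruling s : {rmorphism S -> R} := hom (@mpolyC 18 K) (rulX s) (rulY s).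

Lemma ruling_app sb s p : ruling (app sb s) p = sigma K sb (ruling s p).
Proof.
have -> : sigma K sb (ruling s p) = (sigma K sb \o ruling s) p by [].
apply/esym; apply: hom_eq => [c|r j|j] /=.
- by rewrite homC [LHS]mmapC.
- by rewrite hom_x /rulX !vent_app !rmorphM.
rewrite hom_y /rulY rmorphD !cf_morph.
by congr (_ + _); apply: eq_cf => i; rewrite !vent_app ?rmorphN.
Qed.

Lemma ruling_diag s (k : 'I_4) l : quad l = (U_(k) + U_(k))%MM ->
  ruling s 'X_(rshift (4 * 4) l) = fval K s (Br (2 + k) (6 + k) (14 + k) (10 + k)).
Proof. by move=> El; rewrite [LHS]hom_y El /rulY !cf_diag /= mulrN. Qed.

(* On y_kk = 0 the columns (psi_0k, psi_1k) and (l_1k, - l_0k) are parallel. *)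
Definition diag_subst k : subst :=
  [:: (2 + k, Some [:: 10 + k; 2 + k]); (6 + k, Some [:: 10 + k; 6 + k]);
      (10 + k, Some [:: 14 + k; 6 + k]); (14 + k, Some [:: 14 + k; 2 + k])]%N.
Fixpoint diag_state k := if k is k'.+1 then app (diag_subst k') (diag_state k') else generic_state.

Definition ruling_ideal s : polyset K _ _ := bker (ruling s).

Lemma vent_diag (j : 'I_4) : [/\ vent K (diag_state 4) (2 + j) = vent K generic_state (10 + j) * vent K generic_state (2 + j) :> R,
  vent K (diag_state 4) (6 + j) = vent K generic_state (10 + j) * vent K generic_state (6 + j) :> R,
  vent K (diag_state 4) (10 + j) = vent K generic_state (14 + j) * vent K generic_state (6 + j) :> R &
  vent K (diag_state 4) (14 + j) = vent K generic_state (14 + j) * vent K generic_state (2 + j) :> R].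
Proof.
rewrite /vent -!entM; case: j => [] [|[|[|[|//]]]] lj; split; congr ent; by vm_compute.
Qed.

Lemma ruling_diag4 : ruling_ideal (diag_state 4) = spec_ideal generic_state.
Proof.
suff E p : ruling (diag_state 4) p = theta K generic_state p.
  exact: (f_equal (fun g : S -> R => bker g) (functional_extensionality _ _ E)).
apply: hom_eq => [c|r j|j]; first exact: homC.
  rewrite [LHS]hom_x /thetaX /rulX /psi.
  have -> : vent K (diag_state 4) r./2 = vent K generic_state r./2 :> R.
    by rewrite /vent; congr ent; case: r => [] [|[|[|[|//]]]] lr; vm_compute.
  have [h2 h6 _ _] := vent_diag j.
  by case: (odd r); rewrite ?h2 ?h6.
rewrite [LHS]hom_y /rulY /thetaY /psi.
by congr (_ + _); apply: eq_cf => i; have [h2 h6 h10 h14] := vent_diag i; rewrite ?h2 ?h6 ?h10 ?h14.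
Qed.

Lemma ruling_subv s (k l : 'I_4) : ~~ zfac s (Ent 0) -> ~~ zfac s (Ent 2) ->
  ~~ zfac s (Br (2 + k) (6 + k) (14 + k) (10 + k)) -> subvariety (ruling_ideal s).
Proof.
move=> n0 n2 nk; have [i Ei] := quad_ex k k.
apply: (@bker_subv _ _ _ _ (ruling s) (mxvec_index ord0 ord0) i); last first.
  by rewrite (ruling_diag _ Ei) fvalP.
rewrite [X in X != 0](@hom_x _ _ _ _ _ ord0 ord0) mulf_eq0 negb_or.
by rewrite -[vent K s _]/(fval K s (Ent 0)) -[vent K s (_ + _)]/(fval K s (Ent 2)) !fvalP n0.
Qed.

(** From each section y_kk = 0 a single subvariety is kept, the one parametrized by [diag_subst], so
    the bound passes through unchanged. *)
Lemma diag_deg es n : std_degs es -> deg_ge es (spec_ideal generic_state : polyset K _ _) n ->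
  deg_ge (nseq 4 (0, 1)%N ++ es) (ruling_ideal generic_state) n.
Proof.
move=> ses; rewrite -ruling_diag4 -[generic_state]/(diag_state 0).
have step (k : 'I_4) es' : std_degs es' -> deg_ge es' (ruling_ideal (diag_state k.+1)) n ->
    subvariety (ruling_ideal (diag_state k)) -> subvariety (ruling_ideal (diag_state k.+1)) ->
    ~~ zfac (diag_state k) (Br (2 + k) (6 + k) (14 + k) (10 + k)) ->
    zfac (diag_state k.+1) (Br (2 + k) (6 + k) (14 + k) (10 + k)) ->
    deg_ge ((0, 1)%N :: es') (ruling_ideal (diag_state k)) n.
  move=> ses' d s1 s2 nz z; have [i Ei] := quad_ex k k.
  have by_ := @bihomog_y K (4 * 4) NY i.
  have <- : (\sum_(Q <- [:: (ruling_ideal (diag_state k.+1), n)]) Q.2 = n)%N by rewrite big_seq1.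
  apply: (deg_ge_cut ses' s1 by_) => [|Q [<-|[]]|]; last by repeat constructor.
    by rewrite /ruling_ideal (bkerE _ by_) (ruling_diag _ Ei) => /eqP; rewrite fvalP; exact/negP.
  split; [exact: s2| | |exact: d].
    by apply: bker_eq => e p _ E; rewrite ruling_app E rmorph0.
  by apply/(bkerE (ruling _) by_); rewrite (ruling_diag _ Ei); apply/eqP; rewrite fvalP.
have sv k : (k < 4)%N -> subvariety (ruling_ideal (diag_state k)).
  move=> lk; apply: (@ruling_subv _ (Ordinal (isT : 3 < 4)%N) ord0); move: lk;
    by case: k => [|[|[|[|//]]]] _; vm_compute.
have sv4 : subvariety (ruling_ideal (diag_state 4)).
  by rewrite ruling_diag4; apply: spec_ideal_subv; vm_compute.
move=> d; rewrite [_ ++ _]/=.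
apply: (step (Ordinal (isT : 0 < 4)%N)); [exact: ses| |exact: sv|exact: sv|by vm_compute|by vm_compute].
apply: (step (Ordinal (isT : 1 < 4)%N)); [exact: ses| |exact: sv|exact: sv|by vm_compute|by vm_compute].
apply: (step (Ordinal (isT : 2 < 4)%N)); [exact: ses| |exact: sv|exact: sv|by vm_compute|by vm_compute].
by apply: (step (Ordinal (isT : 3 < 4)%N)); [exact: ses|exact: d|exact: sv|exact: sv4|by vm_compute|by vm_compute].
Qed.

(** The numbers are the leaf counts of the certificates after [segre], and the checker is run by
    [vm_compute]. *)
Lemma ruling_deg i n : (i, n) \in [:: (6, 8); (7, 42); (8, 120); (9, 40)]%N ->
  deg_ge (nseq i (0, 1)%N ++ nseq (14 - i) (1, 0)%N) (ruling_ideal generic_state) n.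
Proof.
have H i' t : (4 <= i' <= 9)%N -> checks (tail_degs i') t generic_state ->
    deg_ge (nseq i' (0, 1)%N ++ nseq (14 - i') (1, 0)%N) (ruling_ideal generic_state) (leaves t).
  move=> li ct; have ses : std_degs (tail_degs i').
    by rewrite /tail_degs /std_degs all_cat !all_nseq !orbT.
  have [d _] := tree_deg K ses ct; move: (diag_deg ses d).
  by rewrite /tail_degs catA -nseqD subnKC //; case/andP: li.
rewrite !inE => /or4P [] /eqP [-> ->].
- have -> : (8 = leaves (segre tree6))%N by vm_compute.
  by apply: H => //; vm_compute.
- have -> : (42 = leaves (segre tree7))%N by vm_compute.
  by apply: H => //; vm_compute.
- have -> : (120 = leaves (segre tree8))%N by vm_compute.
  by apply: H => //; vm_compute.
have -> : (40 = leaves (segre tree9))%N by vm_compute.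
by apply: H => //; vm_compute.
Qed.

End Ruling.

(** * Linear substitutions *)

Lemma graded_hom (K : fieldType) (a b : nat) (A : algType K) (H : nat * nat -> A -> Prop)
    (g : {rmorphism {mpoly K[a + b]} -> A}) :
  (forall e, is_sub (H e)) -> H (0, 0)%N 1 ->
  (forall e d p q, H e p -> H d q -> H (addb e d) (p * q)) ->
  (forall c p, g (c *: p) = c *: g p) ->
  (forall i, H (1, 0)%N (g 'X_(lshift b i))) -> (forall j, H (0, 1)%N (g 'X_(rshift a j))) ->
  forall e p, bihomog e p -> H e (g p).
Proof.
move=> Hs H1 HM gZ gx gy e p bp; rewrite (mpolyE p) raddf_sum big_seq.
apply: sub_sum => // m /bp <-; rewrite /= gZ; apply: subZ => //; clear p bp e.
elim: {m}(mdeg m) {-2}m (erefl (mdeg m)) => [|n IH] m Em.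
  have -> : m = 0%MM by apply/eqP; rewrite -mdeg_eq0 Em.
  by rewrite mpolyX0 rmorph1 bideg0.
have [k mk] : exists k, (0 < m k)%N.
  apply: NNPP => HH; suff : mdeg m = 0%N by rewrite Em.
  rewrite mdegE big1 // => i _; case E: (m i) => [//|t]; case: HH; exists i; lia.
have le1 : (U_(k) <= m)%MM by apply/mnm_lepP => i; rewrite mnm1E; case: eqP => [<-|].
rewrite -(submK le1) addmC mpolyXD rmorphM bidegD; apply: HM.
  by case: (split_ordP k) => k' ->; rewrite ?bidegx ?bidegy.
by apply: IH; have := mdegD (m - U_(k))%MM U_(k)%MM; rewrite submK // Em mdeg1; lia.
Qed.

Section Rows.
Variables (K : fieldType).
Local Notation S := {mpoly K[4 * 4 + NY]}.
Implicit Types M N : 'M[K]_4.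

Definition rowsubst M : (4 * 4 + NY).-tuple S :=
  [tuple vals (fun r j => \sum_i M r i *: 'X_(vx i j)) (fun m => 0) k +
     (if split k is inr _ then 'X_k else 0) | k < 4 * 4 + NY].
Definition chi M (p : S) : S := p \mPo rowsubst M.
HB.instance Definition _ M := GRing.RMorphism.copy (chi M) (comp_mpoly (rowsubst M)).

Lemma chi_x M r j : chi M 'X_(vx r j) = \sum_i M r i *: 'X_(vx i j).
Proof.
by rewrite /chi comp_mpolyXU -tnth_nth tnth_mktuple vals_x (unsplitK (inl _)) addr0.
Qed.

Lemma chi_y M j : chi M 'X_(rshift (4 * 4) j) = 'X_(rshift (4 * 4) j).
Proof.
by rewrite /chi comp_mpolyXU -tnth_nth tnth_mktuple vals_y (unsplitK (inr _)) add0r.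
Qed.

Lemma chiC M c : chi M c%:MP = c%:MP.
Proof. exact: comp_mpolyC. Qed.

Lemma chi_lin M c p q : chi M (c *: p + q) = c *: chi M p + chi M q.
Proof. by rewrite -mul_mpolyC rmorphD rmorphM /= chiC mul_mpolyC. Qed.

Lemma chiM M N p : chi M (chi N p) = chi (N *m M) p.
Proof.
rewrite -[LHS]/((chi M \o chi N) p); apply: rmorph_mpoly_eq => [c|] /=; first by rewrite !chiC.
apply: var_ind => [r j|j] /=; last by rewrite !chi_y.
rewrite !chi_x rmorph_sum /= (eq_bigr (fun i => \sum_k (N r i * M i k) *: 'X_(vx k j))).
  rewrite exchange_big; apply: eq_bigr => k _ /=.
  by rewrite -scaler_suml mxE.
move=> i _; rewrite -mul_mpolyC rmorphM /= chiC chi_x mul_mpolyC scaler_sumr.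
by apply: eq_bigr => k _; rewrite scalerA.
Qed.

Lemma chi1 p : chi 1%:M p = p.
Proof.
rewrite -[RHS]/(idfun p); apply: rmorph_mpoly_eq => [c|] /=; first by rewrite !chiC.
apply: var_ind => [r j|j] /=; last by rewrite !chi_y.
rewrite chi_x (bigD1 r) //= mxE eqxx scale1r big1 ?addr0 // => i ir.
by rewrite mxE eq_sym (negbTE ir) scale0r.
Qed.

Lemma chi_bihomog M e p : bihomog e p -> bihomog e (chi M p).
Proof.
apply: graded_hom => [d||d d' q r|c q|i|j].
- exact: bihomog_sub.
- exact: bihomog1.
- exact: bihomogM.
- by rewrite -!mul_mpolyC rmorphM /= chiC.
- case/mxvec_indexP: i => r j; rewrite [X in bihomog _ X](chi_x M r j); apply: sub_sum => [|i _]; first exact: bihomog_sub.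
  by apply: (@subZ _ _ _ _ _ (bihomog_sub _)); exact: bihomog_x.
by rewrite [X in bihomog _ X]chi_y; exact: bihomog_y.
Qed.

Lemma bicomp_chi M e p : bicomp e (chi M p) = chi M (bicomp e p).
Proof.
rewrite {1}(bicomp_sumE p) rmorph_sum bicomp_sum.
have [ep|] := boolP (e \in bidegs p).
  rewrite (bigD1_seq e) ?undup_uniq //= big1 ?addr0 => [|d de].
    by apply: bicomp_id; apply: chi_bihomog; exact: bicomp_bihomog.
  by apply: bicomp_neq de; apply: chi_bihomog; exact: bicomp_bihomog.
rewrite /bidegs mem_undup => ep; rewrite big_seq big1 => [|d dp].
  have -> : bicomp e p = 0; last by rewrite rmorph0.
  apply/mpolyP => m; rewrite mcoeff_bicomp mcoeff0; case: eqP => // Em.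
  apply/eqP; rewrite mcoeff_eq0; apply: contra ep => mp; apply/mapP; by exists m.
apply: (@bicomp_neq _ _ _ d); first by apply: chi_bihomog; exact: bicomp_bihomog.
by apply: contra ep => /eqP <-; rewrite -mem_undup.
Qed.

Definition chi_bker M (R : nzRingType) (g : {rmorphism S -> R}) : polyset K (4 * 4) NY :=
  fun p => bker g (chi M p).

Lemma chi_bkerE M (R : nzRingType) (g : {rmorphism S -> R}) :
  chi_bker M g = bker (g \o chi M).
Proof.
apply: functional_extensionality => p; apply: propositional_extensionality.
by split=> H e; have := H e; rewrite bicomp_chi.
Qed.

(** An invertible row substitution is an automorphism preserving bidegrees. It serves twice: for the
    second ruling, and for passing from the normal form to any smooth quadric. *)
Lemma hil_chi M (R : nzRingType) (g : {rmorphism S -> R}) m n : M \in unitmx ->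
  hil (bker (g \o chi M)) m n = hil (bker g) m n.
Proof.
move=> uM; have iG := bker_ideal g; have iM := bker_ideal (g \o chi M).
apply/esym/hil_eq => //.
apply: (@dimq_map _ _ _ (chi M)) (hilP m n iM) => //.
- exact: chi_lin.
- exact: bihomog_sub.
- exact: ideal_sub.
- by move=> v; apply: chi_bihomog.
- move=> w bw; exists (chi (invmx M) w); first exact: chi_bihomog.
  by rewrite chiM mulVmx // chi1 subrr; case: iG.
- by move=> v _; rewrite -chi_bkerE.
Qed.

End Rows.

(** * The graph and the base locus *)

Local Notation i0 := (@Ordinal 4 0 isT).
Local Notation i1 := (@Ordinal 4 1 isT).
Local Notation i2 := (@Ordinal 4 2 isT).
Local Notation i3 := (@Ordinal 4 3 isT).

(* The coefficient of z^m in L_0 L_3 - L_1 L_2, with L_r = sum_j X_(r, j) z_j. *)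
Definition detf (R : comNzRingType) (X : 'I_4 -> 'I_4 -> R) m : R :=
  cf (X i0) (X i3) m - cf (X i1) (X i2) m.

Lemma detf_morph (R R' : comNzRingType) (g : {rmorphism R -> R'}) X m :
  g (detf X m) = detf (fun r j => g (X r j)) m.
Proof. by rewrite /detf rmorphB !cf_morph. Qed.

(* The rows form a point (e = 0) of the first ruling of the quadric detf = 0, moved
   in the direction (0, 0, - l1, l0). *)
Lemma detf_ruling (R : comNzRingType) (X : 'I_4 -> 'I_4 -> R) t0 t1 p0 p1 l0 l1 e m :
  (forall k, X i0 k = t0 * p0 k) -> (forall k, X i1 k = t0 * p1 k) ->
  (forall k, X i2 k = t1 * p0 k + e * - l1 k) -> (forall k, X i3 k = t1 * p1 k + e * l0 k) ->
  detf X m = e * t0 * (cf p0 l0 m + cf p1 l1 m).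
Proof.
move=> E0 E1 E2 E3; rewrite /detf (eq_cf _ E0 E3) (eq_cf _ E1 E2) !cf_lin.
have Zl c u v : cf (fun k => c * u k) v m = c * cf u v m by rewrite cfC cfZ cfC.
rewrite !Zl (cfC p1 p0); have -> : cf p1 (fun k => - l1 k) m = - cf p1 l1 m.
  by rewrite -[RHS]mulN1r -cfZ; apply: eq_cf => k; rewrite ?mulN1r.
by ring.
Qed.
Section HomX.
Variables (K : fieldType) (R : comNzRingType) (h : {rmorphism K -> R}).

Definition homX (X : 'I_4 -> 'I_4 -> R) : {rmorphism {mpoly K[4 * 4]} -> R} :=
  mmap h (fun k => mxvec (\matrix_(r, j) X r j) 0 k).

Lemma homX_x X r j : homX X 'X_(mxvec_index r j) = X r j.
Proof. by rewrite [LHS]mmapX mmap1U mxvecE mxE. Qed.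

Lemma homXC X c : homX X c%:MP = h c.
Proof. exact: mmapC. Qed.

Lemma hom_scale (X : 'I_4 -> 'I_4 -> R) Y s e p : bihomog e p ->
  hom h X (fun m => s * Y m) p = s ^+ e.2 * hom h X Y p.
Proof.
move=> bp; rewrite (mpolyE p) !rmorph_sum mulr_sumr big_seq [RHS]big_seq.
apply: eq_bigr => m /bp <- /=.
rewrite -mul_mpolyC !rmorphM /= !homC mulrCA; congr (_ * _).
rewrite /hom !mmapX /mmap1 !big_split_ord /= mulrCA; congr (_ * _).
  by apply: eq_bigr => i _; rewrite /vals !(unsplitK (inl _)).
rewrite -prodrXr -big_split; apply: eq_bigr => j _ /=.
by rewrite !vals_y exprMn.
Qed.

(** A point whose y-coordinates are the coefficients of L_0 L_3 - L_1 L_2 lies on the graph, so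
    evaluation there factors through the graph morphism. *)
Lemma hom_detf X Y : Y = detf X -> forall p,
  hom h X Y p = homX X (hom (@mpolyC (4 * 4) K) (fun r j => 'X_(mxvec_index r j))
    (detf (fun r j => 'X_(mxvec_index r j))) p).
Proof.
move=> -> p; rewrite -[RHS]/((homX X \o hom _ _ _) p); apply/esym; apply: hom_eq => [c|r j|j] /=.
- by rewrite homC homXC.
- by rewrite hom_x homX_x.
rewrite hom_y detf_morph /detf.
by congr (_ - _); apply: eq_cf => k; exact: homX_x.
Qed.

End HomX.

Section Model.
Variable K : fieldType.
Local Notation RX := {mpoly K[4 * 4]}.
Local Notation S := {mpoly K[4 * 4 + NY]}.

Definition genX (r j : 'I_4) : RX := 'X_(mxvec_index r j).
Definition graph_hom : {rmorphism S -> RX} := hom (@mpolyC (4 * 4) K) genX (detf genX).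
Definition model_graph : polyset K (4 * 4) NY := bker graph_hom.
Definition quadric (j : 'I_NY) : S := detf (fun r k => 'X_(vx r k) : S) (quad j).

Lemma graph_hom_x r j : graph_hom 'X_(vx r j) = genX r j.
Proof. exact: hom_x. Qed.

Lemma graph_hom_y j : graph_hom 'X_(rshift (4 * 4) j) = detf genX (quad j).
Proof. exact: hom_y. Qed.

Lemma graph_hom_quadric j : graph_hom (quadric j) = graph_hom 'X_(rshift (4 * 4) j).
Proof.
rewrite graph_hom_y /quadric detf_morph /detf.
by congr (_ - _); apply: eq_cf => k; exact: graph_hom_x.
Qed.

Lemma cf_bihomog r r' m : bihomog (2, 0)%N (cf (fun k => 'X_(vx r k) : S) (fun k => 'X_(vx r' k)) m).
Proof.
have sb := @bihomog_sub K (4 * 4) NY (2, 0)%N.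
apply: sub_sum => // i _; apply: sub_sum => // j _; case: ifP => _; last by case: sb.
by apply: (@bihomogM _ _ _ (1, 0)%N (1, 0)%N); exact: bihomog_x.
Qed.

Lemma quadric_bihomog j : bihomog (2, 0)%N (quadric j).
Proof. by apply: (subB (bihomog_sub _)); exact: cf_bihomog. Qed.

Local Notation R := {mpoly K[18]}.
Local Notation P1 := (ruling_ideal generic_state : polyset K _ _).
Let vt i : R := vent K generic_state i.

Lemma ruling_quadric j : ruling K generic_state (quadric j) = 0.
Proof.
rewrite /quadric detf_morph.
rewrite (@detf_ruling _ _ (vt 0) (vt 1) (fun k => vt (2 + k)) (fun k => vt (6 + k))
  (fun=> 0) (fun=> 0) 0); first by rewrite !mul0r.
- by move=> k; rewrite [LHS]hom_x.
- by move=> k; rewrite [LHS]hom_x.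
- by move=> k; rewrite mul0r addr0 [LHS]hom_x.
by move=> k; rewrite mul0r addr0 [LHS]hom_x.
Qed.

(** The component consists of limits of graph points: the rows [A] leave the base locus with a
    parameter 'X, and detf A = 'X tau_0 Y. A relation of the graph, homogeneous in y, vanishes at
    (A, 'X tau_0 Y), hence at (A, Y); then 'X is set to 0. *)
Lemma model_graph_ruling : subp model_graph P1.
Proof.
apply: bker_eq => e p bp E.
pose h := (@polyC R \o @mpolyC 18 K).
pose w i := (vt i)%:P; pose s := 'X * w 0%N.
(* The direction is (0, 0, - l_1, l_0) with l_1 = - beta, whence the double sign. *)
pose A (r j : 'I_4) := w r./2 * w (2 + 4 * odd r + j)%N +
  'X * (if r == i3 then w (10 + j)%N else if r == i2 then - - w (14 + j)%N else 0).
pose Y m := (rulY K generic_state m)%:P.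
have detA : (fun m => s * Y m) = detf A.
  apply: functional_extensionality => m; apply/esym.
  rewrite (@detf_ruling _ A (w 0%N) (w 1%N) (fun k => w (2 + k)%N) (fun k => w (6 + k)%N)
    (fun k => w (10 + k)%N) (fun k => - w (14 + k)%N) 'X).
  - rewrite /Y /rulY rmorphD !cf_morph; congr (_ * (_ + _)).
    by apply: eq_cf => // k; rewrite rmorphN.
  - by move=> k; rewrite /A /= mulr0 addr0.
  - by move=> k; rewrite /A /= mulr0 addr0.
  - by move=> k; rewrite /A /=.
  - by move=> k; rewrite /A /=.
have := hom_detf h detA p; rewrite -/genX -[hom (@mpolyC _ _) _ _ p]/(graph_hom p) E rmorph0.
have s0 : s != 0.
  rewrite mulf_neq0 ?polyX_eq0 // polyC_eq0.
  by rewrite -[vt _]/(fval K generic_state (Ent 0)) fvalP.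
rewrite (hom_scale _ _ _ _ bp) => /eqP; rewrite mulf_eq0 expf_eq0 (negbTE s0) andbF /= => /eqP E2.
rewrite -(horner0 0) -E2; apply/esym.
rewrite -[LHS]/((horner_eval (0 : R) \o hom h A Y) p); apply: hom_eq => [c|r j|j] /=.
- by rewrite homC /horner_eval hornerC.
- rewrite hom_x /A /horner_eval hornerD hornerM [('X * _).[0]]hornerM hornerX mul0r addr0.
  by congr (_ * _); exact: hornerC.
by rewrite hom_y /horner_eval hornerC.
Qed.

Lemma ruling_ideal_subv : subvariety P1.
Proof. by apply: (@ruling_subv _ _ i3 i0); vm_compute. Qed.

Lemma model_graph_prime : is_prime model_graph.
Proof. exact: bker_prime. Qed.

Lemma model_graph_subv : subvariety model_graph.
Proof.
have [iP _ _ [i Hi] [j Hj]] := ruling_ideal_subv; case: model_graph_prime => iV V1 pV; split=> //.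
  by exists i => /model_graph_ruling.
by exists j => /model_graph_ruling.
Qed.

Lemma quadric_model_graph : exists j, ~ model_graph (quadric j).
Proof.
have [_ _ _ _ [j Hj]] := model_graph_subv; exists j; apply: contra_not Hj.
rewrite /model_graph (bkerE _ (@quadric_bihomog j)) (bkerE _ (@bihomog_y K (4 * 4) NY j)).
by rewrite graph_hom_quadric.
Qed.

(** V + I, the ideal of the exceptional divisor as a subscheme of the graph. *)
Definition base_locus : polyset K (4 * 4) NY := fun p =>
  exists c : 'I_NY -> S, model_graph (p - \sum_j c j * quadric j).

Lemma model_graph_base_locus : subp model_graph base_locus.
Proof. by move=> p Vp; exists (fun=> 0); rewrite big1 ?subr0 // => j _; rewrite mul0r. Qed.

Lemma base_locus_ideal : bihomog_ideal base_locus.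
Proof.
have [V00 VD VM Vb] : bihomog_ideal model_graph := subv_ideal model_graph_subv.
split=> [|p q [c Hp] [d Hq]|p q [c Hq]|p e [c Hp]].
- exact: model_graph_base_locus.
- exists (fun j => c j + d j); rewrite (eq_bigr (fun j => c j * quadric j + d j * quadric j)).
    by rewrite big_split opprD addrACA; apply: VD.
  by move=> j _; rewrite mulrDl.
- exists (fun j => p * c j); rewrite (eq_bigr (fun j => p * (c j * quadric j))).
    by rewrite -mulr_sumr -mulrBr; apply: VM.
  by move=> j _; rewrite mulrA.
have [d Hd] : exists d : 'I_NY -> S, forall j, bicomp e (c j * quadric j) = d j * quadric j.
  apply: (@functional_choice 'I_NY S (fun j d => bicomp e (c j * quadric j) = d * quadric j)) => j.
  case: (bicompM_ex e (c j) (@quadric_bihomog j)) => [|[e']]; rewrite mulrC => ->.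
    by exists 0; rewrite mul0r.
  by exists (bicomp e' (c j)); rewrite mulrC.
exists d; rewrite -(eq_bigr _ (fun j _ => Hd j)) -bicomp_sum -bicompB; exact: Vb.
Qed.

Lemma base_locus_in j : base_locus (quadric j).
Proof.
exists (fun k => (k == j)%:R); rewrite (bigD1 j) //= eqxx mul1r big1 ?addr0 => [|k /negbTE ->].
  by rewrite subrr; case: (subv_ideal model_graph_subv).
by rewrite mul0r.
Qed.

Lemma base_locus_min P : bihomog_ideal P -> subp model_graph P -> (forall j, P (quadric j)) -> subp base_locus P.
Proof.
move=> iP VP FP p [c /VP Hc]; have sP := ideal_sub iP.
rewrite -[p](subrK (\sum_j c j * quadric j)); apply: subD => //.
by apply: sub_sum => // j _; case: iP => _ _ + _; apply.
Qed.

Lemma graph_hom_lin c p q : graph_hom (c *: p + q) = c *: graph_hom p + graph_hom q.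
Proof. by rewrite -mul_mpolyC rmorphD rmorphM [graph_hom c%:MP]homC mul_mpolyC. Qed.

Lemma graph_homZ c p : graph_hom (c *: p) = c *: graph_hom p.
Proof. by rewrite -mul_mpolyC rmorphM [graph_hom c%:MP]homC mul_mpolyC. Qed.

(* Both sides compute the dimensions of spaces of forms in the 16 variables x_k: model_graph has
   Hilbert function dim A_m F^n, with A_m the forms of degree m and F^n the span of
   the products of n quadrics. *)
Lemma hil_base_locus m n : hil model_graph (m + 2) n = (hil base_locus (m + 2) n + hil model_graph m n.+1)%N.
Proof.
have iV := subv_ideal model_graph_subv; have iJ := base_locus_ideal.
have sV := ideal_sub iV; have sJ := ideal_sub iJ.
pose e := ((m + 2)%N, n); pose N p := bihomog e p /\ base_locus p; pose L p := bihomog e p /\ model_graph p.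
have se : is_sub (@bihomog K (4 * 4) NY e) := bihomog_sub e.
have sL : is_sub L by apply: is_subI.
have sN : is_sub N by apply: is_subI.
apply: hil_eq => //.
have h1 : dimq (bihomog e) N (hil base_locus (m + 2) n).
  by apply: dimq_ext (hilP _ _ iJ) => // v hv; split=> [|[]].
suff h2 : dimq N L (hil model_graph m n.+1).
  have : dimq (bihomog e) L (hil base_locus (m + 2) n + hil model_graph m n.+1).
    by apply: dimq_add h1 h2 => // v []// hv /model_graph_base_locus.
  by apply: dimq_ext => // v hv; split=> [[]|].
(* A monomial of y-degree n + 1 contains some y_j; trading it for [quadric j], of bidegree (2, 0),
   keeps its image among the forms in x. *)
have up u : bihomog (m, n.+1) u -> exists2 p, N p & graph_hom p = graph_hom u.
  move=> bu; rewrite (mpolyE u) big_seq.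
  pose Q u := exists2 p, N p & graph_hom p = graph_hom u.
  apply: (@sub_sum _ _ Q) => [|d /bu bd].
    split=> [|c u1 u2 [p1 N1 E1] [p2 N2 E2]]; first by exists 0; [case: sN|].
    by exists (c *: p1 + p2); [case: sN => _; apply|rewrite !graph_hom_lin E1 E2].
  have [j dj] := bideg_gt0 (e := (m, n)) bd.
  have le1 : (U_(rshift (4 * 4) j) <= d)%MM.
    by apply/mnm_lepP => i; rewrite mnm1E; case: eqP => [<-|].
  pose d' := (d - U_(rshift (4 * 4) j))%MM.
  have Ed : d = (U_(rshift (4 * 4) j) + d')%MM by rewrite addmC submK.
  have bd' : bideg d' = (m, n).
    have := bidegD U_(rshift (4 * 4) j)%MM d'; rewrite -Ed bd bidegy => E.
    by apply: (@addb_inj (0, 1)%N); rewrite -E.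
  exists (u@_d *: (quadric j * 'X_[d'])).
    case: sN => N0 NZ; rewrite -[_ *: _]addr0; apply: NZ => //; split.
      by rewrite /e addnC; apply: (@bihomogM _ _ _ (2, 0)%N (m, n)); [exact: quadric_bihomog|exact: bihomogX].
    by rewrite mulrC; case: iJ => _ _ + _; apply; exact: base_locus_in.
  rewrite !graph_homZ; congr (_ *: _).
  by rewrite [in RHS]Ed mpolyXD !rmorphM graph_hom_quadric.
(* Conversely, modulo the graph such an element is a combination of the quadrics, each of which is
   traded for its y_j. *)
have down p : N p -> exists2 u, bihomog (m, n.+1) u & graph_hom u = graph_hom p.
  case=> bp [c Vp]; pose c' j := bicomp (m, n) (c j).
  exists (\sum_j c' j * 'X_(rshift (4 * 4) j)).
    apply: sub_sum => [|j _]; first exact: bihomog_sub.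
    rewrite mulrC; apply: (@bihomogM _ _ _ (0, 1)%N (m, n)); first exact: bihomog_y.
    exact: bicomp_bihomog.
  have -> : graph_hom (\sum_j c' j * 'X_(rshift (4 * 4) j)) = graph_hom (\sum_j c' j * quadric j).
    by rewrite !rmorph_sum; apply: eq_bigr => j _; rewrite !rmorphM graph_hom_quadric.
  apply/esym/eqP; rewrite -subr_eq0 -rmorphB; apply/eqP.
  have := Vp e; rewrite bicompB bicomp_sum (bicomp_id bp) => <-; congr (graph_hom (_ - _)).
  apply: eq_bigr => j _; rewrite mulrC [c j * _]mulrC.
  have -> : e = addb (2, 0)%N (m, n) by rewrite /e /addb /= addnC.
  exact/esym/bicompM/quadric_bihomog.
have [q [qJ qi qs]] : exists q : 'I_(hil model_graph m n.+1) -> S, [/\ forall i, bihomog (m, n.+1) (q i),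
    indep_mod model_graph q & span_mod (bihomog (m, n.+1)) model_graph q] by exact: hilP.
have /(@functional_choice 'I_(hil model_graph m n.+1) S) [q' Hq'] : forall i, exists p, N p /\ graph_hom p = graph_hom (q i).
  by move=> i; have [p ? ?] := up _ (qJ i); exists p.
have Elin c : graph_hom (\sum_i c i *: q' i) = graph_hom (\sum_i c i *: q i).
  rewrite !rmorph_sum; apply: eq_bigr => i _.
  by rewrite -!mul_mpolyC !rmorphM (Hq' i).2.
have bq c : bihomog (m, n.+1) (\sum_i c i *: q i) by apply: (@sub_lin _ _ _ _ _ _ (bihomog_sub _)).
have bq' c : N (\sum_i c i *: q' i) by apply: sub_lin => // i; case: (Hq' i).
exists q'; split=> [i|c [_ Hc]|p Np]; first by case: (Hq' i).
  by apply: qi; apply/(bkerE graph_hom (bq c)); rewrite -Elin; apply/(bkerE graph_hom (bq' c).1).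
have [u bu Eu] := down p Np; have [c Hc] := qs u bu; exists c; split.
  by apply: (subB se); [case: Np|case: (bq' c)].
have b1 : bihomog e (p - \sum_i c i *: q' i) by apply: (subB se); [case: Np|case: (bq' c)].
have b2 : bihomog (m, n.+1) (u - \sum_i c i *: q i) by apply: (subB (bihomog_sub _)).
apply/(bkerE graph_hom b1); rewrite rmorphB Elin -Eu -rmorphB.
exact/(bkerE graph_hom b2).
Qed.

End Model.

(** * The multidegrees *)

Section Numbers.
Variable K : fieldType.
Local Notation RX := {mpoly K[4 * 4]}.
Local Notation S := {mpoly K[4 * 4 + NY]}.
Local Notation model_graph := (@model_graph K).
Local Notation J := (@base_locus K).

Lemma homog_span n d : exists q : 'I_('C(d + n, d)) -> {mpoly K[n.+1]},
  forall p, p \is d.-homog -> exists c, p = \sum_i c i *: q i.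
Proof.
pose b := [seq s2m t | t : d.-tuple 'I_n.+1 <- enum (basis n.+1 d)].
have sb : size b = 'C(d + n, d) by exact: size_basis.
exists (fun i => 'X_[nth 0%MM b i]) => p /dhomogP hp.
exists (fun i : 'I_('C(d + n, d)) => p@_(nth 0%MM b i)).
have E : forall m, m \in msupp p -> m \in b.
  by move=> m /hp /eqP; rewrite basis_cover.
transitivity (\sum_(i < size b) p@_(nth 0%MM b i) *: 'X_[nth 0%MM b i]); last by rewrite sb.
rewrite -(big_mkord xpredT (fun i => p@_(nth 0%MM b i) *: 'X_[nth 0%MM b i])).
rewrite -(big_nth 0%MM xpredT (fun m => p@_m *: 'X_[m])) {1}(mpolyE p).
rewrite [RHS](bigID (mem (msupp p))) /= [X in _ + X]big1 ?addr0 => [|m mp]; last first.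
  by rewrite memN_msupp_eq0 // scale0r.
rewrite -[RHS]big_filter; apply: perm_big; apply: uniq_perm => //.
  by apply: filter_uniq; exact: uniq_basis.
by move=> m; rewrite mem_filter; case: (boolP (m \in msupp p)) => //= /E ->.
Qed.

(** The graph morphism embeds S/V in bidegree (m, n) into the forms of degree m + 2n in 16
    variables. *)
Lemma hil_model_graph_le m n : (hil model_graph m n <= 'C(m + n.*2 + 15, 15))%N.
Proof.
have iV := subv_ideal (model_graph_subv K).
pose H (e : nat * nat) (q : RX) : Prop := q \is (e.1 + e.2.*2).-homog.
have gH e p : bihomog e p -> H e (graph_hom K p).
  have Hs e' : is_sub (H e').
    split=> [|c u v hu hv]; first exact: rpred0.
    by apply: rpredD => //; exact: rpredZ.
  have Hx r j : H (1, 0)%N (genX K r j) by rewrite /H dhomogX; apply/eqP; exact: mdeg1.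
  apply: graded_hom => [//||d d' q r hq hr|c q|i|j].
  - exact: dhomog1.
  - rewrite /H /addb /= (_ : _ + _ = (d.1 + d.2.*2) + (d'.1 + d'.2.*2))%N; last by rewrite doubleD; lia.
    exact: dhomogM.
  - exact: graph_homZ.
  - by case/mxvec_indexP: i => r j; rewrite [X in H _ X]graph_hom_x.
  rewrite [X in H _ X]graph_hom_y.
  have Hcf r r' q : H (0, 1)%N (cf (genX K r) (genX K r') q).
    apply: sub_sum => // i _; apply: sub_sum => // k _; case: ifP => _; last by case: (Hs (0, 1)%N).
    exact: (dhomogM (Hx _ _) (Hx _ _)).
  exact: (subB (Hs _) (Hcf _ _ _) (Hcf _ _ _)).
have [q Hq] := homog_span 15 (m + n.*2).
have sz : is_sub (fun w : RX => w = 0) by split=> // c u w -> ->; rewrite scaler0 addr0.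
have sp : span_mod (H (m, n)) (fun w : RX => w = 0) q.
  by move=> v /Hq [c ->]; exists c; rewrite subrr.
have [r dr] := dimq_ex sz sp.
have -> : 'C(m + n.*2 + 15, 15) = 'C(m + n.*2 + 15, m + n.*2).
  by rewrite -[in RHS]bin_sub ?leq_addr // addKn.
apply: leq_trans (dimq_le sz sp dr).
apply: (dimq_inj_le (@graph_hom_lin K) (bihomog_sub _) sz _ _ (hilP m n iV) dr).
  by move=> v; exact: gH.
by move=> v bv E; apply/(bkerE (graph_hom K) bv).
Qed.

(** Stated for any V with this Hilbert function, since it is also applied to the graph of a quadric
    that is not in normal form. *)
Lemma dimlt_model_graph (V : polyset K (4 * 4) NY) : subvariety V -> hilz V = hilz model_graph -> dimlt 16 V.
Proof.
move=> sV E; apply: (dimlt_bound sV (EP_bin 15 15)) => m n.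
by rewrite E lez_nat hil_model_graph_le.
Qed.

(** For a fixed large n the Hilbert function is bounded by a binomial in m whose 15th difference is
    1; if its own were at least 2, the gap would become negative. *)
Lemma dlim_model_graph_row c : dlim (nseq 15 (1, 0)%N) (hilz model_graph) c -> c <= 1.
Proof.
case=> N HN; rewrite leNgt; apply/negP => c1.
have [n Hn] : exists n, (fun n => ('C(n + (N.*2 + 15), 15))%:Z - hilz model_graph n N) n < 0.
  apply: (@du_neg 15 _ N) => n Nn.
  rewrite iterdu_sub du_bin -(row_du 15 (hilz model_graph) N n) HN // /cstf.
  by lia.
by have := hil_model_graph_le n N; rewrite -lez_nat; move: Hn; rewrite /hilz addnA; lia.
Qed.

Definition degs N i := nseq i (0, 1)%N ++ nseq (N - i) (1, 0)%N.

Lemma std_degs_degs N i : std_degs (degs N i).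
Proof. by rewrite /std_degs all_cat !all_nseq !orbT. Qed.

Lemma size_degs N i : (i <= N)%N -> size (degs N i) = N.
Proof. by move=> iN; rewrite size_cat !size_nseq subnKC. Qed.

(** h(m + 2, n) - h(m, n + 1) equals h(m + 2, n) - h(m, n) minus h(m, n + 1) - h(m, n): two unit
    steps in m against one in n. *)
Lemma dlim_base_locus i c d : (i <= 14)%N ->
  dlim (degs 15 i) (hilz model_graph) c -> dlim (degs 15 i.+1) (hilz model_graph) d ->
  dlim (degs 14 i) (hilz J) (2 * c - d).
Proof.
move=> i14; set g := hilz model_graph.
have -> : degs 15 i = degs 14 i ++ [:: (1, 0)%N].
  rewrite /degs -catA; congr (_ ++ _); rewrite -[[:: (1, 0)%N]]/(nseq 1 _) -nseqD; congr nseq; lia.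
have -> : degs 15 i.+1 = (0, 1)%N :: degs 14 i by [].
rewrite /dlim deltas_cat /= deltas_delta; set D := deltas _ g => [[M HM]] [N HN].
apply: (@eqv_unshift (2, 0)%N).
have -> : shift (2, 0)%N (deltas (degs 14 i) (hilz J)) = subf (shift (2, 0)%N D) (shift (0, 1)%N D).
  rewrite -!deltas_shift -deltas_sub; congr deltas.
  apply: functional_extensionality => m; apply: functional_extensionality => n.
  have := hil_base_locus K m n; rewrite (addnC m 2) /shift /subf /g /hilz /= !add0n add1n => ->.
  by rewrite PoszD addrK.
exists (maxn M N) => m n; rewrite !geq_max => /andP [Mm Nm] /andP [Mn Nn].
have := HM m n Mm Mn; have := HM m.+1 n (leqW Mm) Mn; have := HN m n Nm Nn.
rewrite /delta /shift /subf /cstf /= !add0n !add1n add2n.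
by lia.
Qed.

Local Notation P1 := (ruling_ideal generic_state : polyset K _ _).
Definition swap : {rmorphism RX -> RX} :=
  homX (@mpolyC (4 * 4) K) (fun r j => genX K (tperm i1 i2 r) j).
(** Exchanging L_1 and L_2 fixes L_0 L_3 - L_1 L_2 and interchanges the two rulings, so the second
    component has the Hilbert function of the first. *)
Definition other_ruling : polyset K (4 * 4) NY := bker (ruling K generic_state \o chi (tperm_mx i1 i2)).

Lemma chi_swap r j : chi (tperm_mx i1 i2) ('X_(vx r j) : S) = 'X_(vx (tperm i1 i2 r) j).
Proof.
rewrite chi_x (bigD1 (tperm i1 i2 r)) //= !mxE eqxx scale1r big1 ?addr0 // => k /negbTE kr.
by rewrite !mxE eq_sym kr scale0r.
Qed.

Lemma detf_swap (R : comNzRingType) (X : 'I_4 -> 'I_4 -> R) m :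
  detf (fun r j => X (tperm i1 i2 r) j) m = detf X m.
Proof. by rewrite /detf tpermL tpermR !tpermD // [X in _ - X]cfC. Qed.

Lemma model_graph_swap p : model_graph p -> model_graph (chi (tperm_mx i1 i2) p).
Proof.
have H q : graph_hom K (chi (tperm_mx i1 i2) q) = swap (graph_hom K q).
  rewrite -[LHS]/((graph_hom K \o chi _) q) -[RHS]/((swap \o graph_hom K) q).
  apply: rmorph_mpoly_eq => [c|] /=.
    by rewrite chiC [graph_hom _ c%:MP]homC homXC.
  apply: var_ind => [r j|j]; first by rewrite chi_swap !graph_hom_x homX_x.
  rewrite chi_y !graph_hom_y detf_morph -[LHS]detf_swap /detf.
  by congr (_ - _); apply: eq_cf => k; rewrite homX_x.
by move=> Vp e; rewrite bicomp_chi H Vp rmorph0.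
Qed.

Lemma model_graph_other_ruling : subp model_graph other_ruling.
Proof. by move=> p /model_graph_swap /model_graph_ruling Hp e; have := Hp e; rewrite bicomp_chi. Qed.

Lemma ruling_ideal_quadric j : P1 (quadric K j).
Proof. by apply/(bkerE (ruling K generic_state) (@quadric_bihomog K j)); exact: ruling_quadric. Qed.

Lemma chi_swap_quadric j : chi (tperm_mx i1 i2) (quadric K j) = quadric K j.
Proof.
rewrite /quadric detf_morph -[RHS]detf_swap /detf.
by congr (_ - _); apply: eq_cf => k; rewrite [LHS]chi_swap.
Qed.

Lemma other_ruling_quadric j : other_ruling (quadric K j).
Proof.
apply/(bkerE (ruling K generic_state \o chi (tperm_mx i1 i2)) (@quadric_bihomog K j)).
by rewrite /= chi_swap_quadric ruling_quadric.
Qed.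

Lemma hilz_other_ruling : hilz other_ruling = hilz P1.
Proof.
do 2!(apply: functional_extensionality => ?).
rewrite /hilz /other_ruling hil_chi //.
by rewrite unitmxE det_perm unitrX ?unitrN1.
Qed.

Lemma other_ruling_subv : subvariety other_ruling.
Proof.
have [_ _ _ [i Hi] [j Hj]] := ruling_ideal_subv K.
have [iP P1' pP] : is_prime other_ruling by exact: bker_prime.
split=> //.
  case/mxvec_indexP: i Hi => r k Hi; exists (mxvec_index (tperm i1 i2 r) k).
  have bx q := @bihomog_x K (4 * 4) NY (mxvec_index q k).
  move/(bkerE (ruling K generic_state \o chi _) (bx _)); rewrite /= chi_swap tpermK => H; apply: Hi.
  exact/(bkerE (ruling K generic_state) (bx _)).
have bj := @bihomog_y K (4 * 4) NY j.
exists j; move/(bkerE (ruling K generic_state \o chi _) bj); rewrite /= chi_y => H; apply: Hj.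
exact/(bkerE (ruling K generic_state) bj).
Qed.

(** Rows 0 and 2 are proportional on the first ruling, rows 0 and 1 on the second; the minor of rows
    0 and 1 therefore separates them. *)
Lemma other_ruling_not_sub : ~ subp other_ruling P1.
Proof.
move/(_ (minor K i0 i1)) => H.
have /(bkerE (ruling K generic_state) (@minor_bihomog K i0 i1)) : P1 (minor K i0 i1).
  apply: H; apply/(bkerE (ruling K generic_state \o chi _) (@minor_bihomog K i0 i1)).
  rewrite /= /minor rmorphB !rmorphM /= !chi_swap rmorphB !rmorphM /=.
  rewrite (tpermD (z := i0)) // tpermL ![ruling _ _ 'X__]hom_x /rulX /=; ring.
apply/eqP; rewrite /minor rmorphB !rmorphM ![ruling _ _ _]hom_x /rulX /=.
rewrite (_ : _ - _ = vent K generic_state 0 * vent K generic_state 0 * fval K generic_state (Br 2 6 3 7)); last by rewrite /=; ring.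
by rewrite !mulf_neq0 ?fvalP //;
  rewrite -[vent _ _ _]/(fval K generic_state (Ent 0)) fvalP.
Qed.

Lemma base_locus_bound i c n : (i <= 14)%N -> dlim (degs 14 i) (hilz J) c ->
  0 <= c /\ (deg_ge (degs 14 i) P1 n -> (n + n)%:Z <= c).
Proof.
move=> i14 lc.
have iJ := base_locus_ideal K; have VJ := @model_graph_base_locus K.
have d16 := dimlt_model_graph (model_graph_subv K) (erefl _).
have dJ P : subvariety P -> subp J P -> dimlt 15 P.
  move=> sP JP; have [j Hj] := quadric_model_graph K.
  apply: (dimlt_sub d16 sP); split=> [p /VJ /JP //|/(_ _ (JP _ (base_locus_in _ j))) //].
have EJ : EP (size (degs 14 i)).+1 (hilz J) := ltac:(rewrite (size_degs i14); exact: (EP_ideal iJ dJ)).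
have std := std_degs_degs 14 i.
split.
  (* With an empty list of components the bound reads 0 <= c. *)
  have := @dlim_components K _ _ _ J [::] (fun=> 0) c std iJ EJ _ _ lc.
  by rewrite big_nil; apply=> //; constructor.
move=> dg; have s1 := ruling_ideal_subv K; have JP1 : subp J P1.
  by apply: base_locus_min; [exact: subv_ideal|exact: model_graph_ruling|exact: ruling_ideal_quadric].
have JP2 : subp J other_ruling.
  by apply: base_locus_min; [apply: subv_ideal; exact: other_ruling_subv|exact: model_graph_other_ruling|exact: other_ruling_quadric].
have d1 : dimlt (size (degs 14 i)).+1 P1 := ltac:(rewrite (size_degs i14); exact: dJ).
have [d l1 _] := dlim_pos std s1 d1.
have nd := dg d1 d l1.
have := @dlim_components K _ _ _ J [:: P1; other_ruling] (fun=> d) c std iJ EJ _ _ lc.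
rewrite !big_cons big_nil addr0 PoszD => H; apply: le_trans (lerD nd nd) (H _ _).
  move=> P [<-|[<-|[]]].
    split; [exact: s1|exact: JP1|exact: l1].
  split; [exact: other_ruling_subv|exact: JP2|rewrite hilz_other_ruling; exact: l1].
constructor; first by constructor; [exact: other_ruling_not_sub|constructor].
by constructor; constructor.
Qed.

(** Beyond degree 9 the coefficients are the default value 0 of [nth]. *)
Definition predegree i : nat :=
  nth 0%N [:: 1; 2; 4; 8; 16; 32; 64; 112; 140; 40] i.

Lemma dlim_model_graph i : (i <= 15)%N -> dlim (degs 15 i) (hilz model_graph) (predegree i)%:Z.
Proof.
move=> i15; pose a i := epsilon (inhabits (0 : int)) (dlim (degs 15 i) (hilz model_graph)).
have ha k : (k <= 15)%N -> dlim (degs 15 k) (hilz model_graph) (a k) /\ 0 <= a k.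
  move=> k15; have sV := model_graph_subv K.
  have d16 : dimlt (size (degs 15 k)).+1 model_graph := ltac:(rewrite (size_degs k15); exact: (dimlt_model_graph sV (erefl _))).
  have [c lc c0] := dlim_pos (std_degs_degs 15 k) sV d16.
  have la : dlim (degs 15 k) (hilz model_graph) (a k) by apply: epsilon_spec; exists c.
  by split=> //; rewrite (dlim_uniq la lc).
have hc k n : (k <= 14)%N -> 0 <= 2 * a k - a k.+1 /\
    ((k, n) \in [:: (6, 8); (7, 42); (8, 120); (9, 40)]%N -> (n + n)%:Z <= 2 * a k - a k.+1).
  move=> k14; have [la _] := ha k (leqW k14); have [lb _] := ha k.+1 k14.
  have [c0 H] := base_locus_bound n k14 (dlim_base_locus k14 la lb).
  by split=> // kn; apply: H; exact: ruling_deg.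
have a0 : a 0%N <= 1 by apply: dlim_model_graph_row; have [] := ha 0%N isT.
have c k : (k <= 14)%N -> 0 <= 2 * a k - a k.+1 by move=> k14; case: (hc k 0%N k14).
have c6 := (hc 6%N 8%N isT).2 isT; have c7 := (hc 7%N 42%N isT).2 isT.
have c8 := (hc 8%N 120%N isT).2 isT; have c9 := (hc 9%N 40%N isT).2 isT.
have := c 0%N isT; have := c 1%N isT; have := c 2%N isT; have := c 3%N isT; have := c 4%N isT.
have := c 5%N isT; have := c 10%N isT; have := c 11%N isT; have := c 12%N isT; have := c 13%N isT.
have := c 14%N isT.
have p k : (k <= 15)%N -> 0 <= a k by move=> k15; case: (ha k k15).
have := p 10%N isT; have := p 11%N isT; have := p 12%N isT; have := p 13%N isT; have := p 14%N isT.
have := p 15%N isT.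
clear p c hc => *.
have [la _] := ha i i15; suff E : a i = (predegree i)%:Z by rewrite -E.
(* Linear arithmetic: once a_10 = 0 is forced, a_(i + 1) <= 2 a_i and a_i >= 0 make all later terms
   vanish. *)
clear la ha; move: i15; do 15!(case: i => [_|i]; first by rewrite /predegree /=; lia).
by case: i => [_|//]; rewrite /predegree /=; lia.
Qed.

End Numbers.

(** * Normal form of a quadric *)

Lemma ex_sqrt (K : closedFieldType) (c : K) : exists s, s ^+ 2 = c.
Proof.
have /closed_rootP [s] : size ('X^2 - c%:P) != 1%N by rewrite size_XnsubC.
by rewrite /root !hornerE subr_eq0 => /eqP; exists s.
Qed.

(** Polarization: if e_i and e_j are isotropic, the value at e_i + e_j is 2 A_ij. *)
Lemma ex_anisotropic (K : fieldType) (n : nat) (A : 'M[K]_n) : (2%:R : K) != 0 ->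
  A^T = A -> A != 0 -> exists v : 'cV[K]_n, (v^T *m A *m v) 0 0 != 0.
Proof.
move=> two sA /matrix0Pn [i [j Aij]].
have E k l : ((delta_mx k 0 : 'cV[K]_n)^T *m A *m delta_mx l 0) 0 0 = A k l.
  rewrite trmx_delta -rowE mxE (bigD1 l) //= !mxE !eqxx mulr1 big1 ?addr0 // => t /negbTE tl.
  by rewrite !mxE tl mulr0.
have [Ai|Ai] := eqVneq (A i i) 0; last by exists (delta_mx i 0); rewrite E.
have [Aj|Aj] := eqVneq (A j j) 0; last by exists (delta_mx j 0); rewrite E.
exists (delta_mx i 0 + delta_mx j 0).
rewrite (_ : (_ + _)^T = (delta_mx i 0)^T + (delta_mx j 0)^T); last by apply/matrixP => k l; rewrite !mxE.
rewrite mulmxDr !mulmxDl.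
have add0 (B C : 'M[K]_1) : (B + C) 0 0 = B 0 0 + C 0 0 by rewrite mxE.
rewrite !add0 !E Ai Aj add0r addr0.
have -> : A j i = A i j by rewrite -[in RHS]sA mxE.
by rewrite -mulr2n -mulr_natl mulf_neq0.
Qed.

(** Lagrange reduction: for c = v^T A v nonzero and w = A v / sqrt c, the matrix A - w w^T kills v,
    so its rank is smaller than that of A. *)
Lemma sym_squares (K : closedFieldType) (n r : nat) (A : 'M[K]_n) : (2%:R : K) != 0 ->
  A^T = A -> (\rank A <= r)%N -> exists S : 'M[K]_(r, n), A = S^T *m S.
Proof.
move=> two; elim: r A => [|r IH] A sA rA.
  by exists 0; apply/eqP; rewrite mulmx0 -mxrank_eq0 -leqn0.
have [->|A0] := eqVneq A 0; first by exists 0; rewrite mulmx0.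
have [v hv] := ex_anisotropic two sA A0; set c := (v^T *m A *m v) 0 0 in hv.
have [s hs] := ex_sqrt c; have s0 : s != 0 by apply: contraNneq hv => s0; rewrite -hs s0 expr0n.
have Ec : v^T *m A *m v = c%:M by rewrite [LHS]mx11_scalar.
pose w := s^-1 *: (A *m v).
have Ew : w *m w^T = c^-1 *: (A *m v *m v^T *m A).
  rewrite /w linearZ /= trmx_mul sA -scalemxAl -scalemxAr scalerA -!mulmxA; congr (_ *: _).
  by rewrite -hs expr2 invfM.
have Av : (A - w *m w^T) *m v = 0.
  rewrite Ew mulmxBl -scalemxAl -!mulmxA [v^T *m _]mulmxA Ec.
  by rewrite mul_mx_scalar -scalemxAr scalerA mulVf // scale1r subrr.
have [] := IH (A - w *m w^T).
- by rewrite linearB /= trmx_mul trmxK sA.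
- rewrite -ltnS; apply: leq_trans rA; apply: rank_ltmx; apply/andP; split.
    have -> : A - w *m w^T = (1%:M - c^-1 *: (A *m v *m v^T)) *m A.
      by rewrite Ew mulmxBl mul1mx scalemxAl.
    exact: submxMl.
  apply/negP => /submxP [Y EY]; move: hv; rewrite -/c -[c]mulr1n.
  have -> : c = (c%:M : 'M_1) 0 0 by rewrite mxE.
  by rewrite -Ec -mulmxA {1}EY -[Y *m _ *m _]mulmxA Av !mulmx0 mxE mul0rn eqxx.
move=> S ES; change (exists S : 'M[K]_(1 + r, n), A = S^T *m S); exists (col_mx w^T S).
by rewrite tr_col_mx mul_row_col trmxK -ES addrC subrK.
Qed.

Lemma mdeg2P n (m : 'X_{1..n}) : mdeg m = 2%N -> exists k l, m = (U_(k) + U_(l))%MM.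
Proof.
move=> dm; have [k mk] : exists k, (0 < m k)%N.
  apply: NNPP => H; suff : mdeg m = 0%N by rewrite dm.
  rewrite mdegE big1 // => i _; case E: (m i) => [//|t]; case: H; exists i; lia.
have le1 : (U_(k) <= m)%MM by apply/mnm_lepP => i; rewrite mnm1E; case: eqP => [<-|].
have d1 : mdeg (m - U_(k))%MM = 1%N.
  by have := mdegD (m - U_(k))%MM U_(k)%MM; rewrite submK // dm mdeg1; lia.
have /mdeg1P [l /eqP El] : mdeg (m - U_(k))%MM == 1%N by rewrite d1.
by exists k, l; rewrite -El addmC submK.
Qed.

Definition lin (K : fieldType) (u : 'I_4 -> K) : {mpoly K[4]} := \sum_j u j *: 'X_j.

Lemma mcoeff_lin (K : fieldType) (u v : 'I_4 -> K) m : (lin u * lin v)@_m = cf u v m.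
Proof.
rewrite /lin mulr_suml raddf_sum; apply: eq_bigr => i _ /=.
rewrite mulr_sumr raddf_sum; apply: eq_bigr => j _ /=.
rewrite -scalerAl -scalerAr scalerA -mpolyXD mcoeffZ mcoeffX.
by case: eqP; rewrite ?mulr1 ?mulr0.
Qed.

(** The symmetric matrix of f yields four squares; with s^2 = -1 each pair a^2 + b^2 factors as (a +
    s b)(a - s b). Row 1 of [M] absorbs the sign before the second product. *)
Lemma quadric_form (K : closedFieldType) (f : {mpoly K[4]}) : (2%:R : K) != 0 ->
  f \is 2.-homog -> exists M : 'M[K]_4,
  f = lin (M i0) * lin (M i3) - lin (M i1) * lin (M i2).
Proof.
move=> two /dhomogP hf.
(* Off the diagonal the coefficient of z_i z_j collects two entries of A, hence the factor 1/2. *)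
pose A : 'M[K]_4 := \matrix_(i, j) ((if i == j then 1 else 2^-1) * f@_(U_(i) + U_(j))%MM).
have [S ES] : exists S : 'M[K]_4, A = S^T *m S.
  apply: sym_squares => //; last exact: rank_leq_row.
  by apply/matrixP => i j; rewrite !mxE eq_sym addmC.
have [s hs] := ex_sqrt (-1 : K).
pose M : 'M[K]_4 := \matrix_(r, j)
  if r == i0 then S i0 j + s * S i1 j else if r == i3 then S i0 j + - s * S i1 j
  else if r == i1 then - S i2 j + - s * S i3 j else S i2 j + - s * S i3 j.
exists M; apply/mpolyP => m; rewrite mcoeffB !mcoeff_lin.
have Zl c (u v : 'I_4 -> K) : cf (fun j => c * u j) v m = c * cf u v m by rewrite cfC cfZ cfC.
have sq (a b : 'I_4 -> K) : cf (fun j => 1 * a j + s * b j) (fun j => 1 * a j + - s * b j) m =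
    cf a a m + cf b b m.
  rewrite cf_lin ![cf (fun j => 1 * a j + _) _ _]cfC !cf_lin (cfC b a).
  have E : cf b b m = - (s ^+ 2) * cf b b m by rewrite hs opprK mul1r.
  by rewrite [in RHS]E; ring.
pose row r : 'I_4 -> K := fun j => S r j.
rewrite (@eq_cf _ (M i0) (fun j => 1 * row i0 j + s * row i1 j) (M i3) (fun j => 1 * row i0 j + - s * row i1 j)).
- rewrite (@eq_cf _ (M i1) (fun j => -1 * (1 * row i2 j + s * row i3 j)) (M i2) (fun j => 1 * row i2 j + - s * row i3 j)).
  + rewrite Zl !sq mulN1r opprK addrA.
    have [/eqP /mdeg2P [i [j ->]]|dm] := boolP (mdeg m == 2%N); last first.
      have z (u v : 'I_4 -> K) : cf u v m = 0.
        by apply: big1 => i _; apply: big1 => j _; case: eqP => // E; rewrite -E mdegD !mdeg1 in dm.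
      by rewrite !z !addr0; apply/eqP; rewrite mcoeff_eq0; apply: contra dm => /hf ->.
    have EA : A i j = row i0 i * row i0 j + row i1 i * row i1 j + row i2 i * row i2 j + row i3 i * row i3 j.
      rewrite ES mxE !big_ord_recl big_ord0 addr0 !addrA /row !mxE.
      by do !congr (_ + _); congr (S _ _ * S _ _); apply: val_inj.
    move: EA; rewrite mxE; have [<-|ij] := eqVneq i j; first by rewrite mul1r !cf_diag.
    rewrite !cf_pair // => /(congr1 ( *%R 2%:R)); rewrite mulrA mulfV // mul1r => ->.
    by ring.
  + by move=> j; rewrite mxE /= /row; ring.
  by move=> j; rewrite mxE /= /row; ring.
- by move=> j; rewrite mxE /= /row; ring.
by move=> j; rewrite mxE /= /row; ring.
Qed.

(** * The graph of an arbitrary smooth quadric *)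

Lemma digits_inj D n (f g : 'I_n -> nat) : (forall i, f i < D)%N -> (forall i, g i < D)%N ->
  (\sum_(i < n) f i * D ^ i = \sum_(i < n) g i * D ^ i)%N -> f =1 g.
Proof.
elim: n f g => [|n IH] f g hf hg; first by move=> _ [].
have D0 : (0 < D)%N by apply: leq_ltn_trans (hf ord0).
have E (h : 'I_n.+1 -> nat) :
    (\sum_(i < n.+1) h i * D ^ i = (\sum_(i < n) h (lift ord0 i) * D ^ i) * D + h ord0)%N.
  rewrite big_ord_recl muln1 addnC big_distrl /=; congr (_ + _)%N.
  by apply: eq_bigr => i _; rewrite -mulnA -expnSr.
rewrite !E => H; have H0 : f ord0 = g ord0.
  by move/(congr1 (modn^~ D)): H; rewrite !modnMDl !modn_small.
move/(congr1 (divn^~ D)): H; rewrite !divnMDl // !divn_small // !addn0 => /IH H i.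
by case: (unliftP ord0 i) => [j|] -> //; apply: H.
Qed.

(* Kronecker substitution: X_i is sent to X^(D^i). *)
Lemma mpoly_nonroot (K : closedFieldType) n (p : {mpoly K[n]}) : p != 0 ->
  exists x : 'I_n -> K, p.@[x] != 0.
Proof.
move=> p0; pose D := msize p; pose kr := mmap (@polyC K) (fun i : 'I_n => 'X^(D ^ i)).
have mD m : m \in msupp p -> forall i, (m i < D)%N.
  by move=> /msize_mdeg_lt mp i; apply: leq_ltn_trans mp; rewrite mdegE (bigD1 i) //= leq_addr.
have kX m : mmap1 (fun i : 'I_n => 'X^(D ^ i) : {poly K}) m = 'X^(\sum_(i < n) m i * D ^ i)%N.
  rewrite /mmap1 -prodrXr; apply: eq_bigr => i _; by rewrite -exprM mulnC.
have [m0 m0p] : exists m, m \in msupp p.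
  by move: p0; rewrite -msupp_eq0; case: (msupp p) => // m s _; exists m; rewrite inE eqxx.
have /closed_nonrootP [x] : kr p != 0.
  pose code (m : 'X_{1..n}) := (\sum_(i < n) m i * D ^ i)%N.
  apply/eqP => /(congr1 (fun q : {poly K} => q`_(code m0))); rewrite coef0 /kr /mmap coef_sum.
  have c0 m : m \in msupp p -> m != m0 -> ((p@_m)%:P * mmap1 (fun i : 'I_n => 'X^(D ^ i)) m)`_(code m0) = 0.
    move=> mp mm0; rewrite kX -/(code m) coefCM coefXn; case: eqP; rewrite ?mulr0 // => E.
    case/eqP: mm0; apply/mnmP => i; apply/esym; move: i; apply: (@digits_inj D) => //; exact: mD.
  rewrite (bigD1_seq m0) ?msupp_uniq //= big_seq_cond [X in _ + X]big1 => [|m /andP []]; last exact: c0.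
  by rewrite addr0 kX coefCM coefXn eqxx mulr1 => /eqP; rewrite mcoeff_eq0 m0p.
move=> rx; exists (fun i : 'I_n => x ^+ (D ^ i)); apply: contra rx => /eqP E.
apply/eqP; rewrite -[RHS]E; rewrite -[LHS]/((horner_eval x \o kr) p); apply: rmorph_mpoly_eq => [c|i] /=.
  by rewrite /horner_eval /kr mmapC hornerC mevalC.
by rewrite /horner_eval /kr mmapX mmap1U hornerXn mevalXU.
Qed.

(** A nonzero kernel vector of M is a common zero of the four linear forms, at which f and all its
    derivatives vanish. *)
Lemma lin_unit (K : fieldType) (f : {mpoly K[4]}) (M : 'M[K]_4) :
  f = lin (M i0) * lin (M i3) - lin (M i1) * lin (M i2) ->
  @smooth_hypersurface K 3 f -> M \in unitmx.
Proof.
move=> Ef sf; rewrite -unitmx_tr -row_free_unit -kermx_eq0.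
apply: NNPP => /negP /rowV0Pn [u /sub_kermxP uM u0].
pose x (j : 'I_4) := u 0 j.
have lx r : (lin (M r)).@[x] = 0.
  have := congr1 (fun A : 'rV_4 => A 0 r) uM; rewrite !mxE => E; rewrite -[RHS]E.
  rewrite /lin raddf_sum; apply: eq_bigr => j _ /=.
  by rewrite mevalZ mevalXU mxE mulrC.
have [j xj] : exists j, x j != 0.
  by move: u0 => /matrix0Pn [i [j]]; rewrite ord1; exists j.
have [] := sf x (ex_intro _ j xj).
  by rewrite Ef mevalB !mevalM !lx !mul0r subrr.
move=> k /eqP; apply.
by rewrite Ef mderivB !mderivM mevalB !mevalD !mevalM !lx !(mul0r, mulr0, addr0) subrr.
Qed.

Lemma precomp_coef (K : fieldType) (f : {mpoly K[4]}) (M : 'M[K]_4) :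
  f = lin (M i0) * lin (M i3) - lin (M i1) * lin (M i2) -> forall phi m,
  (@precomp K 3 f phi)@_m = detf (M *m phi) m.
Proof.
move=> -> phi m; rewrite /precomp rmorphB !rmorphM /=.
have E r : lin (M r) \mPo [tuple \sum_(j < 4) phi i j *: 'X_j | i < 4] = lin ((M *m phi) r).
  rewrite /lin raddf_sum /= (eq_bigr (fun i => \sum_j (M r i * phi i j) *: 'X_j)).
    by rewrite exchange_big; apply: eq_bigr => j _ /=; rewrite -scaler_suml mxE.
  move=> i _; rewrite comp_mpolyZ comp_mpolyXU -tnth_nth tnth_mktuple scaler_sumr.
  by apply: eq_bigr => j _; rewrite scalerA.
by rewrite !E mcoeffB !mcoeff_lin.
Qed.

(** * Transport from the normal form *)

Section Final.
Variables (K : closedFieldType) (f : {mpoly K[4]}) (M : 'M[K]_4).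
Hypothesis Ef : f = lin (M i0) * lin (M i3) - lin (M i1) * lin (M i2).
Hypothesis uM : M \in unitmx.
Local Notation S := {mpoly K[4 * 4 + NY]}.
Local Notation grM := (graph_hom K \o chi (invmx M)).

Lemma graph_eval (phi : 'M[K]_4) (q : S) :
  q.@[bipoint (@end_coords K 3 phi) (@form_coords K 3 2 (@precomp K 3 f phi))] =
  (grM q).@[mxvec (M *m phi) 0].
Proof.
have gx r j : (genX K r j).@[mxvec (M *m phi) 0] = (M *m phi) r j.
  by rewrite mevalXU mxvecE.
rewrite -[RHS]/((meval (mxvec (M *m phi) 0) \o grM) q).
apply: rmorph_mpoly_eq => [c|].
  by rewrite /= mevalC chiC [graph_hom _ c%:MP]homC mevalC.
apply: var_ind => [r j|j] /=; rewrite mevalXU.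
  rewrite /bipoint (unsplitK (inl _)) /end_coords mxvecE chi_x.
  rewrite -{1}[phi](mulKmx uM) mxE (rmorph_sum (graph_hom K)).
  rewrite (raddf_sum (meval (mxvec (M *m phi) 0))); apply: eq_bigr => i _ /=.
  by rewrite graph_homZ mevalZ graph_hom_x gx.
rewrite /bipoint (unsplitK (inr _)) /form_coords chi_y graph_hom_y detf_morph.
rewrite (precomp_coef Ef) /detf.
by congr (_ - _); apply: eq_cf => k; apply/esym; exact: gx.
Qed.

(** If the pullback of a form to the ring in x is nonzero, so is its product with a nonzero
    coefficient of [detf]. A point where this product does not vanish is a matrix at which the
    rational map is defined and the form is nonzero on the graph. *)
Lemma graph_closureE : @graph_closure K 3 2 f = bker grM.
Proof.
apply: functional_extensionality => p; apply: propositional_extensionality; split=> H e.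
  apply: NNPP => /eqP nz.
  have [_ _ _ _ [j Hj]] := model_graph_subv K.
  have dj : detf (genX K) (quad j) != 0.
    by apply: contra_not_neq Hj => E; apply/(bkerE (graph_hom K) (@bihomog_y K (4 * 4) NY j)); rewrite graph_hom_y.
  have [x] := mpoly_nonroot (mulf_neq0 nz dj); rewrite mevalM mulf_eq0 negb_or => /andP [nx ndx].
  pose phi := invmx M *m vec_mx (\row_k x k).
  have Ex : mxvec (M *m phi) 0 =1 x by move=> k; rewrite mulKVmx // vec_mxK mxE.
  have prec : @precomp K 3 f phi != 0.
    have E : (detf (genX K) (quad j)).@[x] = (@precomp K 3 f phi)@_(quad j).
      rewrite (precomp_coef Ef) [LHS]detf_morph /detf.
      by congr (_ - _); apply: eq_cf => k; rewrite [LHS]mevalXU -Ex mxvecE.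
    by apply: contra ndx => /eqP pz; rewrite E pz mcoeff0.
  have phi0 : phi != 0.
    apply: contra prec => /eqP ->; apply/eqP/mpolyP => m; rewrite mcoeff0 (precomp_coef Ef).
    have z u v : cf ((M *m (0 : 'M[K]_4)) u) ((M *m (0 : 'M[K]_4)) v) m = 0.
      by rewrite /cf big1 // => i _; rewrite big1 // => k _; rewrite mulmx0 !mxE mul0r; case: ifP.
    by rewrite /detf !z subrr.
  have := H e _ _ (ex_intro _ phi (And4 phi0 prec (erefl _) (erefl _))).
  by rewrite graph_eval (meval_eq _ Ex) => /eqP; apply/negP.
by move=> x y [phi [_ _ -> ->]]; rewrite graph_eval H meval0.
Qed.

Lemma chi_subv : subvariety (bker grM).
Proof.
have [_ _ _ [i Hi] [j Hj]] := model_graph_subv K.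
have [iP P1' pP] : is_prime (bker grM) by exact: bker_prime.
split; [exact: iP|exact: P1'|exact: pP| |].
  apply: NNPP => H; apply: Hi; case/mxvec_indexP: i => r k.
  apply/(bkerE (graph_hom K) (@bihomog_x K (4 * 4) NY (mxvec_index r k))).
  have Hx q : grM 'X_(vx q k) = 0.
    apply/(bkerE grM (@bihomog_x K (4 * 4) NY (mxvec_index q k))).
    by apply: NNPP => H'; apply: H; exists (mxvec_index q k).
  rewrite -/(vx r k) -[X in graph_hom K X]chi1 -(mulmxV uM) -chiM chi_x.
  rewrite (rmorph_sum (chi (invmx M))) (rmorph_sum (graph_hom K)); apply: big1 => q _.
  rewrite -mul_mpolyC rmorphM (rmorphM (graph_hom K)) [X in _ * X](Hx q); exact: mulr0.
exists j; move/(bkerE grM (@bihomog_y K (4 * 4) NY j)) => /= H; apply: Hj.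
by apply/(bkerE (graph_hom K) (@bihomog_y K (4 * 4) NY j)); rewrite -H chi_y.
Qed.

Lemma graph_intersection i : (i <= 15)%N ->
  intersection_number (degs 15 i) (@graph_closure K 3 2 f) (predegree i).
Proof.
move=> i15; rewrite graph_closureE; have sV := chi_subv.
have E : hilz (bker grM) = hilz (@model_graph K).
  apply: functional_extensionality => m; apply: functional_extensionality => n.
  by rewrite /hilz (hil_chi (graph_hom K)) // unitmx_inv.
apply: intersection_number_lim; [exact: std_degs_degs|exact: sV| |].
  by rewrite (size_degs i15); exact: (dimlt_model_graph sV E).
by rewrite E; exact: dlim_model_graph.
Qed.

End Final.

Theorem theorem1p1 (K : closedFieldType) (charK : [pchar K] =i pred0)
    (f : {mpoly K[4]}) (fhom : f \is 2.-homog)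
    (fsmooth : @smooth_hypersurface K 3 f) :
  @is_predegree_polynomial K 3 2 f
    (1 + 2 *: 'X + 4 *: 'X^2 + 8 *: 'X^3 + 16 *: 'X^4 + 32 *: 'X^5
       + 64 *: 'X^6 + 112 *: 'X^7 + 140 *: 'X^8 + 40 *: 'X^9).
Proof.
have two : (2%:R : K) != 0 by move/pcharf0P: charK => ->.
have [M EM] := quadric_form two fhom.
exists predegree; split=> [i i15|].
  exact: (graph_intersection EM (lin_unit EM fsmooth)).
rewrite !big_ord_recr big_ord0 /= !scale0r !addr0 add0r expr0 expr1 scale1r.
by [].
Qed.
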